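(* (Discrete Sobolev inequality.) Assume that the family $\{\mathcal{T}_h\}_h$ satisfies the inverse assumption and the acuteness condition. For every $q>d/2$ and $\alpha\in(d/(2q),1)$ there exists $C>0$ independent of $h$ such that $$\|v_h\|_{L^\infty}\le C\,\|(-A_h)^\alpha v_h\|_{L^q}$$ for all $v_h\in S_h$.
   Context: $\Omega\subset\mathbb{R}^d$, $d\in\{2,3\}$, is a bounded polygonal or polyhedral domain. All functions are complex-valued; $L^q=L^q(\Omega)$, $W^{s,q}=W^{s,q}(\Omega)$, $W^{1,q}_0=\{v\in W^{1,q}: v|_{\partial\Omega}=0\}$. Shape assumption on $\Omega$ (standing): there is a fixed $\mu>d$ such that for every $q\in(1,\mu)$ there is $C>0$, depending only on $\Omega$ and $q$, with $\|v\|_{W^{2,q}}\le C\|\Delta v\|_{L^q}$ for all $v\in W^{2,q}\cap W^{1,q}_0$. Triangulations: $\{\mathcal{T}_h\}_h$ is a fixed family of triangulations of $\Omega$: each $\mathcal{T}_h$ consists of open triangles ($d=2$) or tetrahedra ($d=3$) $K\subset\Omega$ with $\Omega=\operatorname{Int}\bigcup_{K\in\mathcal{T}_h}\overline K$, any two elements meeting only in entire common faces (when $d=3$), sides or vertices; $h_K$ is the diameter of $K$ and $h=\max_{K\in\mathcal{T}_h}h_K$. Regularity (standing): there is $\nu>0$ with $h_K\le\nu\rho_K$ for all $K\in\mathcal{T}_h$ and all $h$, $\rho_K$ being the radius of the inscribed circle or sphere of $K$. $V_h$ is the space of continuous functions on $\Omega$ affine on each $K\in\mathcal{T}_h$; $P_1,\dots,P_{\overline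 N_h}$ are the nodes of $\mathcal{T}_h$, of which $P_1,\dots,P_{N_h}$ are the interior ones; $\phi_j\in V_h$ is the nodal basis function, $\phi_j(P_i)=\delta_{ij}$; $S_h=\{v_h\in V_h: v_h|_{\partial\Omega}=0\}=\operatorname{span}\{\phi_j\}_{j=1}^{N_h}$. Inverse assumption: there is $\gamma>0$ with $h\le\gamma h_K$ for all $K\in\mathcal{T}_h$ and all $h$. Acuteness condition: for each $h$ and all $i\ne j$ in $\{1,\dots,\overline N_h\}$, $\int_\Omega\nabla\phi_i\cdot\nabla\phi_j\,dx\le0$. Mass-lumping: $\Lambda_j$ is the barycentric domain of $P_j$, i.e. (up to null sets) the union over elements $K$ having $P_j$ as a vertex of the points of $K$ at which the barycentric coordinate associated with $P_j$ is the largest one; $\chi_j$ is its characteristic function; $M_hv_h=\sum_{j=1}^{N_h}v_h(P_j)\chi_j$ for $v_h\in S_h$; $(u_h,v_h)_h=(M_hu_h,M_hv_h)_{L^2}$. The discrete Laplacian with mass-lumping $A_h:S_h\to S_h$ is defined by $(A_hu_h,v_h)_h=-(\nabla u_h,\nabla v_h)_{L^2}$ for all $v_h\in S_h$. Fractional powers: for $z\in(0,1)$, $(-A_h)^{-z}v_h=\frac{\sin(\pi z)}{\pi}\int_0^\infty t^{-z}(tI-A_h)^{-1}v_h\,dt$, and $(-A_h)^z$ is the inverse of $(-A_h)^{-z}$. *)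

(* Defs.v *)
From HB Require Import structures.
From mathcomp Require Import all_boot all_order all_algebra.
From mathcomp Require Import all_classical all_reals all_analysis.
From mathcomp Require Import complex.

Set Implicit Arguments.
Unset Strict Implicit.
Unset Printing Implicit Defensive.

Import Order.TTheory GRing.Theory Num.Theory.
Import numFieldNormedType.Exports.
Local Open Scope classical_set_scope.
Local Open Scope ring_scope.

Definition rV_display : measure_display. Proof. exact. Qed.

Section MeasurableRow.
Context {R : realType} (n : nat).

Definition rV_coord (i : 'I_n) (x : 'rV[R]_n) : measurableTypeR R := x ord0 i.

Let rV_set0 : g_sigma_preimage rV_coord set0.
Proof. exact: sigma_algebra0. Qed.

Let rV_setC A : g_sigma_preimage rV_coord A -> g_sigma_preimage rV_coord (~` A).
Proof. exact: sigma_algebraC. Qed.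

Let rV_bigcup (F : (set 'rV[R]_n)^nat) :
  (forall i, g_sigma_preimage rV_coord (F i)) ->
  g_sigma_preimage rV_coord (\bigcup_i F i).
Proof. exact: sigma_algebra_bigcup. Qed.

(* The Borel sets of R^n, generated by the coordinates as in the library's
   instance on n.-tuple. *)
HB.instance Definition _ := @isMeasurable.Build rV_display 'rV[R]_n
  (g_sigma_preimage rV_coord) rV_set0 rV_setC rV_bigcup.

Lemma measurable_rV_coord i : measurable_fun setT (rV_coord i).
Proof.
move=> _ Y mY; rewrite setTI; apply: sub_sigma_algebra => /=.
rewrite -bigcup_seq/=; exists i => /=; first by rewrite mem_index_enum.
by exists Y => //; rewrite setTI.
Qed.

Lemma measurable_fun_rVP d (T : measurableType d) (f : T -> 'rV[R]_n) :
  measurable_fun setT f <->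
  forall i, measurable_fun setT (rV_coord i \o f).
Proof.
split=> [mf i|mf]; first exact: measurableT_comp (measurable_rV_coord i) mf.
suff sub : g_sigma_preimage rV_coord `<=` [set B | measurable (f @^-1` B)].
  by move=> _ A mA; rewrite setTI; exact: sub.
apply: smallest_sub.
- split; first by rewrite /= preimage_set0.
  + by move=> B mB /=; rewrite setTD preimage_setC; exact: measurableC.
  + by move=> F mF /=; rewrite preimage_bigcup; exact: bigcupT_measurable.
- move=> B; rewrite -bigcup_seq => -[i _ [Y mY <-]] /=.
  by have := mf i measurableT Y mY; rewrite !setTI.
Qed.

End MeasurableRow.

Section LebesgueMeasureRn.
Context {R : realType}.

Definition rV_cons n (p : measurableTypeR R * 'rV[R]_n) : 'rV[R]_n.+1 :=
  row_mx (p.1)%:M p.2.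

Definition rV_uncons n (x : 'rV[R]_n.+1) : measurableTypeR R * 'rV[R]_n :=
  (x ord0 ord0, \row_j x ord0 (lift ord0 j)).

Lemma rV_consK n : cancel (@rV_cons n) (@rV_uncons n).
Proof.
move=> [a x]; rewrite /rV_cons /rV_uncons /=; congr pair.
  have e := @row_mxEl _ 1 1 n a%:M x ord0 ord0.
  rewrite [RHS]mxE eqxx mulr1n in e; rewrite -[RHS]e.
  by congr (row_mx _ _ _ _); exact: val_inj.
apply/rowP => j; rewrite [LHS]mxE -(@row_mxEr _ 1 1 n a%:M x ord0 j).
by congr (row_mx _ _ _ _); exact: val_inj.
Qed.

Lemma measurable_rV_cons n : measurable_fun setT (@rV_cons n).
Proof.
apply/measurable_fun_rVP => i.
have [j ->|j ->] := @split_ordP 1 n i.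
- rewrite (_ : _ \o _ = fst) //.
  apply/funext => p; apply: etrans (@row_mxEl _ 1 1 n _ _ ord0 j) _.
  by rewrite mxE !ord1 eqxx mulr1n.
- rewrite (_ : _ \o _ = rV_coord j \o snd).
    exact: measurableT_comp (measurable_rV_coord j) measurable_snd.
  by apply/funext => p; apply: etrans (@row_mxEr _ 1 1 n _ _ ord0 j) _.
Qed.

Lemma measurable_rV_uncons n : measurable_fun setT (@rV_uncons n).
Proof.
apply/measurable_fun_pairP; split => /=.
  exact: (measurable_rV_coord ord0).
apply/measurable_fun_rVP => i.
rewrite (_ : _ \o _ = rV_coord (lift ord0 i)).
  exact: measurable_rV_coord.
by apply/funext => p; rewrite /= /rV_coord mxE.
Qed.

Section Step.
Context (n : nat) (m : {sigma_finite_measure set 'rV[R]_n -> \bar R}).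

Definition rV_measure_step : set 'rV[R]_n.+1 -> \bar R :=
  pushforward (lebesgue_measure \x m)%E (@rV_cons n).

Let step0 : rV_measure_step set0 = 0%E.
Proof. by rewrite /rV_measure_step /pushforward preimage_set0 measure0. Qed.

Let step_ge0 A : (0 <= rV_measure_step A)%E.
Proof.
apply: (@measure_ge0 _ _ _ (pushforward (lebesgue_measure \x m)%E _)).
exact: measurable_rV_cons.
Qed.

Let step_sigma_additive : semi_sigma_additive rV_measure_step.
Proof.
apply: (@measure_semi_sigma_additive _ _ _ (pushforward (lebesgue_measure \x m)%E _)).
exact: measurable_rV_cons.
Qed.

HB.instance Definition _ := isMeasure.Build _ _ _ rV_measure_step
  step0 step_ge0 step_sigma_additive.

Let step_sigma_finite : sigma_finite setT rV_measure_step.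
Proof.
have /sigma_finiteP[F [TF ndF Foo]] := sigma_finiteT (@lebesgue_measure R).
have /sigma_finiteP[G [TG ndG Goo]] := sigma_finiteT m.
exists (fun k => @rV_uncons n @^-1` (F k `*` G k)).
  rewrite -preimage_bigcup (_ : \bigcup_k _ = setT) ?preimage_setT//.
  rewrite -subTset -setXTT TF TG => -[x y] [/= [k _ Fkx] [l _ Gly]].
  exists (maxn k l) => //; split.
  - by move: x Fkx; exact/subsetPset/ndF/leq_maxl.
  - by move: y Gly; exact/subsetPset/ndG/leq_maxr.
move=> k; have [mF Fk] := Foo k; have [mG Gk] := Goo k; split.
  rewrite -[X in measurable X]setTI; apply: measurable_rV_uncons => //.
  exact: measurableX.
rewrite /rV_measure_step /pushforward -comp_preimage.
rewrite (_ : _ \o _ = id); last by apply/funext => p; exact: rV_consK.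
by rewrite preimage_id product_measure1E// lte_mul_pinfty// ge0_fin_numE.
Qed.

HB.instance Definition _ := Measure_isSigmaFinite.Build _ _ _ rV_measure_step
  step_sigma_finite.

End Step.
(* Lebesgue measure on R^n, through R^(n+1) = R x R^n. *)
Fixpoint lebesgue_rV n : {sigma_finite_measure set 'rV[R]_n -> \bar R} :=
  match n with
  | 0 => dirac (0 : 'rV[R]_0)
  | n'.+1 => rV_measure_step (lebesgue_rV n')
  end.
End LebesgueMeasureRn.

Section ComplexFunctions.
Context {R : realType}.

Definition re_fun (T : Type) (f : T -> R[i]) : T -> R := fun x => complex.Re (f x).
Definition im_fun (T : Type) (f : T -> R[i]) : T -> R := fun x => complex.Im (f x).

Definition cmeasurable disp (T : measurableType disp) (D : set T)
    (f : T -> R[i]) :=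
  measurable_fun D (re_fun f) /\ measurable_fun D (im_fun f).

Definition cintegrable disp (T : measurableType disp)
    (mu : {measure set T -> \bar R}) (D : set T) (f : T -> R[i]) :=
  mu.-integrable D (EFin \o re_fun f) /\ mu.-integrable D (EFin \o im_fun f).

Definition cintegral disp (T : measurableType disp)
    (mu : {measure set T -> \bar R}) (D : set T) (f : T -> R[i]) : R[i] :=
  Complex (Rintegral mu D (re_fun f)) (Rintegral mu D (im_fun f)).

Definition ccontinuous_on (T : topologicalType) (D : set T) (f : T -> R[i]) :=
  {within D, continuous (re_fun f)} /\ {within D, continuous (im_fun f)}.

End ComplexFunctions.

Section Geometry.
Context {R : realType} {d : nat}.
Local Notation Rd := 'rV[R]_d.

(* The library norm of 'rV[R]_d is the sup norm, which induces the same
   topology; diameters and balls are Euclidean. *)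
Definition eucl_norm (x : Rd) : R := Num.sqrt (\sum_(i < d) x ord0 i ^+ 2).

Definition diameter (A : set Rd) : R :=
  sup [set r | exists x y, [/\ A x, A y & r = eucl_norm (x - y)]].

(* For a simplex, the largest inscribed ball is the one tangent to all faces. *)
Definition inradius (A : set Rd) : R :=
  sup [set r | 0 <= r /\
    exists x, [set y | eucl_norm (y - x) < r] `<=` A].

Definition boundary (A : set Rd) : set Rd := closure A `\` A°.

Definition affinely_independent (I : finType) (p : I -> Rd) (c : {set I}) :=
  forall l : I -> R, \sum_(a in c) l a = 0 -> \sum_(a in c) l a *: p a = 0 ->
  {in c, forall a, l a = 0}.

Definition barycentric (I : finType) (p : I -> Rd) (c : {set I}) (x : Rd)
    (l : I -> R) :=
  \sum_(a in c) l a = 1 /\ x = \sum_(a in c) l a *: p a.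

Definition open_simplex (I : finType) (p : I -> Rd) (c : {set I}) : set Rd :=
  [set x | exists2 l, barycentric p c x l & {in c, forall a, 0 < l a}].

Definition closed_simplex (I : finType) (p : I -> Rd) (c : {set I}) : set Rd :=
  [set x | exists2 l, barycentric p c x l & {in c, forall a, 0 <= l a}].

(* Polygonal for d = 2, polyhedral for d = 3. *)
Definition bounded_polyhedral_domain (Omega : set Rd) :=
  [/\ open Omega, connected Omega, Omega !=set0, bounded_set Omega &
    exists (m : nat) (p : 'I_m -> 'I_d.+1 -> Rd),
      (forall k, affinely_independent (p k) [set: 'I_d.+1]%SET) /\
      Omega = (\bigcup_k closed_simplex (p k) [set: 'I_d.+1]%SET)°].

End Geometry.

Section SobolevSpaces.
Context {R : realType} {d : nat}.
Local Notation Rd := 'rV[R]_d.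
Local Notation leb := (lebesgue_rV d : {measure set 'rV[R]_d -> \bar R}).

Definition partial (i : 'I_d) (f : Rd -> R) : Rd -> R :=
  fun x => 'D_(delta_mx ord0 i) f x.

Definition mpartial (b : 'I_d -> nat) (f : Rd -> R) : Rd -> R :=
  foldr (fun i g => iter (b i) (partial i) g) f (enum 'I_d).

Definition smooth (f : Rd -> R) :=
  forall (s : seq 'I_d) x, differentiable (foldr partial f s) x.

Context (Omega : set Rd).

Definition test_function (f : Rd -> R) :=
  smooth f /\ exists K, [/\ compact K, K `<=` Omega & forall x, ~ K x -> f x = 0].

Definition Lq_norm (p : \bar R) (f : Rd -> R[i]) : \bar R :=
  Lnorm leb p ((fun x => (Normc.normc (f x))%:E) \_ Omega).

Definition in_Lq (p : \bar R) (f : Rd -> R[i]) :=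
  cmeasurable Omega f /\ (Lq_norm p f < +oo)%E.

Definition locally_cintegrable (f : Rd -> R[i]) :=
  forall K, compact K -> K `<=` Omega -> cintegrable leb K f.

Definition is_weak_deriv (b : 'I_d -> nat) (f g : Rd -> R[i]) :=
  [/\ locally_cintegrable f, locally_cintegrable g &
    forall phi, test_function phi ->
      cintegral leb Omega (fun x => f x * (mpartial b phi x)%:C%C) =
      (-1) ^+ (\sum_(i < d) b i)%N *
      cintegral leb Omega (fun x => g x * (phi x)%:C%C)].

(* Unique up to null sets when it exists; all its uses below are invariant
   under modification on null sets. *)
Definition weak_deriv (b : 'I_d -> nat) (f : Rd -> R[i]) : Rd -> R[i] :=
  xget (cst 0) [set g | is_weak_deriv b f g].

Definition in_sobolev (k : nat) (q : R) (f : Rd -> R[i]) :=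
  in_Lq q%:E f /\
  forall b : 'I_d -> nat, (\sum_(i < d) b i <= k)%N ->
    exists2 g, is_weak_deriv b f g & in_Lq q%:E g.

Definition sobolev_norm (k : nat) (q : R) (f : Rd -> R[i]) : \bar R :=
  ((\sum_(b : {ffun 'I_d -> 'I_k.+1} | (\sum_(i < d) b i <= k)%N)
     Lq_norm q%:E (weak_deriv (fun i => b i : nat) f) `^ q) `^ q^-1)%E.

(* f = 0 on the boundary in the sense of traces: f is a W^{1,q}-limit of
   functions in W^{1,q} that are continuous on the closure of Omega and vanish
   on its boundary. *)
Definition in_W1q_0 (q : R) (f : Rd -> R[i]) :=
  in_sobolev 1 q f /\
  forall e : R, 0 < e -> exists g : Rd -> R[i],
    [/\ in_sobolev 1 q g, ccontinuous_on (closure Omega) g,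
        forall x, boundary Omega x -> g x = 0 &
        (sobolev_norm 1 q (fun x => (f x - g x)%R) <= e%:E)%E].

Definition laplacian (f : Rd -> R[i]) : Rd -> R[i] :=
  fun x => \sum_(i < d) weak_deriv (fun j => if j == i then 2%N else 0%N) f x.

Definition shape_assumption (mu : R) :=
  forall q : R, 1 < q -> q < mu ->
  exists2 C : R, 0 < C & forall v, in_sobolev 2 q v -> in_W1q_0 q v ->
    (sobolev_norm 2 q v <= C%:E * Lq_norm q%:E (laplacian v))%E.

End SobolevSpaces.

(* An element is coded by the set of (indices of) its d + 1 vertices. *)
Record triangulation (R : realType) (d : nat) (Omega : set 'rV[R]_d) :=
  Triangulation {
    nnodes : nat;
    node : 'I_nnodes -> 'rV[R]_d;
    cells : {set {set 'I_nnodes}};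
    element := fun c : {set 'I_nnodes} => open_simplex node c;
    node_inj : injective node;
    node_in_cell : forall j, exists2 c, c \in cells & j \in c;
    card_cell : forall c, c \in cells -> #|c| = d.+1;
    cell_indep : forall c, c \in cells -> affinely_independent node c;
    element_sub : forall c, c \in cells -> element c `<=` Omega;
    cells_cover : Omega = (\bigcup_(c in [set` cells]) closure (element c))°;
    cells_conform : forall c1 c2, c1 \in cells -> c2 \in cells ->
      closure (element c1) `&` closure (element c2) =
      closed_simplex node (c1 :&: c2)
  }.

Section FiniteElements.
Context {R : realType} {d : nat} {Omega : set 'rV[R]_d}.
Local Notation Rd := 'rV[R]_d.
Local Notation leb := (lebesgue_rV d : {measure set 'rV[R]_d -> \bar R}).
Context (T : triangulation Omega).

Definition mesh_size : R := \big[Num.max/0]_(c in cells T) diameter (element c).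

Definition affine_on (D : set Rd) (v : Rd -> R[i]) :=
  exists (a : 'I_d -> R[i]) (b : R[i]),
    forall x, D x -> v x = b + \sum_(i < d) a i * (x ord0 i)%:C%C.

(* Functions on the closure of Omega, extended by 0 to the whole space so that
   equality of functions is Leibniz equality. *)
Definition V_h : set (Rd -> R[i]) :=
  [set v | [/\ ccontinuous_on (closure Omega) v,
               forall c, c \in cells T -> affine_on (element c) v &
               forall x, ~ closure Omega x -> v x = 0]].

Definition S_h : set (Rd -> R[i]) :=
  [set v | V_h v /\ forall x, boundary Omega x -> v x = 0].

Definition nodal_basis (j : 'I_(nnodes T)) : Rd -> R[i] :=
  xget (cst 0) [set phi | V_h phi /\ forall i, phi (node i) = (i == j)%:R].

(* Elementwise gradient, set to 0 on the (null) union of the element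
   boundaries. *)
Definition gradient (i : 'I_d) (v : Rd -> R[i]) : Rd -> R[i] :=
  let D := \bigcup_(c in [set` cells T]) element c in
  fun x => if x \in D then Complex (partial i (re_fun v) x) (partial i (im_fun v) x)
           else 0.

Definition dirichlet (u v : Rd -> R[i]) : R[i] :=
  cintegral leb Omega
    (fun x => \sum_(i < d) gradient i u x * ((gradient i v x)^*)%C).

Definition acute :=
  forall i j : 'I_(nnodes T), i != j ->
    dirichlet (nodal_basis i) (nodal_basis j) <= 0.

Definition barycentric_domain (j : 'I_(nnodes T)) : set Rd :=
  [set x | exists c l, [/\ c \in cells T, j \in c, element c x,
    barycentric (@node _ _ _ T) c x l & forall a, a \in c -> a != j -> l a < l j]].

(* The sum ranges over the interior nodes. *)
Definition lump (v : Rd -> R[i]) : Rd -> R[i] :=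
  fun x => \sum_(j < nnodes T | node j \in Omega)
    v (node j) * (\1_(barycentric_domain j) x)%:C%C.

Definition lumped_product (u v : Rd -> R[i]) : R[i] :=
  cintegral leb Omega (fun x => lump u x * ((lump v x)^*)%C).

Definition A_h (u : Rd -> R[i]) : Rd -> R[i] :=
  xget (cst 0) [set f | S_h f /\
    forall v, S_h v -> lumped_product f v = - dirichlet u v].

Definition resolvent (t : R) (v : Rd -> R[i]) : Rd -> R[i] :=
  xget (cst 0) [set w | S_h w /\ (fun x => t%:C%C * w x - A_h w x) = v].

(* The integral of an S_h-valued function, evaluated pointwise. *)
Definition neg_frac_power (z : R) (v : Rd -> R[i]) : Rd -> R[i] :=
  fun x => (sin (pi * z) / pi)%:C%C *
    cintegral (@lebesgue_measure R) `]0, +oo[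
      (fun t => (t `^ (- z))%:C%C * resolvent t v x).

Definition frac_power (z : R) (v : Rd -> R[i]) : Rd -> R[i] :=
  xget (cst 0) [set w | S_h w /\ neg_frac_power z w = v].

End FiniteElements.

Section MeshFamilies.
Context {R : realType} {d : nat} {Omega : set 'rV[R]_d} {I : Type}.
Context (T : I -> triangulation Omega).

Definition shape_regular :=
  exists2 nu : R, 0 < nu & forall h c, c \in cells (T h) ->
    diameter (element c) <= nu * inradius (element c).

Definition inverse_assumption :=
  exists2 gamma : R, 0 < gamma & forall h c, c \in cells (T h) ->
    mesh_size (T h) <= gamma * diameter (element c).

End MeshFamilies.

(* Main.v *)
(* Write m_j for the area or volume of Lambda_j and S for the stiffness matrix.
   The resolvent of A_h at t > 0 has the kernel g_k = g_k(t), the Green function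
   solving (t m + S) g_k = delta_k on the interior nodes, and (-A_h)^(-alpha) is
   the integral of t^(-alpha) g_k(t) m_k up to the factor sin(pi alpha) / pi <= 1.
   By Hoelder's inequality it is enough to bound the l^q'(m) norms of the g_k,
   q' = q / (q - 1), by a function of t that is independent of the mesh and
   integrable against t^(-alpha).

   Acuteness makes S a symmetric M-matrix, so that g_k >= 0, t * sum m g_k <= 1,
   and the truncation of g_k between the levels x and 2x has energy at most x.
   A mesh-independent Faber-Krahn inequality
     sum m u^2 <= C m{u <> 0}^th a(u, u),  0 < th <= 2/d,
   turns this into x m{g_k > 2x} <= C m{g_k > x}^th, whence m{g_k > x} decays like
   x^(-1/(1 - th)) and the l^q' norm of g_k like min(1, t^(-1 + 1/(q th))). This is
   integrable against t^(-alpha) as soon as th > 1 / (q alpha), which leaves room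
   below 2/d exactly when alpha > d / (2q).

   The Faber-Krahn inequality is obtained for the interpolant u_h by averaging
   u_h(x) = u_h(x) - u_h(x + z) over z in a cube whose volume is twice that of the
   support of u_h. *)

Require Import Defs.
From mathcomp Require Import all_boot all_order all_algebra.
From mathcomp Require Import all_classical all_reals all_analysis.
From mathcomp Require Import complex.
From mathcomp Require Import measurable_realfun ess_sup_inf.
From mathcomp Require Import ring lra.

Set Implicit Arguments.
Unset Strict Implicit.
Unset Printing Implicit Defensive.

Import Order.TTheory GRing.Theory Num.Theory.
Import numFieldNormedType.Exports.
Local Open Scope classical_set_scope.
Local Open Scope ring_scope.

(** The decay rate 1/(1 - th) forces [th] below 1, while the scale-invariant exponent 2/d equals 1
    when d = 2. The inequality is therefore proved with 2/d and then weakened to a smaller [th], a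
    power of the total mass paying for the difference. The total mass also controls small t, where t
    * sum m g_k <= 1 says little. Uniformity in the mesh rests on volume comparisons inside a single
    simplex: the cap at a vertex fills a fraction of the simplex that depends only on d. This
    compares nodal masses with volumes of patches, and lumped norms with L^q norms. The increment
    u_h(x) - u_h(x + z) is taken along a segment that may leave Omega. It makes sense because u_h,
    extended by 0, is continuous on the whole space and piecewise affine on the segment. The
    discrete operators are introduced by choice among the functions satisfying an equation, so each
    is first identified on nodal values; only then do the matrix estimates apply. *)

Lemma hoelder_sum {R : realType} (I : finType) (P : pred I) (m a b : I -> R)
    (p q : R) :
  (forall i, P i -> 0 <= m i) -> (forall i, P i -> 0 <= a i) ->
  (forall i, P i -> 0 <= b i) -> 0 < p -> 0 < q -> p^-1 + q^-1 = 1 ->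
  \sum_(i | P i) m i * (a i * b i) <=
  (\sum_(i | P i) m i * a i `^ p) `^ p^-1 *
  (\sum_(i | P i) m i * b i `^ q) `^ q^-1.
Proof.
move=> m0 a0 b0 p0 q0 pq.
set A := \sum_(i | P i) m i * a i `^ p; set B := \sum_(i | P i) m i * b i `^ q.
have A0 : 0 <= A by apply: sumr_ge0 => i Pi; rewrite mulr_ge0 ?powR_ge0 ?m0.
have B0 : 0 <= B by apply: sumr_ge0 => i Pi; rewrite mulr_ge0 ?powR_ge0 ?m0.
(* If one of the two norms is 0, one cannot normalize by it, but then every term on the left
   vanishes. *)
have null (c : I -> R) s : 0 < s -> (forall i, P i -> 0 <= c i) ->
    \sum_(i | P i) m i * c i `^ s = 0 -> forall i, P i -> m i * c i = 0.
  move=> s0 c0 /eqP; rewrite psumr_eq0; last first.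
    by move=> i Pi; rewrite mulr_ge0 ?powR_ge0 ?m0.
  move=> /allP cs i Pi; have := cs i (mem_index_enum i); rewrite Pi/=.
  rewrite mulf_eq0 powR_eq0 (gt_eqF s0) andbT => /orP[]/eqP ->;
    by rewrite ?mul0r ?mulr0.
have [A_eq0|A_neq0] := eqVneq A 0.
  rewrite big1 ?mulr_ge0 ?powR_ge0// => i Pi.
  by rewrite mulrA (null a p)// mul0r.
have [B_eq0|B_neq0] := eqVneq B 0.
  rewrite big1 ?mulr_ge0 ?powR_ge0// => i Pi.
  by rewrite [a i * _]mulrC mulrA (null b q)// mul0r.
have {A0}A0 : 0 < A by rewrite lt0r A_neq0.
have {B0}B0 : 0 < B by rewrite lt0r B_neq0.
have root_gt0 (C s : R) : 0 < C -> 0 < s -> 0 < C `^ s^-1 /\ (C `^ s^-1) `^ s = C.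
  by move=> C0 s0; rewrite powR_gt0// -powRrM mulVf ?gt_eqF// powRr1// ltW.
have [] := root_gt0 _ _ A0 p0; have [] := root_gt0 _ _ B0 q0.
move: (A `^ _) (B `^ _) => x y y0 yq x0 xp.
rewrite -[leRHS]mul1r -ler_pdivrMr; last exact: mulr_gt0.
rewrite mulr_suml.
apply: (@le_trans _ _ (\sum_(i | P i)
    (m i * a i `^ p / A / p + m i * b i `^ q / B / q))).
  apply: ler_sum => i Pi.
  have inv_powR (z s : R) : 0 < z -> (z^-1) `^ s = (z `^ s)^-1.
    by move=> z0; rewrite -powR_inv1 ?ltW// -powRrM mulN1r powRN.
  (* Young's inequality for [a i / x] and [b i / y], where [x] and [y] are the two norms; the
     weights add up to 1/p + 1/q = 1. *)
  have /(ler_wpM2l (m0 i Pi)) := conjugate_powR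
    (divr_ge0 (a0 i Pi) (ltW x0)) (divr_ge0 (b0 i Pi) (ltW y0)) p0 q0 pq.
  rewrite !powRM ?invr_ge0 ?a0 ?b0 ?(ltW x0) ?(ltW y0)//.
  rewrite !inv_powR// xp yq.
  rewrite mulrDr invfM !mulrA; apply: le_trans.
  by rewrite le_eqVlt; apply/orP; left; apply/eqP; ring.
by rewrite big_split/= -!mulr_suml -/A -/B !divff// !mul1r pq.
Qed.

(** * Green functions of a graph Laplacian *)

Section EnergyForm.
Context {R : realType} {n : nat}.
Variable S : 'I_n -> 'I_n -> R.
Hypothesis S_sym : forall i j, S i j = S j i.
Hypothesis S_offdiag : forall i j, i != j -> S i j <= 0.
Hypothesis S_row : forall i, \sum_j S i j = 0.

Definition energy (u v : 'I_n -> R) := \sum_i \sum_j S i j * (u i * v j).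

(** Zero row sums cancel the terms u i * v i and u j * v j. Each pair then carries a conductance -S
    i j >= 0, so that the inequalities below can be checked pair by pair. *)
Lemma energyE u v :
  energy u v = - (2^-1 * \sum_i \sum_j S i j * ((u i - u j) * (v i - v j))).
Proof.
have -> : \sum_i \sum_j S i j * ((u i - u j) * (v i - v j)) =
    \sum_i \sum_j S i j * (u i * v i) + \sum_i \sum_j S i j * (u j * v j)
    - (\sum_i \sum_j S i j * (u i * v j) + \sum_i \sum_j S i j * (u j * v i)).
  rewrite -!big_split/= -sumrB; apply: eq_bigr => i _.
  by rewrite -!big_split/= -sumrB; apply: eq_bigr => j _; ring.
have diag : \sum_i \sum_j S i j * (u i * v i) = 0.
  by apply: big1 => i _; rewrite -mulr_suml S_row mul0r.
rewrite diag exchange_big/=.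
rewrite (eq_bigr (fun i => \sum_j S i j * (u i * v i))); last first.
  by move=> i _; apply: eq_bigr => j _; rewrite S_sym.
rewrite diag [X in _ - (_ + X)]exchange_big/=.
rewrite [X in _ - (_ + X)](_ : _ = energy u v); first by rewrite -/(energy u v); field.
by apply: eq_bigr => i _; apply: eq_bigr => j _; rewrite S_sym.
Qed.

(** The differences of [u] and of [T \o u] have the same sign on every pair. [T] may jump, which
    allows indicator functions of level sets as test functions. *)
Lemma energy_homo_ge0 (T : R -> R) u :
  {homo T : x y / x <= y} -> 0 <= energy u (T \o u).
Proof.
move=> Tle; rewrite energyE oppr_ge0 pmulr_rle0 ?invr_gt0//.
apply: sumr_le0 => i _; apply: sumr_le0 => j _.
have [->|ij] := eqVneq i j; first by rewrite subrr mul0r mulr0.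
apply: mulr_le0_ge0; first exact: S_offdiag.
have [uij|/ltW uij] := leP (u i) (u j).
  by rewrite mulr_le0// subr_le0// Tle.
by rewrite mulr_ge0// subr_ge0// Tle.
Qed.

Lemma energy_ge0 u : 0 <= energy u u.
Proof. exact: (@energy_homo_ge0 id). Qed.

(** On every pair (Tx - Ty)^2 <= (x - y)(Tx - Ty). The energy of a truncation is thus bounded by the
    form that appears when the equation for [u] is tested with it. *)
Lemma energy_contract (T : R -> R) u :
  {homo T : x y / x <= y} -> (forall x y, x <= y -> T y - T x <= y - x) ->
  energy (T \o u) (T \o u) <= energy u (T \o u).
Proof.
move=> Tle Tlip; rewrite !energyE lerN2 ler_pM2l ?invr_gt0//.
apply: ler_sum => i _; apply: ler_sum => j _.
have [->|ij] := eqVneq i j; first by rewrite !subrr !mul0r mulr0.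
apply: ler_wnM2l; first exact: S_offdiag.
have [uij|/ltW uij] := leP (u i) (u j) => /=.
  rewrite -[leLHS]mulrNN -[leRHS]mulrNN !opprB.
  by rewrite ler_wpM2r ?subr_ge0 ?Tle ?Tlip.
by rewrite ler_wpM2r ?subr_ge0 ?Tle ?Tlip.
Qed.

End EnergyForm.

Section Resolvent.
Context {R : realType} {n : nat}.
Variables (P : pred 'I_n) (m : 'I_n -> R) (S : 'I_n -> 'I_n -> R).
Hypothesis m_gt0 : forall i, P i -> 0 < m i.
Hypothesis S_sym : forall i j, S i j = S j i.
Hypothesis S_offdiag : forall i j, i != j -> S i j <= 0.
Hypothesis S_row : forall i, \sum_j S i j = 0.

(* The rows and columns of the nodes outside P are those of the identity, so
   that this matrix is the direct sum of t M + S on P and of the identity. *)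
Definition shifted_mx (t : R) : 'M[R]_n :=
  \matrix_(i, j) if P i && P j then t * m i * (i == j)%:R + S i j
                 else (i == j)%:R.

(** Inverting t M + S rather than t + M^-1 S keeps the kernel symmetric; the resolvent is recovered
    by the extra factor [m j]. *)
Definition green (t : R) (i j : 'I_n) : R := invmx (shifted_mx t) i j.

Lemma shifted_mx_sym t : (shifted_mx t)^T = shifted_mx t.
Proof.
apply/matrixP => i j; rewrite !mxE andbC eq_sym S_sym.
by case: ifP => // _; have [->|] := eqVneq i j; rewrite ?mulr0.
Qed.

Lemma shifted_mxE t (u : 'I_n -> R) i : (forall j, ~~ P j -> u j = 0) ->
  \sum_j shifted_mx t i j * u j =
  if P i then t * (m i * u i) + \sum_j S i j * u j else 0.
Proof.
move=> u0; have [Pi|nPi] := boolP (P i).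
  rewrite (eq_bigr (fun j => t * m i * (i == j)%:R * u j + S i j * u j)).
    rewrite big_split/=; congr +%R.
    rewrite (bigD1 i)//= eqxx mulr1 big1 ?addr0 ?mulrA// => j ji.
    by rewrite eq_sym (negbTE ji) mulr0 mul0r.
  move=> j _; rewrite mxE Pi/=; have [Pj|nPj] := boolP (P j).
    by rewrite mulrDl.
  by rewrite u0// !mulr0 addr0.
apply: big1 => j _; rewrite mxE (negbTE nPi)/=.
by have [<-|_] := eqVneq i j; rewrite ?mul0r// u0// mulr0.
Qed.

Lemma shifted_form t (u v : 'I_n -> R) : (forall j, ~~ P j -> u j = 0) ->
  (forall j, ~~ P j -> v j = 0) ->
  \sum_i v i * \sum_j shifted_mx t i j * u j =
  t * \sum_(i | P i) m i * (u i * v i) + energy S u v.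
Proof.
move=> u0 v0; under eq_bigr do rewrite shifted_mxE//.
rewrite /energy exchange_big/= mulr_sumr [X in X + _]big_mkcond/= -big_split/=.
apply: eq_bigr => i _.
have [Pi|nPi] := boolP (P i); last first.
  by rewrite v0// mul0r add0r big1// => j _; rewrite !mulr0.
rewrite mulrDr mulr_sumr; congr +%R; first by ring.
by apply: eq_bigr => j _; rewrite S_sym; ring.
Qed.

(** Coercivity: a kernel vector vanishes outside [P], and testing it against itself gives t * sum m
    u^2 + energy = 0 with both terms nonnegative. *)
Lemma shifted_mx_unit t : 0 < t -> shifted_mx t \in unitmx.
Proof.
move=> t0; rewrite -row_free_unit -kermx_eq0.
apply/eqP/row_matrixP => k; rewrite row0.
have : row k (kermx (shifted_mx t)) *m shifted_mx t = 0.
  by rewrite -row_mul mulmx_ker row0.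
move: (row _ _) => w w0; pose u i := w ord0 i.
have uE i : \sum_j shifted_mx t i j * u j = 0.
  have /rowP/(_ i) := w0; rewrite !mxE => w0i; rewrite -[RHS]w0i.
  by apply: eq_bigr => j _; rewrite -[in LHS]shifted_mx_sym mxE mulrC.
have u0 j : ~~ P j -> u j = 0.
  move=> nPj; rewrite -[RHS](uE j) (bigD1 j)//= mxE (negbTE nPj)/= eqxx mul1r.
  rewrite big1 ?addr0// => i ij.
  by rewrite mxE (negbTE nPj)/= eq_sym (negbTE ij) mul0r.
have := @shifted_form t u u u0 u0.
rewrite big1 => [/esym/eqP|i _]; last by rewrite uE mulr0.
have sq_ge0 i : P i -> 0 <= m i * (u i * u i).
  by move=> Pi; rewrite mulr_ge0 ?(ltW (m_gt0 Pi))// -expr2 sqr_ge0.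
have E0 := energy_ge0 S_sym S_offdiag S_row u.
have sq_sum : 0 <= \sum_(i | P i) m i * (u i * u i) by exact: sumr_ge0.
rewrite paddr_eq0 ?mulr_ge0 ?(ltW t0)// mulf_eq0 (gt_eqF t0)/= => /andP[+ _].
rewrite psumr_eq0// => /allP s0.
apply/rowP => i; rewrite mxE; have [Pi|/u0//] := boolP (P i).
have := s0 i (mem_index_enum i); rewrite Pi/= mulf_eq0 (gt_eqF (m_gt0 Pi))/=.
by rewrite mulf_eq0 orbb => /eqP.
Qed.

Lemma green_sym t i j : green t i j = green t j i.
Proof.
by rewrite /green -[in LHS]shifted_mx_sym -trmx_inv mxE.
Qed.

Lemma shifted_green t i k : 0 < t ->
  \sum_j shifted_mx t i j * green t j k = (i == k)%:R.
Proof.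
move=> t0; have /matrixP/(_ i k) := mulmxV (shifted_mx_unit t0).
by rewrite !mxE.
Qed.

Lemma green_out t i k : 0 < t -> P k -> ~~ P i -> green t i k = 0.
Proof.
move=> t0 Pk nPi; have := @shifted_green t i k t0.
rewrite (bigD1 i)//= mxE (negbTE nPi)/= eqxx mul1r big1 => [|j ji]; last first.
  by rewrite mxE (negbTE nPi)/= eq_sym (negbTE ji) mul0r.
rewrite addr0 => ->; case: eqP => // ik; by rewrite ik Pk in nPi.
Qed.

Lemma green_sum_out t (x : 'I_n -> R) i : 0 < t -> ~~ P i ->
  \sum_(k | P k) green t i k * x k = 0.
Proof. by move=> t0 nPi; apply: big1 => k Pk; rewrite green_out// mul0r. Qed.

Lemma shifted_green_sum t (x : 'I_n -> R) i : 0 < t -> P i ->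
  \sum_j shifted_mx t i j * (\sum_(k | P k) green t j k * x k) = x i.
Proof.
move=> t0 Pi; under eq_bigr do rewrite mulr_sumr.
rewrite exchange_big/= (bigD1 i)//= [X in _ + X]big1 ?addr0 => [|k /andP[_ ki]].
  under eq_bigr do rewrite mulrA.
  by rewrite -mulr_suml shifted_green// eqxx mul1r.
under eq_bigr do rewrite mulrA.
by rewrite -mulr_suml shifted_green// eq_sym (negbTE ki) mul0r.
Qed.

Lemma green_sum_solves t (x : 'I_n -> R) i : 0 < t -> P i ->
  let g j := \sum_(k | P k) green t j k * x k in
  t * (m i * g i) + \sum_j S i j * g j = x i.
Proof.
move=> t0 Pi g; rewrite -[RHS](shifted_green_sum x t0 Pi) shifted_mxE ?Pi// => j.
exact: green_sum_out.
Qed.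

Lemma green_sum_unique t (u : 'I_n -> R) k : 0 < t -> (forall j, ~~ P j -> u j = 0) ->
  u k = \sum_(i | P i) green t k i * (t * (m i * u i) + \sum_j S i j * u j).
Proof.
move=> t0 u0; have /matrixP/(_ k ord0) : invmx (shifted_mx t) *m
    (shifted_mx t *m \col_j u j) = \col_j u j by rewrite mulKmx// shifted_mx_unit.
rewrite !mxE => <-; rewrite [RHS]big_mkcond/=; apply: eq_bigr => i _.
rewrite mxE (eq_bigr (fun j => shifted_mx t i j * u j)); last first.
  by move=> j _; rewrite [X in _ * X]mxE.
by rewrite shifted_mxE//; case: ifP => _ //; rewrite mulr0.
Qed.

(** Weak form of the equation for the Green function. Positivity, the mass bound and the energy of
    the truncations all come from it by choosing [v]. *)
Lemma green_test t k v : 0 < t -> P k -> (forall j, ~~ P j -> v j = 0) ->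
  t * \sum_(i | P i) m i * (green t i k * v i) +
  energy S (green t ^~ k) v = v k.
Proof.
move=> t0 Pk v0; rewrite -shifted_form//; last by move=> j; exact: green_out.
under eq_bigr do rewrite shifted_green//.
rewrite (bigD1 k)//= eqxx mulr1 big1 ?addr0// => i /negbTE ->.
by rewrite mulr0.
Qed.

(** Test with the negative part min(g, 0): both terms on the left are nonnegative and the right side
    is nonpositive, so m * g * min(g, 0) vanishes at each node of [P]. *)
Lemma green_ge0 t i k : 0 < t -> P k -> 0 <= green t i k.
Proof.
move=> t0 Pk; have [Pi|nPi] := boolP (P i); last by rewrite green_out.
pose T (s : R) := Num.min s 0.
have Tle : {homo T : x y / x <= y}.
  by move=> x y xy; rewrite /T le_min ge_min xy/= ge_min lexx orbT.
have := @green_test t k (T \o green t ^~ k) t0 Pk.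
have T0 j : ~~ P j -> (T \o green t ^~ k) j = 0.
  by move=> nPj; rewrite /= green_out// /T minxx.
move=> /(_ T0).
have E0 := energy_homo_ge0 S_sym S_offdiag S_row (green t ^~ k) Tle.
have sq j : P j -> 0 <= m j * (green t j k * (T \o green t ^~ k) j).
  move=> Pj; rewrite mulr_ge0 ?(ltW (m_gt0 Pj))//= /T.
  by rewrite minEle; case: ifP => _; rewrite ?mulr0// -expr2 sqr_ge0.
have sqs : 0 <= \sum_(j | P j) m j * (green t j k * (T \o green t ^~ k) j).
  exact: sumr_ge0.
have Tk : (T \o green t ^~ k) k <= 0 by rewrite /= /T ge_min lexx orbT.
move=> e; have : \sum_(j | P j) m j * (green t j k * (T \o green t ^~ k) j) == 0.
  apply/eqP/le_anti; rewrite sqs andbT -(pmulr_rle0 _ t0).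
  by apply: le_trans Tk; rewrite -e lerDl.
rewrite psumr_eq0// => /allP/(_ i (mem_index_enum i)); rewrite Pi/=.
rewrite mulf_eq0 (gt_eqF (m_gt0 Pi))/= /T minEle.
by have [//|/ltW//] := leP (green t i k) 0; rewrite mulf_eq0 orbb => + /eqP <-.
Qed.

(** Test with the indicator of {g > 0}: its energy against g is nonnegative and its value at [k] is
    at most 1. *)
Lemma green_mass t k : 0 < t -> P k -> t * \sum_(i | P i) m i * green t i k <= 1.
Proof.
move=> t0 Pk; pose T (s : R) : R := (0 < s)%R%:R.
have Tle : {homo T : x y / x <= y}.
  move=> x y xy; rewrite /T ler_nat; case: (ltP 0 x) => // x0.
  by rewrite (lt_le_trans x0 xy).
have T0 j : ~~ P j -> (T \o green t ^~ k) j = 0.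
  by move=> nPj; rewrite /= green_out// /T ltxx.
have := @green_test t k (T \o green t ^~ k) t0 Pk T0.
have E0 := energy_homo_ge0 S_sym S_offdiag S_row (green t ^~ k) Tle.
rewrite (eq_bigr (fun i => m i * green t i k)) => [e|i Pi]; last first.
  rewrite /= /T; congr *%R.
  by have := green_ge0 i t0 Pk; rewrite le_eqVlt => /predU1P[<-|->];
    rewrite ?mul0r ?mulr1.
have : (T \o green t ^~ k) k <= 1 by rewrite /= /T; case: ltP; rewrite ?ler01.
by apply: le_trans; rewrite -e lerDl.
Qed.

End Resolvent.

(** * Decay of distribution functions and dyadic layers *)

Section Layers.
Context {R : realType}.

(** With r = 1/(1 - th), so that 1 + r * th = r, the quantity f(x) = x^r N(x) satisfies f(2x) <= D
    f(x)^th for D = 2^r C. The bound D^r is the fixed point of s |-> D s^th, hence is preserved by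
    doubling x. *)
Lemma dyadic_decay (N : R -> R) (M C th : R) : 0 < th -> th < 1 -> 0 < C ->
  (forall x, 0 <= N x) -> (forall x, N x <= M) ->
  (forall x, 0 < x -> x * N (2 * x) <= C * N x `^ th) ->
  forall x, 0 < x ->
    x `^ (1 - th)^-1 * N x <= (2 `^ (1 - th)^-1 * C) `^ (1 - th)^-1.
Proof.
move=> th0 th1 C0 N0 NM Ndouble.
have : 0 < (1 - th)^-1 by rewrite invr_gt0 subr_gt0.
have : 1 + (1 - th)^-1 * th = (1 - th)^-1.
  by field; rewrite subr_eq0 gt_eqF.
move: (1 - th)^-1 => r rth r0.
have : 0 < 2 `^ r * C by rewrite mulr_gt0// powR_gt0.
move DE : (2 `^ r * C) => D D0; set B := D `^ r.
have B0 : 0 < B by rewrite powR_gt0.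
have step x : 0 < x -> x `^ r * N x <= B -> (2 * x) `^ r * N (2 * x) <= B.
  move=> x0 xB.
  have -> : (2 * x) `^ r * N (2 * x) = 2 `^ r * x `^ (r * th) * (x * N (2 * x)).
    have xr : x `^ r = x * x `^ (r * th).
      by rewrite -[in LHS]rth powRD ?powRr1 ?(ltW x0)// (gt_eqF x0) implybT.
    by rewrite powRM ?(ltW x0)// xr; ring.
  apply: (@le_trans _ _ (2 `^ r * x `^ (r * th) * (C * N x `^ th))).
    by rewrite ler_wpM2l ?mulr_ge0 ?powR_ge0 ?Ndouble.
  have -> : 2 `^ r * x `^ (r * th) * (C * N x `^ th) = D * (x `^ r * N x) `^ th.
    by rewrite powRM ?powR_ge0// -powRrM -DE; ring.
  apply: (@le_trans _ _ (D * B `^ th)).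
    by rewrite ler_pM2l// ge0_ler_powR ?(ltW th0) ?nnegrE ?mulr_ge0 ?powR_ge0 ?(ltW B0).
  rewrite /B -powRrM -[X in X * _](powRr1 (ltW D0)) -powRD ?rth//.
  by rewrite (gt_eqF D0) implybT.
(* The induction starts near 0, where boundedness of [N] makes x^r N(x) small. [M] only determines
   how far to halve and does not enter the final bound. *)
have base : exists2 y, 0 < y & forall x, 0 < x -> x <= y -> x `^ r * N x <= B.
  have M0 : 0 < M + 1 by rewrite ltr_wpDl// (le_trans (N0 0) (NM 0)).
  exists ((B / (M + 1)) `^ r^-1); first by rewrite powR_gt0 ?divr_gt0.
  move=> x x0 xy; apply: (@le_trans _ _ (x `^ r * (M + 1))).
    by rewrite ler_wpM2l ?powR_ge0// (le_trans (NM x)) ?lerDl.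
  rewrite -ler_pdivlMr//; have := xy.
  move=> /(@ge0_ler_powR _ r (ltW r0) _ _); rewrite !nnegrE powR_ge0 (ltW x0).
  move=> /(_ isT isT) /le_trans; apply.
  by rewrite -powRrM mulVf ?gt_eqF// powRr1// divr_ge0 ?ltW.
have [y y0 small] := base => x x0.
have [k xk] : exists k, x / 2 ^+ k <= y.
  exists (Num.bound (x / y)); rewrite ler_pdivrMr ?exprn_gt0//.
  rewrite mulrC -ler_pdivrMr//; apply: ltW.
  apply: (lt_le_trans (archi_boundP _)); first by rewrite divr_ge0 ?ltW.
  by rewrite -natrX ler_nat ltnW// ltn_expl.
elim: k x x0 xk => [|k IH] x x0 xk.
  by apply: small => //; rewrite expr0 divr1 in xk.
have -> : x = 2 * (x / 2) by field.
apply: step; first by rewrite divr_gt0.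
by apply: IH; rewrite ?divr_gt0// -mulrA -invfM -exprS.
Qed.

Lemma geometric_sum_le (x : R) k : 0 <= x -> x < 1 ->
  \sum_(l < k) x ^+ l <= (1 - x)^-1.
Proof.
move=> x0 x1; rewrite -[leRHS]mul1r ler_pdivlMr ?subr_gt0// mulrC.
rewrite -[_ * _]opprK -mulNr opprB -subrX1 opprB.
by rewrite gerBl exprn_ge0.
Qed.

Context {n : nat} (P : pred 'I_n) (m g : 'I_n -> R).
Hypothesis m_ge0 : forall i, P i -> 0 <= m i.

Definition level_mass (x : R) := \sum_(i | P i && (x < g i)) m i.

Lemma level_mass_ge0 x : 0 <= level_mass x.
Proof. by apply: sumr_ge0 => i /andP[/m_ge0]. Qed.

Lemma level_mass_le x : level_mass x <= \sum_(i | P i) m i.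
Proof.
rewrite [leRHS](bigID (fun i => x < g i))/= lerDl.
by apply: sumr_ge0 => i /andP[/m_ge0].
Qed.

(** The layer 2^k K < g <= 2^(k+1) K contributes at most (2^(k+1) K)^p times the mass above 2^k K,
    that is 2^p B (2^k K)^(p - r). These bounds form a geometric series of ratio 2^(p - r) < 1. *)
Lemma sum_powR_above (p r B K : R) : 0 < p -> p < r -> 0 <= B -> 0 < K ->
  (forall x, 0 < x -> x `^ r * level_mass x <= B) ->
  \sum_(i | P i && (K < g i)) m i * g i `^ p <=
  2 `^ p * B / (1 - 2 `^ (p - r)) * K `^ (p - r).
Proof.
move=> p0 pr B0 K0 NB.
have x0 : 0 <= 2 `^ (p - r) :> R by exact: powR_ge0.
have x1 : 2 `^ (p - r) < 1 :> R.
  rewrite -opprB powRN invf_lt1 ?powR_gt0//.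
  have := @gt0_ltr_powR R (r - p) _ 1 2; rewrite powR1; apply;
    by rewrite ?subr_gt0 ?nnegrE ?ltr1n.
have layer k : \sum_(i | P i && (2 ^+ k * K < g i <= 2 ^+ k.+1 * K))
    m i * g i `^ p <= 2 `^ p * B * K `^ (p - r) * (2 `^ (p - r)) ^+ k.
  have K2 : 0 < 2 ^+ k * K by rewrite mulr_gt0 ?exprn_gt0.
  apply: (@le_trans _ _ ((2 ^+ k.+1 * K) `^ p * level_mass (2 ^+ k * K))).
    rewrite /level_mass mulr_sumr big_mkcond [leRHS]big_mkcond/=.
    apply: ler_sum => i _; case: (boolP (P i)) => //= Pi.
    have [ki|] := ltP (2 ^+ k * K) (g i); last by [].
    case: ifP => [/= gk|_]; last by rewrite mulr_ge0 ?powR_ge0 ?m_ge0.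
    rewrite [leRHS]mulrC ler_wpM2l ?m_ge0// ge0_ler_powR ?(ltW p0)// nnegrE.
      by rewrite ltW// (lt_trans K2).
    by rewrite mulr_ge0 ?exprn_ge0// ltW.
  have -> : 2 ^+ k.+1 * K = 2 * (2 ^+ k * K) by rewrite exprS mulrA.
  rewrite powRM ?(ltW K2)//.
  have -> : (2 ^+ k * K) `^ p = (2 ^+ k * K) `^ (p - r) * (2 ^+ k * K) `^ r.
    by rewrite -powRD ?subrK// (gt_eqF K2) implybT.
  rewrite -[leRHS]mulrA.
  have -> : K `^ (p - r) * (2 `^ (p - r)) ^+ k = (2 ^+ k * K) `^ (p - r) :> R.
    rewrite powRM ?exprn_ge0 ?(ltW K0)// mulrC; congr (_ * _).
    by rewrite -(powR_mulrn k x0) -(powR_mulrn k (ler0n R 2)) -!powRrM mulrC.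
  rewrite -!mulrA ler_pM2l ?powR_gt0// [leRHS]mulrC ler_wpM2l ?powR_ge0//.
  exact: NB.
have sum_le k : \sum_(i | P i && (K < g i <= 2 ^+ k * K)) m i * g i `^ p <=
    2 `^ p * B * K `^ (p - r) * \sum_(l < k) (2 `^ (p - r)) ^+ l.
  elim: k => [|k IH].
    rewrite big_ord0 mulr0 big_pred0// => i; rewrite expr0 mul1r.
    by apply/negbTE/negP => /and3P[_ /lt_le_trans h /h]; rewrite ltxx.
  rewrite big_ord_recr/= mulrDr (le_trans _ (lerD IH (layer k)))//.
  rewrite le_eqVlt; apply/orP; left; apply/eqP.
  rewrite (bigID (fun i => g i <= 2 ^+ k * K))/=; congr +%R.
    apply: eq_bigl => i; rewrite -!andbA; congr andb; congr andb.
    apply: andb_idl => gk; rewrite (le_trans gk)// ler_pM2r//.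
    by rewrite ler_eXn2l ?ltr1n.
  apply: eq_bigl => i; rewrite -!andbA -ltNge; congr andb.
  rewrite andbC -andbA; apply/andP/andP => [[-> /andP[->]]//|[gk gk1]].
  split => //; rewrite gk/=; apply: le_lt_trans gk.
  by rewrite ler_peMl ?(ltW K0)// exprn_ege1// ler1n.
have [k gk] : exists k, forall i, g i <= 2 ^+ k * K.
  have [b gb] : exists b, forall i, g i <= b.
    exists (\sum_i `|g i|) => i; rewrite (bigD1 i)//= (le_trans (ler_norm _))//.
    by rewrite lerDl sumr_ge0.
  exists (Num.bound (b / K)) => i; apply: (le_trans (gb i)).
  rewrite -ler_pdivrMr//.
  have [b0|/ltW b0] := leP 0 (b / K); last first.
    by apply: (le_trans b0); rewrite exprn_ge0.
  apply/ltW/(lt_le_trans (archi_boundP b0)).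
  by rewrite -natrX ler_nat ltnW// ltn_expl.
rewrite (eq_bigl (fun i => P i && (K < g i <= 2 ^+ k * K))); last first.
  by move=> i; rewrite gk andbT.
apply: (le_trans (sum_le k)).
rewrite [leRHS]mulrAC ler_wpM2l ?mulr_ge0 ?powR_ge0//.
exact: geometric_sum_le.
Qed.

End Layers.

Section Clip.
Context {R : realType}.
Implicit Types x y z s : R.

(** Monotone and 1-Lipschitz in [s], as [energy_contract] demands of a truncation. *)
Definition clip x s : R := Num.min (Num.max (s - x) 0) x.

Lemma clipE x s : 0 < x ->
  clip x s = if s <= x then 0 else if s <= 2 * x then s - x else x.
Proof.
move=> x0; rewrite /clip; case: (leP s x) => sx.
  by rewrite max_r ?subr_le0// min_l// ltW.
rewrite max_l ?subr_ge0 ?(ltW sx)//; case: (leP s (2 * x)) => s2.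
  by rewrite min_l// lerBlDr; move: s2; rewrite mulr_natl mulr2n.
by rewrite min_r// lerBrDr ltW//; move: s2; rewrite mulr_natl mulr2n.
Qed.

Lemma clip_ge0 x s : 0 < x -> 0 <= clip x s.
Proof. by move=> x0; rewrite /clip le_min le_max lexx orbT ltW. Qed.

Lemma clip_le x s : clip x s <= x.
Proof. by rewrite /clip ge_min lexx orbT. Qed.

Lemma clip_homo x : {homo clip x : y z / y <= z}.
Proof.
move=> y z yz; rewrite /clip le_min !ge_min lexx orbT andbT; apply/orP; left.
by rewrite ge_max !le_max lexx orbT andbT lerD2r yz.
Qed.

Lemma clip_lip x y z : 0 < x -> y <= z -> clip x z - clip x y <= z - y.
Proof.
move=> x0 yz; rewrite !clipE//.
by case: (leP z x); case: (leP y x); case: (leP z (2 * x)); case: (leP y (2 * x)); lra.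
Qed.

End Clip.

(** * Bounds on the Green function from the Faber-Krahn inequality *)

Section GreenBound.
Context {R : realType} {n : nat}.
Variables (P : pred 'I_n) (m : 'I_n -> R) (S : 'I_n -> 'I_n -> R).
Hypothesis m_gt0 : forall i, P i -> 0 < m i.
Hypothesis S_sym : forall i j, S i j = S j i.
Hypothesis S_offdiag : forall i j, i != j -> S i j <= 0.
Hypothesis S_row : forall i, \sum_j S i j = 0.
Variables (C th M : R).
Hypothesis C_gt0 : 0 < C.
Hypothesis th_gt0 : 0 < th.
Hypothesis th_lt1 : th < 1.
Hypothesis mass_le : \sum_(i | P i) m i <= M.
Hypothesis faber_krahn : forall u : 'I_n -> R, (forall i, ~~ P i -> u i = 0) ->
  \sum_(i | P i) m i * u i ^+ 2 <=
  C * (\sum_(i | P i && (u i != 0)) m i) `^ th * energy S u u.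

Local Notation green := (green P m S).

(* The truncation of the Green function between the levels x and 2x has energy
   at most x, and it equals x above the level 2x. *)
Lemma green_level_double t k x : 0 < t -> P k -> 0 < x ->
  x * level_mass P m (green t ^~ k) (2 * x) <=
  C * level_mass P m (green t ^~ k) x `^ th.
Proof.
move=> t0 Pk x0; pose u := clip x \o green t ^~ k.
have u0 j : ~~ P j -> u j = 0.
  by move=> nPj; rewrite /u/= green_out// clipE// ltW.
have u_ge0 j : 0 <= u j by exact: clip_ge0.
have ux j : u j <= x by exact: clip_le.
have g0 j : 0 <= green t j k by exact: green_ge0.
have Eu : energy S u u <= x.
  apply: le_trans (ux k).
  apply: (le_trans (energy_contract S_sym S_offdiag S_row _ (@clip_homo _ x)
    (fun y z => @clip_lip _ x y z x0))).
  rewrite -(green_test m_gt0 S_sym S_offdiag S_row t0 Pk u0) lerDr.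
  rewrite mulr_ge0 ?(ltW t0)// sumr_ge0// => i Pi.
  by rewrite !mulr_ge0// ltW// m_gt0.
have suppE : \sum_(i | P i && (u i != 0)) m i = level_mass P m (green t ^~ k) x.
  apply: eq_bigl => i; congr andb; rewrite /u/= clipE// ltNge.
  case: leP => //= sx; first by rewrite eqxx.
  by case: leP => _; rewrite gt_eqF// subr_gt0.
have := faber_krahn u0; rewrite suppE => fk.
rewrite -(ler_pM2r x0) [leLHS]mulrC mulrA -expr2.
apply: (@le_trans _ _ (\sum_(i | P i) m i * u i ^+ 2)).
  rewrite /level_mass mulr_sumr big_mkcond [leRHS]big_mkcond/=.
  apply: ler_sum => i _; case: (boolP (P i)) => //= Pi.
  case: ltP => [sx|_]; last by rewrite mulr_ge0 ?sqr_ge0// ltW// m_gt0.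
  rewrite mulrC ler_wpM2l ?(ltW (m_gt0 Pi))//.
  rewrite /u/= clipE//; case: (leP _ x) => [gx|_].
    by have := lt_le_trans sx gx; rewrite ltNge ler_peMl ?(ltW x0)// ler1n.
  by rewrite [_ <= 2 * x]leNgt sx.
apply: (le_trans fk); rewrite ler_wpM2l//.
by rewrite mulr_ge0 ?powR_ge0// ltW.
Qed.

Variable p : R.
Hypothesis p_gt1 : 1 < p.
Hypothesis p_lt : p < (1 - th)^-1.
Let r := (1 - th)^-1.
Let p_gt0 : 0 < p. Proof. exact: lt_trans p_gt1. Qed.

(** The factor of [sum_powR_above] when its [B] is the bound of [dyadic_decay]; the denominator is
    positive because p < r. *)
Definition green_cst : R :=
  2 `^ p * (2 `^ r * C) `^ r / (1 - 2 `^ (p - r)).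

Lemma green_sum_above t k K : 0 < t -> P k -> 0 < K ->
  \sum_(i | P i && (K < green t i k)) m i * green t i k `^ p <=
  green_cst * K `^ (p - r).
Proof.
move=> t0 Pk K0; have m_ge0 i : P i -> 0 <= m i by move/m_gt0/ltW.
apply: sum_powR_above => // [|x x0]; first exact: powR_ge0.
apply: (@dyadic_decay _ _ M) => // [y|y|y y0].
- exact: level_mass_ge0.
- by apply: le_trans mass_le; exact: level_mass_le.
- exact: green_level_double.
Qed.

(** The cut at level 1 does not involve t: below it the powers are at most 1 and the total mass
    takes over. *)
Lemma green_sum_small t k : 0 < t -> P k ->
  \sum_(i | P i) m i * green t i k `^ p <= M + green_cst.
Proof.
move=> t0 Pk; rewrite (bigID (fun i => 1 < green t i k))/= addrC lerD//.
  apply: le_trans mass_le; rewrite [leRHS](bigID (fun i => 1 < green t i k))/=.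
  rewrite -[leLHS]add0r lerD//; first by apply: sumr_ge0 => i /andP[/m_gt0/ltW].
  apply: ler_sum => i /andP[Pi]; rewrite -leNgt => g1.
  rewrite -[leRHS]mulr1 ler_wpM2l ?(ltW (m_gt0 Pi))//.
  have := @ge0_ler_powR R p (ltW p_gt0) (green t i k) 1; rewrite powR1 !nnegrE.
  by apply => //; exact: green_ge0.
by rewrite (le_trans (green_sum_above t0 Pk ltr01))// powR1 mulr1.
Qed.

(** Cut at the level K with K^(r - 1) = t, which balances the two parts: below it g^p <= K^(p - 1) g
    and the mass bound give K^(p - 1)/t, above it the layers give K^(p - r). *)
Lemma green_sum_large t k : 0 < t -> P k ->
  \sum_(i | P i) m i * green t i k `^ p <=
  (1 + green_cst) * t `^ ((p - r) / (r - 1)).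
Proof.
move=> t0 Pk; have r1 : 1 < r by exact: lt_trans p_lt.
set K := t `^ (r - 1)^-1; have K0 : 0 < K by exact: powR_gt0.
have KE : t `^ ((p - r) / (r - 1)) = K `^ (p - r) by rewrite /K -powRrM mulrC.
rewrite KE (bigID (fun i => K < green t i k))/= addrC mulrDl mul1r lerD//; last first.
  exact: green_sum_above.
have -> : K `^ (p - r) = K `^ (p - 1) * t^-1.
  have -> : t^-1 = K `^ (1 - r).
    rewrite /K -powRrM -[1 - r]opprB mulrN mulVf ?subr_eq0 ?gt_eqF//.
    by rewrite powR_inv1// ltW.
  rewrite -powRD ?(gt_eqF K0) ?implybT//; congr (_ `^ _); ring.
apply: (@le_trans _ _ (K `^ (p - 1) * \sum_(i | P i) m i * green t i k)).
  rewrite mulr_sumr [leRHS](bigID (fun i => K < green t i k))/=.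
  rewrite -[leLHS]add0r lerD//.
    apply: sumr_ge0 => i /andP[Pi _].
    by rewrite !mulr_ge0 ?powR_ge0 ?(ltW (m_gt0 Pi))//; exact: green_ge0.
  apply: ler_sum => i /andP[Pi]; rewrite -leNgt => gK.
  have g0 : 0 <= green t i k by exact: green_ge0.
  rewrite mulrCA ler_wpM2l ?(ltW (m_gt0 Pi))//.
  rewrite -(mulr_powRB1 g0 p_gt0) mulrC ler_wpM2r//.
  by rewrite ge0_ler_powR ?subr_ge0 ?(ltW p_gt1) ?nnegrE ?(ltW K0).
rewrite ler_wpM2l ?powR_ge0// -[leRHS]mul1r ler_pdivlMr// mulrC.
exact: green_mass.
Qed.

(** If q is conjugate to p, the exponent (r - p)/(r - 1)/p is 1 - 1/(q th). The constant serves both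
    ranges of t. *)
Definition green_decay (t : R) : R :=
  (M + 1 + green_cst) `^ p^-1 *
  (if t <= 1 then 1 else t `^ (- ((r - p) / (r - 1) / p))).

Lemma green_norm_le t k : 0 < t -> P k ->
  (\sum_(i | P i) m i * green t i k `^ p) `^ p^-1 <= green_decay t.
Proof.
move=> t0 Pk; have pV : 0 <= p^-1 by rewrite invr_ge0 ltW.
have r1 : 1 < r by exact: lt_trans p_lt.
have s0 : 0 <= \sum_(i | P i) m i * green t i k `^ p.
  by apply: sumr_ge0 => i /m_gt0/ltW mi; rewrite mulr_ge0 ?powR_ge0.
have M0 : 0 <= M.
  by apply: le_trans mass_le; apply: sumr_ge0 => i /m_gt0/ltW.
have c0 : 0 <= green_cst.
  have := le_trans _ (@green_sum_above t k 1 t0 Pk ltr01).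
  rewrite powR1 mulr1; apply; apply: sumr_ge0 => i /andP[/m_gt0/ltW mi _].
  by rewrite mulr_ge0 ?powR_ge0.
have mono (x y : R) : 0 <= x -> x <= y -> x `^ p^-1 <= y `^ p^-1.
  by move=> x0 xy; rewrite ge0_ler_powR// nnegrE// (le_trans x0).
rewrite /green_decay; case: ifP => t1.
  by rewrite mulr1 mono// (le_trans (green_sum_small t0 Pk))// -addrA lerD2l lerDr.
apply: (le_trans (mono _ _ s0 (green_sum_large t0 Pk))).
rewrite powRM ?addr_ge0 ?powR_ge0// -powRrM.
have -> : (p - r) / (r - 1) / p = - ((r - p) / (r - 1) / p).
  by rewrite -opprB !mulNr.
by rewrite ler_wpM2r ?powR_ge0 ?mono ?addr_ge0// -addrA lerDr.
Qed.

End GreenBound.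

(** * Lebesgue measure of R^n *)

Section Dilation.
Context {R : realType}.
Local Notation leb1 := (@lebesgue_measure R).

Definition dilate1 (s b : R) (x : measurableTypeR R) : measurableTypeR R :=
  s * x + b.

Lemma measurable_dilate1 s b : measurable_fun setT (dilate1 s b).
Proof. by apply: measurable_funD => //; exact: measurable_funM. Qed.

(** The image measure multiplied by [s] agrees with Lebesgue measure on half-open intervals, hence
    everywhere by uniqueness. *)
Lemma lebesgue_measure_dilate1 (s b : R) (A : set (measurableTypeR R)) :
  0 < s -> measurable A ->
  leb1 (dilate1 s b @^-1` A) = (s^-1%:E * leb1 A)%E.
Proof.
move=> s0 mA; pose r : {nonneg R} := NngNum (ltW s0).
have : leb1 A = mscale r (pushforward leb1 (dilate1 s b)) A.
  move=> mf; apply: lebesgue_measure_unique => // _ [[x y]] _ <-.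
  rewrite -[RHS]/(s%:E * leb1 (dilate1 s b @^-1` [set` `]x, y]]))%E.
  have -> : dilate1 s b @^-1` [set` `]x, y]] = [set` `](x - b) / s, (y - b) / s]].
    apply/seteqP; split => z /=; rewrite !in_itv/= /dilate1;
      by rewrite ltr_pdivrMr// ler_pdivlMr// ltrBlDr lerBrDr mulrC.
  rewrite !lebesgue_measure_itv/= !lte_fin ltr_pM2r ?invr_gt0// ltrD2r.
  case: ifP => _; rewrite ?mule0// -!EFinD -EFinM.
  by congr EFin; field; rewrite gt_eqF.
move=> /(_ (measurable_dilate1 s b)).
rewrite -[mscale _ _ _]/(s%:E * leb1 (dilate1 s b @^-1` A))%E => ->.
rewrite muleA -EFinM mulVf ?gt_eqF//.
by rewrite mul1e.
Qed.

Lemma ge0_integral_dilate1 (s b : R) (f : R -> \bar R) : 0 < s ->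
  measurable_fun setT f -> (forall x, 0 <= f x)%E ->
  (\int[leb1]_x f (dilate1 s b x) = s^-1%:E * \int[leb1]_x f x)%E.
Proof.
move=> s0 mf f0; have s0' : 0 <= s^-1 by rewrite invr_ge0 ltW.
pose r : {nonneg R} := NngNum s0'.
have /= <- := @ge0_integral_pushforward _ _ _ _ R _ (measurable_dilate1 s b) leb1
  setT f measurableT mf (fun y _ => f0 y).
rewrite -[s^-1]/(r%:num) -ge0_integral_mscale//.
apply: eq_measure_integral => [|m A mA _]; first exact: measurable_dilate1.
exact: lebesgue_measure_dilate1.
Qed.

Definition dilate n (s : R) (b : 'rV[R]_n) (x : 'rV[R]_n) : 'rV[R]_n := s *: x + b.

Lemma dilateE n s (b x : 'rV[R]_n) i :
  dilate s b x ord0 i = s * x ord0 i + b ord0 i.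
Proof. by rewrite !mxE. Qed.

Lemma measurable_dilate n s (b : 'rV[R]_n) : measurable_fun setT (dilate s b).
Proof.
apply/measurable_fun_rVP => i.
rewrite (_ : _ \o _ = dilate1 s (b ord0 i) \o rV_coord i).
  exact: measurableT_comp (measurable_dilate1 _ _) (measurable_rV_coord i).
by apply/funext => x; rewrite /= /rV_coord /dilate /dilate1 !mxE.
Qed.

Lemma lebesgue_rVS n (A : set 'rV[R]_n.+1) : lebesgue_rV n.+1 A =
  (\int[leb1]_x lebesgue_rV n (xsection (@rV_cons R n @^-1` A) x))%E.
Proof. by []. Qed.

Lemma rV_cons_ord0 n (p : measurableTypeR R * 'rV[R]_n) :
  rV_cons p ord0 ord0 = p.1.
Proof. by have := congr1 fst (rV_consK p). Qed.

Lemma rV_cons_lift n (p : measurableTypeR R * 'rV[R]_n) j :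
  rV_cons p ord0 (lift ord0 j) = p.2 ord0 j.
Proof. by have /rowP/(_ j) := congr1 snd (rV_consK p); rewrite mxE. Qed.

Lemma dilate_rV_cons n s (b : 'rV[R]_n.+1) (p : measurableTypeR R * 'rV[R]_n) :
  dilate s b (rV_cons p) =
  rV_cons (dilate1 s (rV_uncons b).1 p.1, dilate s (rV_uncons b).2 p.2).
Proof.
apply/rowP => i; rewrite dilateE; case: (unliftP ord0 i) => [j|] ->.
  by rewrite !rV_cons_lift dilateE mxE.
by rewrite !rV_cons_ord0.
Qed.

Lemma measurable_rV_cons_preimage n (A : set 'rV[R]_n.+1) : measurable A ->
  measurable (@rV_cons R n @^-1` A).
Proof. by move=> mA; rewrite -[X in measurable X]setTI; exact: measurable_rV_cons. Qed.

(** Induction on the dimension: the dilation acts on the first coordinate and on the remaining ones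
    separately, so each section is handled by the induction hypothesis and one factor 1/s comes from
    the line. *)
Lemma lebesgue_rV_dilate n s (b : 'rV[R]_n) (A : set 'rV[R]_n) : 0 < s ->
  measurable A ->
  lebesgue_rV n (dilate s b @^-1` A) = ((s ^- n)%:E * lebesgue_rV n A)%E.
Proof.
move=> s0; elim: n b A => [|n IH] b A mA.
  rewrite /= !diracE expr0 invr1 mul1e; congr (_%:E); congr (_%:R); congr nat_of_bool.
  rewrite (_ : dilate s b @^-1` A = A)//; apply/seteqP.
  by split=> x /=; rewrite (thinmx0 (dilate s b x)) (thinmx0 x).
pose h x := lebesgue_rV n (xsection (@rV_cons R n @^-1` A) x).
have mh : measurable_fun setT h.
  by apply: measurable_fun_xsection; exact: measurable_rV_cons_preimage.
rewrite !lebesgue_rVS.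
transitivity (\int[leb1]_x ((s ^- n)%:E * h (dilate1 s (rV_uncons b).1 x)))%E.
  apply: eq_integral => x _; rewrite -(IH (rV_uncons b).2); last first.
    by apply: measurable_xsection; exact: measurable_rV_cons_preimage.
  congr (lebesgue_rV n _); apply/seteqP; split => y;
    by rewrite /xsection/= !inE/= dilate_rV_cons.
have sn0 : 0 <= s ^- n by rewrite invr_ge0 exprn_ge0// ltW.
rewrite ge0_integralZl_EFin//; last first.
  exact: measurableT_comp mh (measurable_dilate1 _ _).
by rewrite ge0_integral_dilate1// muleA -EFinM exprSr invfM mulrC.
Qed.

Lemma ge0_integral_rV_dilate n s (b : 'rV[R]_n) (f : 'rV[R]_n -> \bar R) :
  0 < s -> measurable_fun setT f -> (forall x, 0 <= f x)%E ->
  (\int[lebesgue_rV n]_x f (dilate s b x) =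
   (s ^- n)%:E * \int[lebesgue_rV n]_x f x)%E.
Proof.
move=> s0 mf f0; have s0' : 0 <= s ^- n by rewrite invr_ge0 exprn_ge0// ltW.
pose r : {nonneg R} := NngNum s0'.
have /= <- := @ge0_integral_pushforward _ _ _ _ R _ (measurable_dilate s b)
  (lebesgue_rV n) setT f measurableT mf (fun y _ => f0 y).
rewrite -[s ^- n]/(r%:num) -ge0_integral_mscale//.
apply: eq_measure_integral => [|m A mA _]; first exact: measurable_dilate.
exact: lebesgue_rV_dilate.
Qed.

Definition box n (s : R) : set 'rV[R]_n := [set x | forall i, `[0, s]%classic (x ord0 i)].
Arguments box n s x : clear implicits.

Lemma measurable_box n s : measurable (box n s).
Proof.
have -> : box n s = \bigcap_(i in [set: 'I_n]) (rV_coord i @^-1` `[0, s]%classic).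
  by apply/seteqP; split => [x xs i _|x xs i]; [exact: xs|exact: xs].
apply: fin_bigcap_measurable; first exact: finite_finset.
by move=> i _; rewrite -[X in measurable X]setTI; exact: measurable_rV_coord.
Qed.

Lemma lebesgue_rV_box n s : 0 <= s -> lebesgue_rV n (box n s) = (s ^+ n)%:E.
Proof.
move=> s0; elim: n => [|n IH].
  by rewrite /= diracE expr0 mem_set// => -[].
rewrite lebesgue_rVS.
transitivity (\int[leb1]_x ((s ^+ n)%:E * (\1_(`[0%R, s]%classic) x)%:E))%E;
  last first.
  rewrite ge0_integralZl_EFin ?exprn_ge0//; last exact/measurable_EFinP.
  have leb_s : leb1 `[0%R, s]%classic = s%:E.
    rewrite lebesgue_measure_itv/= lte_fin oppr0 adde0.
    by case: ltP => // s_le0; congr EFin; apply/le_anti; rewrite s0 s_le0.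
  rewrite integral_indic//= setIT.
  by transitivity ((s ^+ n)%:E * s%:E)%E; [congr (_ * _)%E|rewrite -EFinM exprSr].
apply: eq_integral => x _; have xsE : xsection (@rV_cons R n @^-1` box n.+1 s) x =
    if x \in `[0, s]%classic then box n s else set0.
  apply/seteqP; split => y.
    rewrite /xsection/= inE/= => xy.
    have := xy ord0; rewrite rV_cons_ord0/= => xs; rewrite mem_set//.
    by move=> i; have := xy (lift ord0 i); rewrite rV_cons_lift.
  case: ifPn => // /set_mem xs ys; rewrite /xsection/= inE/= => i.
  by case: (unliftP ord0 i) => [j|] ->; rewrite ?rV_cons_lift ?rV_cons_ord0.
rewrite xsE indicE; case: ifP => _; first by rewrite IH mule1.
by rewrite measure0 mule0.
Qed.

End Dilation.
Arguments box {R} n s x.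

Lemma bounded_cover {R : realType} n (A : set 'rV[R]_n) (M : R) : 0 <= M ->
  (forall x k, A x -> `|x ord0 k| <= M) ->
  exists V : set 'rV[R]_n, [/\ measurable V, A `<=` V &
    lebesgue_rV n V = ((2 * M) ^+ n)%:E].
Proof.
move=> M0 AM; have mbox := @measurable_box R n (2 * M).
exists (dilate 1 (const_mx M) @^-1` box n (2 * M)); split.
- by rewrite -[X in measurable X]setTI; apply: measurable_dilate.
- move=> x xA k; have := AM x k xA; rewrite dilateE mxE mul1r/= in_itv/= ler_norml.
  by case/andP => l1 l2; apply/andP; split; lra.
- have := lebesgue_rV_dilate (const_mx M) ltr01 mbox.
  by rewrite lebesgue_rV_box ?mulr_ge0// expr1n invr1 mul1e.
Qed.

(** * Averaging over translations in R^n *)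

Section FaberKrahn.
Context {R : realType}.
Local Notation leb1 := (@lebesgue_measure R).
Local Notation I01 := (`[0%R, 1%R]%classic : set (measurableTypeR R)).

Lemma lebesgue_measure_I01 : leb1 I01 = 1%E.
Proof. by rewrite lebesgue_measure_itv/= lte_fin ltr01 oppr0 adde0. Qed.

(** Jensen's inequality on [0, 1], obtained by integrating 2 c h <= h^2 + c^2. Adding c^2 to both
    sides avoids a subtraction of possibly infinite integrals. *)
Lemma sqr_le_integral_I01 (h : measurableTypeR R -> R) (c : R) :
  measurable_fun setT h -> (forall t, 0 <= h t) -> 0 <= c ->
  (c%:E <= \int[leb1]_t (\1_I01 t * h t)%:E)%E ->
  ((c ^+ 2)%:E <= \int[leb1]_t (\1_I01 t * h t ^+ 2)%:E)%E.
Proof.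
move=> mh h0 c0 ch.
have m1 : measurable_fun setT (\1_I01 : measurableTypeR R -> R) by [].
have mh1 : measurable_fun setT (fun t => \1_I01 t * h t) by exact: measurable_funM.
have mh2 : measurable_fun setT (fun t => \1_I01 t * h t ^+ 2).
  by apply: measurable_funM => //; exact: measurable_funX.
have h2_ge0 t : 0 <= \1_I01 t * h t ^+ 2 by rewrite mulr_ge0 ?sqr_ge0.
have mc2 : measurable_fun setT (fun t => c ^+ 2 * \1_I01 t) by exact: measurable_funM.
have c2_ge0 t : 0 <= c ^+ 2 * \1_I01 t by rewrite mulr_ge0 ?sqr_ge0.
have int_c2 : (\int[leb1]_t (c ^+ 2 * \1_I01 t)%:E = (c ^+ 2)%:E)%E.
  under eq_integral do rewrite EFinM.
  rewrite ge0_integralZl_EFin ?sqr_ge0//; last exact/measurable_EFinP.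
  by rewrite integral_indic// setIT -[RHS]mule1 -lebesgue_measure_I01.
rewrite -(@leeD2rE _ (c ^+ 2)%:E)// -[in leRHS]int_c2.
rewrite -ge0_integralD//; try exact/measurable_EFinP;
  try by move=> t _; rewrite lee_fin.
have c2 : 0 <= 2 * c by rewrite mulr_ge0.
have -> : ((c ^+ 2)%:E + (c ^+ 2)%:E = (2 * c)%:E * c%:E)%E.
  by rewrite -EFinD -EFinM; congr EFin; ring.
apply: (le_trans (lee_wpmul2l _ ch)); first by rewrite lee_fin.
rewrite -ge0_integralZl_EFin//; [|by move=> t _; rewrite lee_fin mulr_ge0|
  exact/measurable_EFinP].
apply: ge0_le_integral => //.
- by move=> t _; rewrite -EFinM lee_fin !mulr_ge0.
- by apply/measurable_EFinP; exact: measurable_funM.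
- by apply/measurable_EFinP/measurable_funD.
move=> t _; rewrite -EFinM lee_fin indicE.
case: (_ \in _); last by rewrite !mul0r !mulr0 addr0.
rewrite !mul1r mulr1 -subr_ge0.
by have := sqr_ge0 (h t - c); congr (0 <= _); ring.
Qed.

Variable n : nat.
Local Notation Rn := 'rV[R]_n.
Local Notation leb := (lebesgue_rV n).
Variables (u G : Rn -> R) (V : set Rn) (s : R).
Hypothesis mu : measurable_fun setT u.
Hypothesis mG : measurable_fun setT G.
Hypothesis G0 : forall x, 0 <= G x.
Hypothesis mV : measurable V.
Hypothesis uV : forall x, ~ V x -> u x = 0.
Hypothesis s_gt0 : 0 < s.
Hypothesis V_small : (leb V <= (s ^+ n / 2)%:E)%E.
Hypothesis increment : forall x z, box n s z ->
  (`|u (x + z) - u x|%:E <=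
   s%:E * \int[leb1]_t (\1_I01 t * G (x + t *: z))%:E)%E.

Lemma measurable_translate (z : Rn) : measurable_fun setT (fun x : Rn => x + z).
Proof.
have -> : (fun x : Rn => x + z) = dilate 1 z.
  by apply/funext => x; rewrite /dilate scale1r.
exact: measurable_dilate.
Qed.

Lemma ge0_integral_translate (z : Rn) (f : Rn -> \bar R) :
  measurable_fun setT f -> (forall x, 0 <= f x)%E ->
  (\int[leb]_x f (x + z)%R = \int[leb]_x f x)%E.
Proof.
move=> mf f0; have := ge0_integral_rV_dilate z ltr01 mf f0.
rewrite expr1n invr1 mul1e => <-.
by apply: eq_integral => x _; rewrite /dilate scale1r.
Qed.

Lemma measurable_segment (z : Rn) :
  measurable_fun setT (fun p : Rn * measurableTypeR R => p.1 + p.2 *: z).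
Proof.
apply/measurable_fun_rVP => i.
rewrite (_ : _ \o _ = fun p => rV_coord i p.1 + p.2 * z ord0 i).
  apply: measurable_funD; first exact: measurableT_comp (measurable_rV_coord i) _.
  by apply: measurable_funM => //; exact: measurable_snd.
by apply/funext => p; rewrite /= /rV_coord !mxE.
Qed.

Lemma measurable_addrV :
  measurable_fun setT (fun p : Rn * Rn => p.1 + p.2).
Proof.
apply/measurable_fun_rVP => i.
rewrite (_ : _ \o _ = fun p => rV_coord i p.1 + rV_coord i p.2).
  by apply: measurable_funD; exact: measurableT_comp (measurable_rV_coord i) _.
by apply/funext => p; rewrite /= /rV_coord !mxE.
Qed.

Lemma increment_sqr x z : box n s z ->
  (((u (x + z) - u x) ^+ 2)%:E <=
   (s ^+ 2)%:E * \int[leb1]_t (\1_I01 t * G (x + t *: z) ^+ 2)%:E)%E.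
Proof.
move=> zs; set D := u (x + z) - u x.
have mGx : measurable_fun setT (fun t : measurableTypeR R => G (x + t *: z)).
  apply: (measurableT_comp mG).
  exact: measurableT_comp (measurable_segment z) (pair1_measurable x).
have Ds : ((`|D| / s)%:E <= \int[leb1]_t (\1_I01 t * G (x + t *: z))%:E)%E.
  by rewrite EFinM muleC lee_pdivrMl//; exact: increment.
have := sqr_le_integral_I01 mGx (fun t => G0 _) _ Ds.
rewrite divr_ge0 ?(ltW s_gt0)// => /(_ isT).
rewrite exprMn exprVn real_normK ?num_real// mulrC EFinM.
by rewrite lee_pdivrMl// exprn_gt0.
Qed.

Let ptwise_ge0 (z : Rn) (p : Rn * measurableTypeR R) :
  (0 <= (\1_I01 p.2 * G (p.1 + p.2 *: z) ^+ 2)%:E)%E.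
Proof. by rewrite lee_fin mulr_ge0 ?sqr_ge0. Qed.

Let measurable_ptwise (z : Rn) : measurable_fun setT
  (fun p : Rn * measurableTypeR R => (\1_I01 p.2 * G (p.1 + p.2 *: z) ^+ 2)%:E).
Proof.
apply/measurable_EFinP/measurable_funM.
  by apply: measurableT_comp => //; exact: measurable_snd.
apply: measurable_funX; apply: measurableT_comp => //; exact: measurable_segment.
Qed.

Lemma increment_L2 z : box n s z ->
  (\int[leb]_x ((u (x + z) - u x) ^+ 2)%:E <=
   (s ^+ 2)%:E * \int[leb]_x (G x ^+ 2)%:E)%E.
Proof.
move=> zs.
have mG2 : measurable_fun setT (fun x => (G x ^+ 2)%:E).
  by apply/measurable_EFinP; exact: measurable_funX.
(* Translation invariance: for every fixed t the integral over x of G(x + t z)^2 is that of G^2, and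
   averaging over t in [0, 1] changes nothing. *)
have -> : (\int[leb]_x (G x ^+ 2)%:E =
    \int[leb]_x \int[leb1]_t (\1_I01 t * G (x + t *: z) ^+ 2)%:E)%E.
  rewrite (fubini_tonelli (fun p : Rn * measurableTypeR R =>
    (\1_I01 p.2 * G (p.1 + p.2 *: z) ^+ 2)%:E))//=.
  under [RHS]eq_integral => t _.
    under eq_integral do rewrite EFinM.
    rewrite ge0_integralZl_EFin//; last 2 first.
    - by move=> x _; rewrite lee_fin sqr_ge0.
    - by apply: (measurableT_comp mG2); exact: measurable_translate.
    rewrite (ge0_integral_translate _ mG2) => [|x]; last by rewrite lee_fin sqr_ge0.
    over.
  rewrite ge0_integralZr//.
  - rewrite integral_indic// setIT.
    by rewrite -[LHS]mul1e -lebesgue_measure_I01.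
  - exact/measurable_EFinP.
  - by apply: integral_ge0 => x _; rewrite lee_fin sqr_ge0.
rewrite -ge0_integralZl_EFin ?sqr_ge0//; last 2 first.
- by move=> x _; apply: integral_ge0 => t _; exact: (ptwise_ge0 z (x, t)).
- exact: (measurable_fun_fubini_tonelli_F _ (measurable_ptwise z) (ptwise_ge0 z)).
apply: ge0_le_integral => //.
- by move=> x _; rewrite lee_fin sqr_ge0.
- apply/measurable_EFinP/measurable_funX/measurable_funB => //.
  by apply: (measurableT_comp mu); exact: measurable_translate.
- apply: emeasurable_funM => //.
  exact: (measurable_fun_fubini_tonelli_F _ (measurable_ptwise z) (ptwise_ge0 z)).
- by move=> x _; exact: increment_sqr.
Qed.

Let Vx (x : Rn) : set Rn := [set z | V (x + z)].

Lemma box_diff_measure x :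
  ((s ^+ n / 2)%:E <= leb (box n s `\` Vx x))%E.
Proof.
have VE : Vx x = dilate 1 x @^-1` V.
  by apply/seteqP; split => z; rewrite /Vx/= /dilate scale1r addrC.
have mVx : measurable (Vx x).
  by rewrite VE -[X in measurable X]setTI; exact: measurable_dilate.
have mb := @measurable_box R n s.
have : (leb (box n s) <= leb (box n s `\` Vx x) + leb (Vx x))%E.
  apply: (@le_trans _ _ (leb ((box n s `\` Vx x) `|` Vx x))).
    apply: le_measure; rewrite ?inE//.
    - by apply: measurableU => //; exact: measurableD.
    - by move=> z bz; have [?|?] := pselect (V (x + z)); [right|left].
  by apply: measureU2 => //; exact: measurableD.
rewrite lebesgue_rV_box ?(ltW s_gt0)// VE lebesgue_rV_dilate// expr1n invr1 mul1e.
move=> h; have {h} := le_trans h (leeD2l _ V_small).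
by rewrite -leeBlDr// -EFinB (_ : s ^+ n - s ^+ n / 2 = s ^+ n / 2)//; field.
Qed.

(* If x + z is not in V then u x ^+ 2 = (u (x + z) - u x) ^+ 2, and for each x
   this holds for z in at least one half of the cube. *)
Lemma faber_krahn_L2 :
  (\int[leb]_x (u x ^+ 2)%:E <= (2 * s ^+ 2)%:E * \int[leb]_x (G x ^+ 2)%:E)%E.
Proof.
have mu2 : measurable_fun setT (fun x => (u x ^+ 2)%:E).
  by apply/measurable_EFinP; exact: measurable_funX.
have mbox : measurable_fun setT (\1_(box n s) : Rn -> R).
  by apply: measurable_indic; exact: measurable_box.
pose F (p : Rn * Rn) := (\1_(box n s) p.2 * (u (p.1 + p.2) - u p.1) ^+ 2)%:E.
have F0 p : (0 <= F p)%E by rewrite lee_fin mulr_ge0 ?sqr_ge0.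
have mF : measurable_fun setT F.
  apply/measurable_EFinP/measurable_funM.
    by apply: measurableT_comp => //; exact: measurable_snd.
  apply/measurable_funX/measurable_funB; apply: measurableT_comp => //.
  exact: measurable_addrV.
have upper : (\int[leb]_z \int[leb]_x F (x, z) <=
    (s ^+ n)%:E * ((s ^+ 2)%:E * \int[leb]_x (G x ^+ 2)%:E))%E.
  set K := ((s ^+ 2)%:E * _)%E.
  have K0 : (0 <= K)%E.
    rewrite mule_ge0 ?lee_fin ?sqr_ge0//.
    by apply: integral_ge0 => x _; rewrite lee_fin sqr_ge0.
  have -> : ((s ^+ n)%:E * K = \int[leb]_z ((\1_(box n s) z)%:E * K))%E.
    rewrite ge0_integralZr//; last exact/measurable_EFinP.
    rewrite integral_indic ?setIT//; last exact: measurable_box.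
    by congr (_ * _)%E; exact/esym/lebesgue_rV_box/ltW.
  apply: ge0_le_integral => //.
  - by move=> z _; apply: integral_ge0.
  - exact: (measurable_fun_fubini_tonelli_G _ mF F0).
  - by apply: emeasurable_funM => //; exact/measurable_EFinP.
  move=> z _; rewrite /F/= indicE; have [zb|zb] := boolP (z \in box n s).
    under eq_integral do rewrite mul1r.
    by rewrite mul1e; apply: increment_L2; exact: set_mem.
  under eq_integral do rewrite mul0r.
  by rewrite integral0 mul0e.
have lower : ((s ^+ n / 2)%:E * \int[leb]_x (u x ^+ 2)%:E <=
    \int[leb]_x \int[leb]_z F (x, z))%E.
  have sn2 : 0 <= s ^+ n / 2 by rewrite divr_ge0 ?exprn_ge0 ?(ltW s_gt0).
  rewrite -ge0_integralZl_EFin//; last first.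
    by move=> x _; rewrite lee_fin sqr_ge0.
  apply: ge0_le_integral => //.
  - by move=> x _; rewrite -EFinM lee_fin mulr_ge0 ?sqr_ge0.
  - exact: emeasurable_funM.
  - exact: (measurable_fun_fubini_tonelli_F _ mF F0).
  move=> x _; pose B := box n s `\` Vx x.
  have mB : measurable B.
    apply: measurableD; first exact: measurable_box.
    rewrite (_ : Vx x = dilate 1 x @^-1` V); last first.
      by apply/seteqP; split => z; rewrite /Vx/= /dilate scale1r addrC.
    by rewrite -[X in measurable X]setTI; exact: measurable_dilate.
  apply: (@le_trans _ _ (\int[leb]_z ((u x ^+ 2)%:E * (\1_B z)%:E))%E).
    rewrite ge0_integralZl_EFin ?sqr_ge0//; last first.
      by apply/measurable_EFinP; exact: measurable_indic.
    rewrite integral_indic// setIT muleC lee_wpmul2l ?lee_fin ?sqr_ge0//.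
    exact: box_diff_measure.
  apply: ge0_le_integral => //.
  - by move=> z _; rewrite -EFinM lee_fin mulr_ge0 ?sqr_ge0.
  - by apply: emeasurable_funM => //; apply/measurable_EFinP; exact: measurable_indic.
  - exact: (measurableT_comp mF (pair1_measurable x)).
  move=> z _; rewrite -EFinM lee_fin/= [X in _ * X <= _]indicE.
  have [|_] := boolP (z \in B); last by rewrite mulr0 mulr_ge0 ?sqr_ge0.
  by move=> /set_mem[zb /uV ->]; rewrite indicE mem_set// sub0r sqrrN mulr1 mul1r.
rewrite (fubini_tonelli F)// in lower.
move: (le_trans lower upper).
rewrite -lee_pdivlMl ?divr_gt0 ?exprn_gt0// => /le_trans; apply.
rewrite !muleA -!EFinM le_eqVlt; apply/orP; left; apply/eqP.
by congr (_%:E * _)%E; field; rewrite expf_neq0 ?gt_eqF.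
Qed.

End FaberKrahn.

(** * Barycentric coordinates *)

Section Simplex.
Context {R : realType} {d : nat} {I : finType}.
Local Notation Rd := 'rV[R]_d.
Variables (p : I -> Rd).
Implicit Type c : {set I}.

(* As a row vector, (1, x) is the row of barycentric coordinates of x times this
   matrix; its pseudo-inverse yields them as affine functions on the whole space,
   set to 0 for the indices outside c. *)
Definition vertex_mx c : 'M[R]_(#|c|, 1 + d) :=
  \matrix_(i < #|c|) row_mx 1%:M (p (enum_val i)).

Definition bary_coef c (a : I) (k : 'I_(1 + d)) : R :=
  \sum_(i < #|c|) (enum_val i == a)%:R * pinvmx (vertex_mx c) k i.

Definition bary_grad c a (k : 'I_d) : R := bary_coef c a (rshift 1 k).

Definition bary c a (x : Rd) : R :=
  bary_coef c a (lshift d ord0) + \sum_k bary_grad c a k * x ord0 k.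

Lemma bary_mxE c a x : bary c a x =
  \sum_(i < #|c|) (enum_val i == a)%:R *
    (row_mx 1%:M x *m pinvmx (vertex_mx c)) ord0 i.
Proof.
rewrite /bary /bary_grad /bary_coef.
under [X in _ + X]eq_bigr do rewrite mulr_suml.
rewrite exchange_big/= -big_split/=; apply: eq_bigr => i _.
rewrite [in RHS]mxE big_split_ord/= big_ord1 row_mxEl [1%:M _ _]mxE eqxx mul1r.
rewrite mulrDr mulr_sumr.
by congr +%R; apply: eq_bigr => k _; rewrite row_mxEr; ring.
Qed.

Lemma bary_out c a x : a \notin c -> bary c a x = 0.
Proof.
move=> ac; rewrite bary_mxE big1// => i _.
by case: eqP => [ia|_]; rewrite ?mul0r//; case/negP: ac; rewrite -ia enum_valP.
Qed.

Lemma baryD c a x y : bary c a (x + y) = bary c a x + \sum_k bary_grad c a k * y ord0 k.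
Proof.
rewrite /bary -addrA -big_split/=; congr +%R; apply: eq_bigr => k _.
by rewrite mxE mulrDr.
Qed.

Lemma bary_dilate c a s b x :
  bary c a (s *: x + b) = s * (bary c a x - bary c a 0) + bary c a b.
Proof.
have b0 : bary c a 0 = bary_coef c a (lshift d ord0).
  by rewrite /bary big1 ?addr0// => k _; rewrite mxE mulr0.
rewrite addrC baryD addrC b0; congr +%R.
rewrite /bary addrAC subrr add0r mulr_sumr; apply: eq_bigr => k _.
by rewrite mxE mulrCA.
Qed.

Lemma continuous_bary c a : continuous (bary c a).
Proof.
move=> x; apply: continuousD; first exact: cst_continuous.
apply: (@continuous_big _ _ _ _ _ _ _ _ _ _ x) => [|k _ y]; first exact: add_continuous.
by apply: continuousM; [exact: cst_continuous|exact: coord_continuous].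
Qed.

Lemma measurable_bary c a : measurable_fun setT (bary c a).
Proof.
apply: measurable_funD => //; apply: measurable_sum => k.
by apply: measurable_funM => //; exact: measurable_rV_coord.
Qed.

Variable c : {set I}.
Hypothesis card_c : #|c| = d.+1.
Hypothesis ind_c : affinely_independent p c.

(** A vector in the left kernel is an affine dependence between the vertices, so the rows are free;
    having d + 1 rows and columns, the matrix is square. *)
Lemma vertex_mx_full : row_full (vertex_mx c).
Proof.
suff: row_free (vertex_mx c).
  by rewrite /row_free /row_full => /eqP ->; rewrite card_c add1n.
rewrite -kermx_eq0; apply/eqP/row_matrixP => k; rewrite row0.
have : row k (kermx (vertex_mx c)) *m vertex_mx c = 0.
  by rewrite -row_mul mulmx_ker row0.
move: (row _ _) => w w0.
pose l a := \sum_(i < #|c|) (enum_val i == a)%:R * w ord0 i.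
have lE i : l (enum_val i) = w ord0 i.
  rewrite /l (bigD1 i)//= eqxx mul1r big1 ?addr0// => j ji.
  by rewrite (inj_eq enum_val_inj) (negbTE ji) mul0r.
have wE : w *m vertex_mx c = row_mx (\sum_(a in c) l a)%:M (\sum_(a in c) l a *: p a).
  apply/rowP => k'; rewrite [LHS]mxE.
  rewrite -[k']splitK; case: (fintype.split k') => /= j; rewrite ?row_mxEl ?row_mxEr.
    rewrite [RHS]mxE !ord1 eqxx mulr1n [RHS]big_enum_val; apply: eq_bigr => i _.
    by rewrite lE mxE row_mxEl mxE mulr1.
  rewrite summxE [RHS]big_enum_val; apply: eq_bigr => i _.
  by rewrite lE [RHS]mxE [vertex_mx _ _ _]mxE row_mxEr.
have := w0; rewrite wE -(@row_mx0 R 1 1 d) => /eq_row_mx[/matrixP/(_ 0 0)].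
rewrite !mxE eqxx mulr1n => l1 l2.
apply/rowP => i; rewrite [RHS]mxE -lE; apply: (ind_c l1 l2); exact: enum_valP.
Qed.

Lemma bary_row x :
  row_mx (1%:M : 'M[R]_1) x *m pinvmx (vertex_mx c) *m vertex_mx c = row_mx 1%:M x.
Proof. by rewrite -mulmxA (mulVpmx vertex_mx_full) mulmx1. Qed.

Lemma bary_enum x (i : 'I_#|c|) : bary c (enum_val i) x =
  (row_mx (1%:M : 'M[R]_1) x *m pinvmx (vertex_mx c)) ord0 i.
Proof.
rewrite bary_mxE (bigD1 i)//= eqxx mul1r big1 ?addr0// => j ji.
by rewrite (inj_eq enum_val_inj) (negbTE ji) mul0r.
Qed.

Lemma sum_bary x : \sum_(a in c) bary c a x = 1.
Proof.
have /matrixP/(_ ord0 (lshift d ord0)) := bary_row x.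
rewrite row_mxEl [RHS]mxE eqxx [LHS]mxE => e; rewrite -[RHS]e [LHS]big_enum_val.
by apply: eq_bigr => i _; rewrite bary_enum [vertex_mx _ _ _]mxE row_mxEl [1%:M _ _]mxE eqxx mulr1.
Qed.

Lemma bary_comb x : \sum_(a in c) bary c a x *: p a = x.
Proof.
apply/rowP => k; have /matrixP/(_ ord0 (rshift 1 k)) := bary_row x.
rewrite row_mxEr [LHS]mxE => e; rewrite -[RHS]e summxE [LHS]big_enum_val.
by apply: eq_bigr => i _; rewrite mxE bary_enum [vertex_mx _ _ _]mxE row_mxEr.
Qed.

Lemma barycentric_bary x : barycentric p c x (bary c ^~ x).
Proof. by split; [exact: sum_bary|rewrite bary_comb]. Qed.

Lemma barycentric_uniq x l : barycentric p c x l -> {in c, forall a, l a = bary c a x}.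
Proof.
move=> [l1 lx] a ac; apply/eqP; rewrite -subr_eq0; apply/eqP.
apply: (ind_c (l := fun a => l a - bary c a x)) => //.
  by rewrite sumrB l1 sum_bary subrr.
under eq_bigr do rewrite scalerBl.
by rewrite sumrB -lx bary_comb subrr.
Qed.

Lemma bary_vertex a b : b \in c -> bary c a (p b) = (a == b)%:R.
Proof.
move=> bc; have [ac|ac] := boolP (a \in c); last first.
  by rewrite bary_out//; case: eqP => // ab; rewrite ab bc in ac.
rewrite -(barycentric_uniq (l := fun a => (a == b)%:R))//; split.
  by rewrite (bigD1 b)//= eqxx big1 ?addr0// => i /andP[_ /negbTE ->].
rewrite (bigD1 b)//= eqxx scale1r big1 ?addr0// => i /andP[_ /negbTE ->].
by rewrite scale0r.
Qed.

Lemma sum_bary_grad k : \sum_(a in c) bary_grad c a k = 0.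
Proof.
have := sum_bary (0 + delta_mx ord0 k); under eq_bigr do rewrite baryD.
rewrite big_split/= sum_bary => /(congr1 (fun z => z - 1)).
rewrite addrAC subrr add0r => s0; rewrite -[RHS]s0.
apply: eq_bigr => a _; rewrite (bigD1 k)//= mxE !eqxx mulr1 big1 ?addr0// => i ik.
by rewrite mxE (negbTE ik) andbF mulr0.
Qed.

Lemma open_simplexP x : open_simplex p c x <-> {in c, forall a, 0 < bary c a x}.
Proof.
split=> [[l lx l0] a ac|x0].
  by rewrite -(barycentric_uniq lx)// l0.
by exists (bary c ^~ x) => //; exact: barycentric_bary.
Qed.

Lemma closed_simplexP x : closed_simplex p c x <-> {in c, forall a, 0 <= bary c a x}.
Proof.
split=> [[l lx l0] a ac|x0].
  by rewrite -(barycentric_uniq lx)// l0.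
by exists (bary c ^~ x) => //; exact: barycentric_bary.
Qed.

Lemma open_simplexE : open_simplex p c = \bigcap_(a in [set` c]) [set x | 0 < bary c a x].
Proof. by apply/seteqP; split => x; rewrite open_simplexP => h a ac; exact: h. Qed.

Lemma closed_simplexE : closed_simplex p c = \bigcap_(a in [set` c]) [set x | 0 <= bary c a x].
Proof. by apply/seteqP; split => x; rewrite closed_simplexP => h a ac; exact: h. Qed.

Lemma sub_open_closed_simplex : open_simplex p c `<=` closed_simplex p c.
Proof.
by move=> x /open_simplexP x0; apply/closed_simplexP => a /x0/ltW.
Qed.

Lemma open_open_simplex : open (open_simplex p c).
Proof.
rewrite -closedC (_ : ~` _ = \bigcup_(a in [set` c]) [set x | bary c a x <= 0]).
  apply: closed_bigcup => [|a _]; first exact: finite_finset.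
  apply: (@preimage_closed _ _ (bary c a) [set y | y <= 0]); last exact: closed_le.
  by move=> x _; exact: continuous_bary.
rewrite open_simplexE setC_bigcap; apply: eq_bigcupr => a _.
by apply/seteqP; split => x /=; rewrite leNgt => /negP.
Qed.

Lemma closed_closed_simplex : closed (closed_simplex p c).
Proof.
rewrite closed_simplexE; apply: closed_bigI => a _.
apply: (@preimage_closed _ _ (bary c a) [set y | 0 <= y]); last exact: closed_ge.
by move=> x _; exact: continuous_bary.
Qed.

Lemma measurable_open_simplex : measurable (open_simplex p c).
Proof.
rewrite open_simplexE; apply: fin_bigcap_measurable; first exact: finite_finset.
move=> a _; rewrite -[X in measurable X]setTI.
have := @measurable_bary c a measurableT `]0, +oo[%classic (measurable_itv _).
by congr measurable; congr setI; apply/seteqP; split => x /=; rewrite in_itv/= andbT.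
Qed.

Lemma measurable_closed_simplex : measurable (closed_simplex p c).
Proof.
rewrite closed_simplexE; apply: fin_bigcap_measurable; first exact: finite_finset.
move=> a _; rewrite -[X in measurable X]setTI.
have := @measurable_bary c a measurableT `[0, +oo[%classic (measurable_itv _).
by congr measurable; congr setI; apply/seteqP; split => x /=; rewrite in_itv/= andbT.
Qed.

Definition centroid : Rd := \sum_(a in c) (d.+1)%:R^-1 *: p a.

Lemma bary_centroid : {in c, forall a, bary c a centroid = (d.+1)%:R^-1}.
Proof.
move=> a ac; rewrite -(barycentric_uniq (l := fun=> d.+1%:R^-1))//; split => //.
by rewrite sumr_const card_c -[_ *+ _]mulr_natr mulVf ?pnatr_eq0.
Qed.

Lemma open_simplex_centroid : open_simplex p c centroid.
Proof.
by apply/open_simplexP => a ac; rewrite bary_centroid// invr_gt0 ltr0n.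
Qed.

Lemma bary_conv a (s : R) x y :
  bary c a (s *: x + (1 - s) *: y) = s * bary c a x + (1 - s) * bary c a y.
Proof.
have := bary_dilate c a (1 - s) 0 y; rewrite addr0 => e2.
by rewrite bary_dilate e2; ring.
Qed.

Lemma open_simplex_segment s x y : open_simplex p c x -> closed_simplex p c y ->
  0 < s <= 1 -> open_simplex p c (s *: x + (1 - s) *: y).
Proof.
move=> /open_simplexP x0 /closed_simplexP y0 /andP[s0 s1].
apply/open_simplexP => a ac; rewrite bary_conv ltr_wpDr//.
  by rewrite mulr_ge0 ?subr_ge0// y0.
by rewrite mulr_gt0// x0.
Qed.

(** A point of the closed simplex moved slightly towards the centroid lies in the open one. *)
Lemma closure_open_simplex : closure (open_simplex p c) = closed_simplex p c.
Proof.
apply/seteqP; split.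
  by rewrite closureE => x; apply; split;
    [exact: closed_closed_simplex|exact: sub_open_closed_simplex].
move=> x xc B; rewrite nbhs_ballP => -[e /= e0 xB].
pose y s := s *: centroid + (1 - s) *: x.
have [s s01 sx] : exists2 s : R, 0 < s <= 1 & ball x e (y s).
  pose D := `|centroid - x| + 1; have D0 : 0 < D by rewrite ltr_wpDl.
  have eD : 0 < e / D / 2 by rewrite !divr_gt0.
  pose m := Num.min 1 (e / D / 2).
  have m0 : 0 < m by rewrite lt_min ltr01.
  have mE : m <= e / D / 2 by rewrite ge_min lexx orbT.
  exists m; first by rewrite m0 ge_min lexx.
  rewrite -ball_normE/= /y.
  have -> : x - (m *: centroid + (1 - m) *: x) = - (m *: (centroid - x)).
    by apply/rowP => k; rewrite !mxE; ring.
  rewrite normrN normrZ (gtr0_norm m0).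
  have : m * `|centroid - x| <= e / D / 2 * D.
    by apply: ler_pM => //; [exact: ltW|rewrite lerDl].
  move=> /le_lt_trans; apply; rewrite mulrAC divfK ?gt_eqF//.
  by rewrite ltr_pdivrMr// mulr_natr mulr2n ltrDl.
exists (y s); split; last exact: xB.
exact: open_simplex_segment open_simplex_centroid xc s01.
Qed.

Local Notation leb := (lebesgue_rV d).
Local Notation K := (open_simplex p c).
Local Notation Kbar := (closed_simplex p c).

Lemma bary_le1 x a : closed_simplex p c x -> bary c a x <= 1.
Proof.
move=> /closed_simplexP x0; have [ac|ac] := boolP (a \in c); last by rewrite bary_out.
rewrite -(sum_bary x) (bigD1 a)//= lerDl.
by apply: sumr_ge0 => b /andP[/x0].
Qed.

Lemma closed_simplex_bounded : exists2 M : R, 0 <= M &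
  forall x k, Kbar x -> `|x ord0 k| <= M.
Proof.
exists (\sum_a \sum_k `|p a ord0 k|).
  by apply: sumr_ge0 => a _; apply: sumr_ge0.
move=> x k xK; rewrite -[in leLHS](bary_comb x) summxE.
apply: (le_trans (ler_norm_sum _ _ _)).
apply: (@le_trans _ _ (\sum_(a in c) \sum_k `|p a ord0 k|)); last first.
  rewrite [leRHS](bigID [in c])/= lerDl.
  by apply: sumr_ge0 => a _; apply: sumr_ge0.
apply: ler_sum => a ac; rewrite mxE normrM (bigD1 k)//=.
rewrite -[leLHS]addr0 lerD ?sumr_ge0//.
rewrite ger0_norm; last by move/closed_simplexP: xK; apply.
by rewrite ler_piMl// bary_le1.
Qed.

Lemma lebesgue_closed_simplex_lty : (leb Kbar < +oo)%E.
Proof.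
have [M M0 xM] := closed_simplex_bounded.
have [V [mV KV VE]] := bounded_cover M0 (fun x k => xM x k).
apply: (@le_lt_trans _ _ (leb V)); last by rewrite VE ltry.
by apply: le_measure; rewrite ?inE//; exact: measurable_closed_simplex.
Qed.

Lemma lebesgue_open_simplex_lty : (leb K < +oo)%E.
Proof.
apply: le_lt_trans lebesgue_closed_simplex_lty; apply: le_measure; rewrite ?inE.
- exact: measurable_open_simplex.
- exact: measurable_closed_simplex.
- exact: sub_open_closed_simplex.
Qed.

Lemma lebesgue_open_simplex_gt0 : (0 < leb K)%E.
Proof.
pose L := \sum_a \sum_k `|bary_grad c a k|.
have L0 : 0 <= L by apply: sumr_ge0 => a _; apply: sumr_ge0.
(* A cube of this side with its corner at the centroid stays inside: each coordinate is 1/(d + 1) at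
   the centroid and drops by at most L s < 1/(d + 1). *)
pose s := d.+1%:R^-1 / (L + 1).
have s0 : 0 < s by rewrite divr_gt0 ?invr_gt0 ?ltr0n// ltr_wpDl.
have := @lebesgue_rV_dilate R d 1 centroid K ltr01 measurable_open_simplex.
rewrite expr1n invr1 mul1e => <-.
apply: (@lt_le_trans _ _ (s ^+ d)%:E); first by rewrite lte_fin exprn_gt0.
rewrite -(lebesgue_rV_box d (ltW s0)); apply: le_measure; rewrite ?inE.
- exact: measurable_box.
- rewrite -[X in measurable X]setTI; apply: measurable_dilate => //.
  exact: measurable_open_simplex.
move=> z zs; rewrite /dilate/= scale1r addrC; apply/open_simplexP => a ac.
rewrite baryD bary_centroid// -ltrBlDl sub0r ltrNl.
apply: (@le_lt_trans _ _ (L * s)).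
  rewrite -sumrN; apply: (@le_trans _ _ (\sum_k `|bary_grad c a k| * s)).
    apply: ler_sum => k _; apply: (le_trans (ler_norm _)); rewrite normrN normrM.
    have := zs k; rewrite /= in_itv/= => /andP[z0 z1].
    by rewrite ler_wpM2l// ger0_norm.
  rewrite -mulr_suml ler_wpM2r ?(ltW s0)// /L (bigD1 a)//= lerDl.
  by apply: sumr_ge0 => b _; apply: sumr_ge0.
rewrite /s mulrCA mulrC -[ltRHS]mul1r ltr_pM2r ?invr_gt0 ?ltr0n//.
by rewrite ltr_pdivrMr ?ltr_wpDl// mul1r ltrDl.
Qed.

Definition vertex_cap a (s : R) : set Rd := K `&` [set x | 1 - s < bary c a x].

Lemma measurable_vertex_cap a s : measurable (vertex_cap a s).
Proof.
apply: measurableI; first exact: measurable_open_simplex.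
rewrite -[X in measurable X]setTI.
have := @measurable_bary c a measurableT `]1 - s, +oo[%classic (measurable_itv _).
by congr measurable; congr setI; apply/seteqP; split => x /=; rewrite in_itv/= andbT.
Qed.

(** The homothety of ratio [s] centred at the vertex [a] sends the open simplex into the cap and
    multiplies volumes by s^d. *)
Lemma lebesgue_vertex_cap a s : a \in c -> 0 < s < 1 ->
  ((s ^+ d)%:E * leb K <= leb (vertex_cap a s))%E.
Proof.
move=> ac /andP[s0 s1].
have sV0 : 0 < s^-1 by rewrite invr_gt0.
pose b := p a - s^-1 *: p a.
have := @lebesgue_rV_dilate R d s^-1 b K sV0 measurable_open_simplex.
rewrite exprVn invrK => <-; apply: le_measure; rewrite ?inE.
- rewrite -[X in measurable X]setTI; apply: measurable_dilate => //.
  exact: measurable_open_simplex.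
- exact: measurable_vertex_cap.
move=> x /=; set y := dilate _ _ x => yK.
have xE : x = s *: y + (1 - s) *: p a.
  rewrite /y /dilate /b; apply/rowP => k; rewrite !mxE; field.
  by rewrite gt_eqF.
have by0 : {in c, forall b, 0 < bary c b y} by move/open_simplexP: yK.
split.
  apply/open_simplexP => b' b'c; rewrite xE bary_conv bary_vertex//.
  by rewrite ltr_wpDr ?mulr_gt0 ?by0// mulr_ge0// subr_ge0 ltW.
by rewrite /= xE bary_conv bary_vertex// eqxx mulr1 ltrDr mulr_gt0// by0.
Qed.

Lemma bernoulli_ineq (e : R) n : 0 <= e <= 1 -> 1 - n%:R * e <= (1 - e) ^+ n.
Proof.
move=> /andP[e0 e1]; elim: n => [|n IH]; first by rewrite mul0r subr0 expr0.
rewrite exprS; apply: le_trans (ler_wpM2l _ IH); last by rewrite subr_ge0.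
rewrite -natr1 -subr_ge0.
have : 0 <= n%:R * e * e by rewrite !mulr_ge0.
by congr (0 <= _); ring.
Qed.

(* The image of the closed simplex by a homothety of ratio s < 1 centred at the
   centroid lies in the open one, so that s ^+ d * |Kbar| <= |K|. *)
Lemma lebesgue_closed_simplex_le : (leb Kbar <= leb K)%E.
Proof.
have Kfin : leb K \is a fin_num by rewrite ge0_fin_numE// lebesgue_open_simplex_lty.
have Kbfin : leb Kbar \is a fin_num.
  by rewrite ge0_fin_numE// lebesgue_closed_simplex_lty.
rewrite -(fineK Kfin) -(fineK Kbfin) lee_fin.
have shrink s : 0 < s < 1 -> s ^+ d * fine (leb Kbar) <= fine (leb K).
  move=> /andP[s0 s1]; rewrite -lee_fin EFinM !fineK//.
  have sV0 : 0 < s^-1 by rewrite invr_gt0.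
  have := @lebesgue_rV_dilate R d s^-1 (centroid - s^-1 *: centroid) Kbar sV0
    measurable_closed_simplex.
  rewrite exprVn invrK => <-; apply: le_measure; rewrite ?inE.
  - rewrite -[X in measurable X]setTI; apply: measurable_dilate => //.
    exact: measurable_closed_simplex.
  - exact: measurable_open_simplex.
  move=> x /=; set y := dilate _ _ x => yK.
  have -> : x = (1 - s) *: centroid + (1 - (1 - s)) *: y.
    rewrite /y /dilate; apply/rowP => k; rewrite !mxE; field.
    by rewrite gt_eqF.
  apply: open_simplex_segment open_simplex_centroid yK _.
  by rewrite subr_gt0 s1/= gerBl ltW.
move: shrink (fine_ge0 (measure_ge0 leb Kbar)).
move: (fine _) (fine _) => w v shrink v0.
apply/ler_addgt0Pr => e e0.
pose t := Num.min 2^-1 (e / (d%:R * v + 1)).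
have D0 : 0 < d%:R * v + 1 by rewrite ltr_wpDl ?mulr_ge0.
have t0 : 0 < t by rewrite lt_min invr_gt0 ltr0n/= divr_gt0.
have t1 : t < 1 by rewrite gt_min invf_lt1 ?ltr1n.
have te : t * (d%:R * v) <= e.
  apply: (@le_trans _ _ (t * (d%:R * v + 1))).
    by rewrite ler_wpM2l ?lerDl// ltW.
  by rewrite -ler_pdivlMr// ge_min lexx orbT.
have := shrink (1 - t); rewrite subr_gt0 t1 gtrBl t0 => /(_ isT).
have : (1 - d%:R * t) * v <= (1 - t) ^+ d * v.
  by rewrite ler_wpM2r ?bernoulli_ineq// ?ltW.
rewrite mulrBl mul1r; move: te; rewrite mulrCA mulrA => te h1 h2.
have := le_trans h1 h2; rewrite lerBlDr => /le_trans; apply.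
by rewrite lerD2l.
Qed.

Lemma lebesgue_simplex_boundary : leb (Kbar `\` K) = 0%E.
Proof.
have mK := measurable_open_simplex; have mKb := measurable_closed_simplex.
rewrite measureD//; last exact: lebesgue_closed_simplex_lty.
rewrite setIC (setIidl sub_open_closed_simplex).
apply/eqP; rewrite eq_le; apply/andP; split; last first.
  rewrite sube_ge0 ?ge0_fin_numE ?lebesgue_open_simplex_lty//.
  by apply: le_measure; rewrite ?inE//; exact: sub_open_closed_simplex.
rewrite leeBlDr ?add0e; last by rewrite ge0_fin_numE// lebesgue_open_simplex_lty.
exact: lebesgue_closed_simplex_le.
Qed.

Lemma affine_on_simplex (f : Rd -> R) (g0 : R) (g : 'I_d -> R) x :
  (forall y, Kbar y -> f y = g0 + \sum_k g k * y ord0 k) -> Kbar x ->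
  f x = \sum_(a in c) bary c a x * f (p a).
Proof.
move=> fE xK; have pK a : a \in c -> Kbar (p a).
  by move=> ac; apply/closed_simplexP => b bc; rewrite bary_vertex.
rewrite (fE x xK) (eq_bigr (fun a => bary c a x * g0 +
  bary c a x * \sum_k g k * p a ord0 k)); last first.
  by move=> a ac; rewrite (fE _ (pK a ac)) mulrDr.
rewrite big_split/= -mulr_suml sum_bary mul1r; congr +%R.
under [RHS]eq_bigr do rewrite mulr_sumr.
rewrite exchange_big/=; apply: eq_bigr => k _.
rewrite -[in LHS](bary_comb x) summxE mulr_sumr; apply: eq_bigr => a _.
by rewrite mxE mulrCA.
Qed.

End Simplex.

(** * Nodal interpolation, stiffness and lumped mass *)

Section Mesh.
Context {R : realType} {d : nat} {Omega : set 'rV[R]_d}.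
Variable T : triangulation Omega.
Hypothesis Omega_open : open Omega.
Local Notation Rd := 'rV[R]_d.
Local Notation J := 'I_(nnodes T).
Local Notation p := (@node _ _ _ T).
Local Notation K c := (open_simplex p c).
Local Notation Kbar c := (closed_simplex p c).
Local Notation bar := (bary p).
Implicit Types (c : {set J}) (x : Rd).

Lemma closure_element c : c \in cells T -> closure (element (t := T) c) = Kbar c.
Proof.
by move=> cT; apply: closure_open_simplex; [exact: card_cell|exact: cell_indep].
Qed.

Lemma closure_Omega : closure Omega = \bigcup_(c in [set` cells T]) Kbar c.
Proof.
have meshE : \bigcup_(c in [set` cells T]) closure (element c) =
    \bigcup_(c in [set` cells T]) Kbar c.
  by apply: eq_bigcupr => c cT; exact: closure_element.
apply/seteqP; split.
  rewrite closureE => x; apply; split.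
    apply: closed_bigcup => [|c cT]; first exact: finite_finset.
    by apply: closed_closed_simplex; [exact: card_cell|exact: cell_indep].
  by move=> y; rewrite {1}(cells_cover T) meshE => /interior_subset.
move=> x [c cT]; rewrite -closure_element//.
by apply: closure_subset; exact: element_sub.
Qed.

(** By conformity the point lies in the simplex spanned by the common vertices. Its coordinates
    there, extended by 0, are barycentric coordinates in both cells, and these are unique. *)
Lemma bary_consistent c1 c2 x j : c1 \in cells T -> c2 \in cells T ->
  Kbar c1 x -> Kbar c2 x -> bar c1 j x = bar c2 j x.
Proof.
move=> c1T c2T x1 x2; have : (Kbar c1 `&` Kbar c2) x by [].
rewrite -!closure_element// cells_conform// => -[l [l1 lx] _].
pose l' a := if a \in c1 :&: c2 then l a else 0.
suff bE c : c \in cells T -> c1 :&: c2 \subset c -> bar c j x = l' j.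
  by rewrite !bE ?subsetIl ?subsetIr.
move=> cT sc; have [jc|jc] := boolP (j \in c); last first.
  rewrite bary_out// /l'; case: ifP => // jc12.
  by rewrite (fintype.subsetP sc _ jc12) in jc.
rewrite -(barycentric_uniq (card_cell cT) (cell_indep cT) (l := l'))//.
have restrict (V : nmodType) (F : J -> V) : (forall a, a \notin c1 :&: c2 -> F a = 0) ->
    \sum_(a in c1 :&: c2) F a = \sum_(a in c) F a.
  move=> F0; rewrite big_mkcond [RHS]big_mkcond; apply: eq_bigr => a _.
  case: ifPn => [/(fintype.subsetP sc) ->//|/F0 ->]; by case: ifP.
split.
  rewrite -restrict => [|a /negbTE]; last by rewrite /l' => ->.
  by rewrite -[RHS]l1; apply: eq_bigr => a ac; rewrite /l' ac.
rewrite -restrict => [|a /negbTE]; last by rewrite /l' => ->; rewrite scale0r.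
by rewrite [LHS]lx; apply: eq_bigr => a ac; rewrite /l' ac.
Qed.

(* The choice of the cell does not matter, by bary_consistent. *)
Definition hat (j : J) (x : Rd) : R :=
  if [pick c in cells T | `[< Kbar c x >]] is Some c then bar c j x else 0.

Lemma hatE c j x : c \in cells T -> Kbar c x -> hat j x = bar c j x.
Proof.
move=> cT xc; rewrite /hat; case: pickP => [c' /andP[c'T /asboolP xc']|/(_ c)].
  exact: bary_consistent.
by rewrite cT/= => /asboolP.
Qed.

Lemma hat_out j x : ~ closure Omega x -> hat j x = 0.
Proof.
rewrite closure_Omega => xO; rewrite /hat; case: pickP => // c /andP[cT /asboolP xc].
by exfalso; apply: xO; exists c.
Qed.

Lemma hat_ge0 j x : 0 <= hat j x.
Proof.
rewrite /hat; case: pickP => // c /andP[cT /asboolP xc].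
have [jc|jc] := boolP (j \in c); last by rewrite bary_out.
by move/(closed_simplexP (card_cell cT) (cell_indep cT)): xc; apply.
Qed.

Lemma sum_hat_cell (V : lmodType R) (F : J -> V) c x : c \in cells T -> Kbar c x ->
  \sum_j hat j x *: F j = \sum_(a in c) bar c a x *: F a.
Proof.
move=> cT xc; rewrite [RHS]big_mkcond; apply: eq_bigr => a _.
rewrite (hatE _ cT xc); case: ifPn => // ac; by rewrite bary_out// scale0r.
Qed.

Lemma sum_hat x : \sum_j hat j x = (x \in closure Omega)%:R.
Proof.
have [/set_mem|] := boolP (x \in closure Omega).
  rewrite closure_Omega => -[c cT xc].
  have := sum_hat_cell (fun=> 1 : R^o) cT xc.
  under eq_bigr do rewrite /GRing.scale/= mulr1.
  move=> ->; under eq_bigr do rewrite /GRing.scale/= mulr1.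
  by rewrite (sum_bary (card_cell cT) (cell_indep cT)).
by rewrite notin_setE => xO; rewrite big1// => j _; exact: hat_out.
Qed.

Lemma node_closed c j : c \in cells T -> j \in c -> Kbar c (p j).
Proof.
move=> cT jc; apply/(closed_simplexP (card_cell cT) (cell_indep cT)) => a ac.
by rewrite (bary_vertex (card_cell cT) (cell_indep cT)).
Qed.

Lemma closure_node j : closure Omega (p j).
Proof.
have [c cT jc] := node_in_cell j; rewrite closure_Omega; exists c => //.
exact: node_closed.
Qed.

Lemma hat_node i j : hat j (p i) = (j == i)%:R.
Proof.
have [c cT ic] := node_in_cell i.
by rewrite (hatE j cT (node_closed cT ic)) (bary_vertex (card_cell cT) (cell_indep cT)).
Qed.

(** Pasting of affine functions over a finite cover by closed sets. *)
Lemma continuous_hat j : {within closure Omega, continuous (hat j)}.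
Proof.
have -> : closure Omega = \big[setU/set0]_(c <- enum (cells T)) Kbar c.
  rewrite closure_Omega -bigcup_seq; apply: eq_bigcupl.
  by split => c /=; rewrite mem_enum.
have : {subset enum (cells T) <= cells T} by move=> c; rewrite mem_enum.
elim: (enum _) => [|c s IH] sT; first by rewrite big_nil; exact: continuous_subspace0.
have sT' : {subset s <= cells T} by move=> c' c's; apply: sT; rewrite inE c's orbT.
have cT : c \in cells T by apply: sT; rewrite inE eqxx.
have closedK c' : c' \in cells T -> closed (Kbar c').
  by move=> c'T; apply: closed_closed_simplex; [exact: card_cell|exact: cell_indep].
rewrite big_cons; apply: withinU_continuous.
- exact: closedK.
- by apply: closed_bigsetU => c' /sT'; exact: closedK.
- apply: (@subspace_eq_continuous _ _ _ (bar c j)); last first.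
    by apply: continuous_subspaceT; exact: continuous_bary.
  by move=> x /set_mem xc; exact/esym/hatE.
- exact: IH.
Qed.

(* The homothety centred at the node j maps x close to the node; a neighbourhood
   of the image is covered by cells containing j, and enlarging them back
   covers a neighbourhood of x. *)
Lemma hat_interior j x : Omega (p j) -> ~ Omega x -> hat j x = 0.
Proof.
move=> jO xO; apply/eqP; apply: contra_notT xO => hx0.
have [c cT xc] : exists2 c, c \in cells T & Kbar c x.
  have : closure Omega x by apply: contrapT => /(hat_out j)/eqP; exact/negP.
  by rewrite closure_Omega => -[c cT xc]; exists c.
have hx : 0 < hat j x by rewrite lt_neqAle eq_sym hx0 hat_ge0.
pose h s (y : Rd) := s *: y + (1 - s) *: p j.
have hcont s : continuous (h s).
  move=> y; apply: continuousD; last exact: cst_continuous.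
  exact: scaler_continuous.
have [s s01 hsx] : exists2 s : R, 0 < s < 1 & Omega (h s x).
  move: Omega_open; rewrite openE => /(_ _ jO).
  rewrite /interior nbhs_ballP => -[e /= e0 eO].
  pose D := `|p j - x| + 1; have D0 : 0 < D by rewrite ltr_wpDl.
  have eD : 0 < e / D / 2 by rewrite !divr_gt0.
  pose m := Num.min 2^-1 (e / D / 2).
  have m0 : 0 < m by rewrite lt_min invr_gt0 ltr0n.
  have m1 : m < 1 by rewrite gt_min invf_lt1 ?ltr1n.
  have mE : m <= e / D / 2 by rewrite ge_min lexx orbT.
  exists m; first by rewrite m0.
  apply: eO; rewrite -ball_normE/= /h.
  have -> : p j - (m *: x + (1 - m) *: p j) = m *: (p j - x).
    by apply/rowP => k; rewrite !mxE; ring.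
  rewrite normrZ (gtr0_norm m0).
  have : m * `|p j - x| <= e / D / 2 * D.
    by apply: ler_pM => //; [exact: ltW|rewrite lerDl].
  move=> /le_lt_trans; apply; rewrite mulrAC divfK ?gt_eqF//.
  by rewrite ltr_pdivrMr// mulr_natr mulr2n ltrDl.
case/andP: s01 => s0 s1.
have jc : j \in c.
  by apply: contraTT hx => /bary_out jc; rewrite (hatE j cT xc) jc ltxx.
have hsxc : Kbar c (h s x).
  apply/(closed_simplexP (card_cell cT) (cell_indep cT)) => a ac.
  rewrite /h bary_conv (bary_vertex (card_cell cT) (cell_indep cT))//.
  rewrite addr_ge0 ?mulr_ge0 ?subr_ge0 ?(ltW s0) ?(ltW s1)//.
  by move/(closed_simplexP (card_cell cT) (cell_indep cT)): xc; apply.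
have hat_hsx : 1 - s < hat j (h s x).
  rewrite (hatE j cT hsxc) /h bary_conv (bary_vertex (card_cell cT) (cell_indep cT))//.
  by rewrite eqxx mulr1 ltrDr mulr_gt0// -(hatE j cT xc).
have hat_near : \forall z \near h s x, 1 - s < hat j z.
  have : {in Omega, continuous (hat j)}.
    rewrite -continuous_open_subspace//.
    apply: (@continuous_subspaceW _ _ Omega (closure Omega)); last exact: continuous_hat.
    exact: subset_closure.
  move=> hc; apply: (hc (h s x) (mem_set hsx) [set r | 1 - s < r]).
  by apply: open_nbhs_nbhs; split; [exact: open_gt|].
have O_near : \forall z \near h s x, Omega z by apply: open_nbhs_nbhs; split.
rewrite (cells_cover T) /interior.
have := hcont s x _ (@filterI _ _ (nbhs_filter (h s x)) _ _ hat_near O_near).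
apply: (@filterS _ _ (nbhs_filter x)) => y [/= hy Oy].
have : closure Omega (h s y) by exact: subset_closure.
rewrite closure_Omega => -[c' c'T yc']; exists c' => //.
rewrite closure_element//.
move: hy; rewrite (hatE j c'T yc') => hy.
have jc' : j \in c'.
  by apply: contraTT hy => /bary_out ->; rewrite -leNgt subr_ge0 ltW.
apply/(closed_simplexP (card_cell c'T) (cell_indep c'T)) => a ac'.
move/(closed_simplexP (card_cell c'T) (cell_indep c'T)): yc' => /(_ a ac').
move: hy; rewrite /h !bary_conv !(bary_vertex (card_cell c'T) (cell_indep c'T))//.
rewrite eqxx mulr1 ltrDr pmulr_rgt0// => hy.
have [->|_] := eqVneq a j; first by move=> _; exact: ltW.
by rewrite mulr0 addr0 pmulr_rge0.
Qed.

Definition interp (u : J -> R) x : R := \sum_j u j * hat j x.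

Definition slope (u : J -> R) c (k : 'I_d) : R := \sum_j u j * bary_grad p c j k.

Lemma interp_cell u c x : c \in cells T -> Kbar c x ->
  interp u x = \sum_j u j * bar c j x.
Proof. by move=> cT xc; apply: eq_bigr => j _; rewrite (hatE j cT xc). Qed.

Lemma interp_affine u c x : c \in cells T -> Kbar c x ->
  interp u x = \sum_j u j * bary_coef p c j (lshift d ord0) +
               \sum_k slope u c k * x ord0 k.
Proof.
move=> cT xc; rewrite (interp_cell _ cT xc) /bary.
under eq_bigr do rewrite mulrDr.
rewrite big_split/=; congr +%R.
under [RHS]eq_bigr do rewrite mulr_suml.
rewrite exchange_big/=; apply: eq_bigr => j _; rewrite mulr_sumr.
by apply: eq_bigr => k _; rewrite mulrA.
Qed.

Lemma interp_out u x : ~ closure Omega x -> interp u x = 0.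
Proof. by move=> xO; apply: big1 => j _; rewrite hat_out// mulr0. Qed.

Lemma interp_node u i : interp u (p i) = u i.
Proof.
rewrite /interp (bigD1 i)//= hat_node eqxx mulr1 big1 ?addr0// => j ji.
by rewrite hat_node (negbTE ji) mulr0.
Qed.

Lemma interp_interior u x : (forall j, ~ Omega (p j) -> u j = 0) -> ~ Omega x ->
  interp u x = 0.
Proof.
move=> u0 xO; apply: big1 => j _; have [jO|/u0 ->] := pselect (Omega (p j)).
  by rewrite hat_interior// mulr0.
by rewrite mul0r.
Qed.

Lemma continuous_interp u : {within closure Omega, continuous (interp u)}.
Proof.
move=> x; apply: (@continuous_big _ _ _ _ _ _ _ _ _ _ x) => [|j _ y].
  exact: add_continuous.
by apply: continuousM; [exact: cst_continuous|exact: continuous_hat].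
Qed.

(** Continuity on the whole space, not only on the closure of Omega: the segments used for
    increments may leave the domain. The pieces are the closure and the complement of Omega, where
    the interpolant vanishes by [hat_interior]. *)
Lemma continuous_interp_interior u : (forall j, ~ Omega (p j) -> u j = 0) ->
  continuous (interp u).
Proof.
move=> u0; apply/continuous_subspace_setT.
have <- : closure Omega `|` ~` Omega = setT.
  apply/seteqP; split => // x _; have [xO|xO] := pselect (Omega x); last by right.
  by left; exact: subset_closure.
apply: withinU_continuous; [exact: closed_closure|exact: open_closedC| |].
  exact: continuous_interp.
apply: (@subspace_eq_continuous _ _ _ (cst 0)).
  by move=> x /set_mem xO; exact/esym/interp_interior.
by apply: continuous_subspaceT => x; exact: cst_continuous.
Qed.

Lemma eq_on_closure (f g : Rd -> R) (A D : set Rd) x :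
  {within D, continuous f} -> continuous g -> A `<=` D -> {in A, f =1 g} ->
  closure A x -> D x -> f x = g x.
Proof.
move=> /subspace_continuousP fc gc AD fg Ax Dx.
apply/eqP; rewrite -subr_eq0 -normr_le0; apply/ler_addgt0Pr => e e0.
have e2 : 0 < e / 2 by rewrite divr_gt0.
have fx := fc x Dx _ (@nbhsx_ballx R R (f x) _ e2).
have gx := gc x _ (@nbhsx_ballx R R (g x) _ e2).
have [y [Ay [/= fy gy]]] := Ax _ (@filterI _ _ (nbhs_filter x) _ _ fx gx).
have {}fy := fy (AD _ Ay).
rewrite add0r (splitr e).
have -> : f x - g x = (f x - f y) - (g x - g y) by rewrite (fg y (mem_set Ay)); ring.
by apply: (le_trans (ler_normB _ _)); apply: lerD; exact: ltW.
Qed.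

Lemma ReD (x y : R[i]) : complex.Re (x + y) = complex.Re x + complex.Re y.
Proof. by case: x y => [? ?] [? ?]. Qed.

Lemma ImD (x y : R[i]) : complex.Im (x + y) = complex.Im x + complex.Im y.
Proof. by case: x y => [? ?] [? ?]. Qed.

Lemma Re_sum (I : Type) (r : seq I) (P : pred I) (F : I -> R[i]) :
  complex.Re (\sum_(i <- r | P i) F i) = \sum_(i <- r | P i) complex.Re (F i).
Proof. exact: (big_morph _ ReD). Qed.

Lemma Im_sum (I : Type) (r : seq I) (P : pred I) (F : I -> R[i]) :
  complex.Im (\sum_(i <- r | P i) F i) = \sum_(i <- r | P i) complex.Im (F i).
Proof. exact: (big_morph _ ImD). Qed.

Lemma ReMreal (x : R[i]) (r : R) : complex.Re (x * r%:C%C) = complex.Re x * r.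
Proof. by case: x => ? ? /=; rewrite mulr0 subr0. Qed.

Lemma ImMreal (x : R[i]) (r : R) : complex.Im (x * r%:C%C) = complex.Im x * r.
Proof. by case: x => ? ? /=; rewrite mulr0 add0r. Qed.

Lemma complexP (x y : R[i]) : complex.Re x = complex.Re y -> complex.Im x = complex.Im y -> x = y.
Proof. by case: x y => [? ?] [? ?] /= -> ->. Qed.

Lemma partial_interp u c x k : c \in cells T -> K c x ->
  partial k (interp u) x = slope u c k.
Proof.
move=> cT xc; have Ksub := @sub_open_closed_simplex _ _ _ _ _ (card_cell cT) (cell_indep cT).
pose A (y : Rd) := \sum_j u j * bary_coef p c j (lshift d ord0) +
               \sum_k slope u c k * y ord0 k.
transitivity ('D_(delta_mx ord0 k) A x).
  apply: near_eq_derive.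
  have : \forall y \near x, K c y.
    apply: open_nbhs_nbhs; split => //.
    by apply: open_open_simplex; [exact: card_cell|exact: cell_indep].
  by apply: (@filterS _ _ (nbhs_filter x)) => y /Ksub; exact: interp_affine.
rewrite /derive; apply: cvg_lim => //; apply: cvg_near_cst.
near=> h; have h0 : h != 0 by near: h; exact: nbhs_dnbhs_neq.
rewrite /A/= opprD addrACA subrr add0r -sumrB (bigD1 k)//= !mxE !eqxx big1 => [|i ik].
  by rewrite addr0 mulr1 mulrDr addrK /GRing.scale/= mulrCA mulVf// mulr1.
by rewrite !mxE (negbTE ik) andbF mulr0 add0r subrr.
Unshelve. all: by end_near. Qed.

Definition cinterp (z : J -> R[i]) x : R[i] :=
  Complex (interp (fun j => complex.Re (z j)) x) (interp (fun j => complex.Im (z j)) x).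

Lemma cinterpE z x : cinterp z x = \sum_j z j * (hat j x)%:C%C.
Proof.
apply: complexP; rewrite ?Re_sum ?Im_sum; apply: eq_bigr => j _;
  by rewrite ?ReMreal ?ImMreal.
Qed.

Lemma cinterp_node z i : cinterp z (p i) = z i.
Proof. by apply: complexP; rewrite /= interp_node. Qed.

Lemma cinterp_out z x : ~ closure Omega x -> cinterp z x = 0.
Proof. by move=> xO; apply: complexP; rewrite /= interp_out. Qed.

Lemma V_h_cinterp z : V_h T (cinterp z).
Proof.
split; last by move=> x; exact: cinterp_out.
  by split; exact: continuous_interp.
move=> c cT.
pose re j := complex.Re (z j); pose im j := complex.Im (z j).
exists (fun k => Complex (slope re c k) (slope im c k)).
exists (Complex (\sum_j re j * bary_coef p c j (lshift d ord0))
                (\sum_j im j * bary_coef p c j (lshift d ord0))) => x xc.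
have {}xc := sub_open_closed_simplex (card_cell cT) (cell_indep cT) xc.
apply: complexP.
  rewrite ReD Re_sum [LHS](interp_affine _ cT xc); congr +%R.
  by apply: eq_bigr => k _; rewrite ReMreal.
rewrite ImD Im_sum [LHS](interp_affine _ cT xc); congr +%R.
by apply: eq_bigr => k _; rewrite ImMreal.
Qed.

(** Affinity on an open cell passes to the closed cell by continuity, and an affine function is
    recovered from the vertex values through barycentric coordinates. *)
Lemma V_hP v : V_h T v -> v = cinterp (fun j => v (p j)).
Proof.
move=> [[cre cim] vaff v0]; apply/funext => x.
have [|xO] := pselect (closure Omega x); last by rewrite v0// cinterp_out.
rewrite closure_Omega => -[c cT xc].
have cc := card_cell cT; have ic := cell_indep cT.
have [a [b vE]] := vaff c cT.
have Kbar_sub : Kbar c `<=` closure Omega.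
  by rewrite closure_Omega => y yc; exists c.
have K_sub := sub_open_closed_simplex cc ic.
have ext (f : Rd -> R) (a0 : R) (a1 : 'I_d -> R) :
    {within closure Omega, continuous f} ->
    (forall y, K c y -> f y = a0 + \sum_k a1 k * y ord0 k) ->
    f x = \sum_j f (p j) * hat j x.
  move=> cf fE; rewrite (@affine_on_simplex _ _ _ p c cc ic f a0 a1)//.
    rewrite big_mkcond; apply: eq_bigr => j _; rewrite (hatE j cT xc) mulrC.
    by case: ifPn => // jc; rewrite bary_out// mulr0.
  move=> y yc; apply: (@eq_on_closure f (fun w : Rd => a0 + \sum_k a1 k * w ord0 k)
    (K c) (closure Omega)) => //.
  - move=> w; apply: continuousD; first exact: cst_continuous.
    apply: (@continuous_big _ _ _ _ _ _ _ _ _ _ w) => [|k _ w'].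
      exact: add_continuous.
    by apply: continuousM; [exact: cst_continuous|exact: coord_continuous].
  - by move=> w /K_sub /Kbar_sub.
  - by move=> w /set_mem; exact: fE.
  - by rewrite (closure_open_simplex cc ic).
  - exact: Kbar_sub.
apply: complexP.
  apply: (ext (re_fun v) (complex.Re b) (fun k => complex.Re (a k)) cre) => y yc.
  rewrite /re_fun vE// ReD Re_sum; congr +%R.
  by apply: eq_bigr => k _; rewrite ReMreal.
apply: (ext (im_fun v) (complex.Im b) (fun k => complex.Im (a k)) cim) => y yc.
rewrite /im_fun vE// ImD Im_sum; congr +%R.
by apply: eq_bigr => k _; rewrite ImMreal.
Qed.

Lemma cinterp_inj z z' : cinterp z = cinterp z' -> z =1 z'.
Proof. by move=> zz' j; rewrite -(cinterp_node z) zz' cinterp_node. Qed.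

(** A function chosen by [xget] is known only once its defining property is shown to have exactly
    one solution; the same pattern serves for [A_h] and [resolvent]. *)
Lemma nodal_basisE j : nodal_basis j = cinterp (fun i => (i == j)%:R).
Proof.
apply: xget_unique; first by split=> [|i]; [exact: V_h_cinterp|rewrite cinterp_node].
move=> v [/V_hP vE vj]; rewrite vE; congr cinterp; apply/funext => i.
by rewrite vj.
Qed.

Definition interior_supported (z : J -> R[i]) := forall j, ~ Omega (p j) -> z j = 0.

Lemma S_h_cinterp z : interior_supported z -> S_h T (cinterp z).
Proof.
move=> z0; split=> [|x [_]]; first exact: V_h_cinterp.
rewrite ((interior_id Omega).1 Omega_open) => xO.
by apply: complexP; rewrite /= interp_interior// => j jO; rewrite z0.
Qed.

Lemma S_hP v : S_h T v -> exists2 z, interior_supported z & v = cinterp z.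
Proof.
move=> [/V_hP vE v0]; exists (fun j => v (p j)) => // j jO; apply: v0; split.
  exact: closure_node.
by move=> /interior_subset.
Qed.

(** A vertex of [c1] missing from [c2] would have a positive coordinate in the first cell and a zero
    one in the second. *)
Lemma open_disjoint c1 c2 x : c1 \in cells T -> c2 \in cells T ->
  K c1 x -> K c2 x -> c1 = c2.
Proof.
move=> c1T c2T x1 x2; apply/eqP; rewrite eqEcard !card_cell// leqnn andbT.
apply/fintype.subsetP => a ac1; apply: contraT => ac2.
have x1' := sub_open_closed_simplex (card_cell c1T) (cell_indep c1T) x1.
have x2' := sub_open_closed_simplex (card_cell c2T) (cell_indep c2T) x2.
move/(open_simplexP (card_cell c1T) (cell_indep c1T)): x1 => /(_ a ac1).
by rewrite (bary_consistent a c1T c2T x1' x2') bary_out// ltxx.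
Qed.

End Mesh.

(** * Integrals of simple functions *)

Section SimpleIntegral.
Context {R : realType} {n : nat}.
Local Notation leb := (lebesgue_rV n : {measure set 'rV[R]_n -> \bar R}).
Variables (D : set 'rV[R]_n) (I : finType) (E : I -> set 'rV[R]_n).
Hypothesis mE : forall i, measurable (E i).
Hypothesis Efin : forall i, (leb (E i) < +oo)%E.
Hypothesis ED : forall i, E i `<=` D.

Lemma Rintegral_simple (a : I -> R) :
  Rintegral leb D (fun x => \sum_i a i * \1_(E i) x) =
  \sum_i a i * fine (leb (E i)).
Proof.
rewrite Rintegral_mkcond (_ : _ \_ _ = fun x => \sum_i a i * \1_(E i) x); last first.
  apply/funext => x; rewrite patchE; case: ifPn => //.
  rewrite notin_setE => xD; rewrite big1// => i _.
  by rewrite indicE memNset ?mulr0// => /ED.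
have intE i : leb.-integrable setT (EFin \o \1_(E i)).
  apply/integrableP; split; first by apply/measurable_EFinP; exact: measurable_indic.
  rewrite (eq_integral (EFin \o \1_(E i))); last first.
    by move=> x _; rewrite /= ger0_norm.
  by rewrite integral_indic// setIT; exact: Efin.
have intaE i : leb.-integrable setT (fun x => (a i)%:E * (\1_(E i) x)%:E)%E.
  by apply: integrableZl => //; exact: intE.
rewrite /Rintegral; under eq_integral do rewrite -sumEFin.
under eq_integral do under eq_bigr do rewrite EFinM.
rewrite integral_sum//.
rewrite (eq_bigr (fun i => (a i * fine (leb (E i)))%:E)) ?sumEFin// => i _.
rewrite integralZl//; last exact: intE.
rewrite integral_indic// setIT EFinM fineK// ge0_fin_numE//; exact: Efin.
Qed.

Lemma cintegral_simple (z : I -> R[i]) :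
  cintegral leb D (fun x => \sum_i z i * (\1_(E i) x)%:C%C) =
  \sum_i z i * (fine (leb (E i)))%:C%C.
Proof.
apply: complexP.
  rewrite Re_sum /= -[RHS](@eq_bigr _ _ _ _ _ _ (fun i => complex.Re (z i) * fine (leb (E i))));
    last by move=> i _; rewrite ReMreal.
  rewrite -Rintegral_simple; congr Rintegral; apply/funext => x.
  by rewrite /re_fun Re_sum; apply: eq_bigr => i _; rewrite ReMreal.
rewrite Im_sum /= -[RHS](@eq_bigr _ _ _ _ _ _ (fun i => complex.Im (z i) * fine (leb (E i))));
  last by move=> i _; rewrite ImMreal.
rewrite -Rintegral_simple; congr Rintegral; apply/funext => x.
by rewrite /im_fun Im_sum; apply: eq_bigr => i _; rewrite ImMreal.
Qed.

End SimpleIntegral.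

Section MeasureSums.
Context {disp : measure_display} {X : measurableType disp} {R : realType}.
Variables (mu : {measure set X -> \bar R}) (I : finType) (P : pred I).
Variable E : I -> set X.
Hypothesis mE : forall i, P i -> measurable (E i).

Lemma sum_measureE (k : I -> R) : (forall i, P i -> 0 <= k i) ->
  (\sum_(i | P i) (k i)%:E * mu (E i) =
   \int[mu]_x (\sum_(i | P i) k i * \1_(E i) x)%:E)%E.
Proof.
move=> k0; under [RHS]eq_integral do rewrite -sumEFin big_mkcond.
rewrite ge0_integral_sum//; last 2 first.
- move=> i; have [Pi|_] := boolP (P i); last exact: measurable_cst.
  by apply/measurable_EFinP/measurable_funM => //; apply: measurable_indic; exact: mE.
- move=> i x _; have [Pi|//] := boolP (P i); rewrite lee_fin mulr_ge0 ?k0//.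
rewrite big_mkcond; apply: eq_bigr => i _; have [Pi|_] := boolP (P i); last first.
  by rewrite integral0.
under eq_integral do rewrite EFinM.
have m1 : measurable_fun setT (\1_(E i) : X -> R) by apply: measurable_indic; exact: mE.
rewrite ge0_integralZl_EFin ?k0//; last exact/measurable_EFinP.
by rewrite integral_indic ?setIT//; exact: mE.
Qed.

Lemma measurable_sum_indic (k : I -> R) :
  measurable_fun setT (fun x => (\sum_(i | P i) k i * \1_(E i) x)%:E).
Proof.
apply/measurable_EFinP; under eq_fun do rewrite big_mkcond.
apply: measurable_sum => i; have [Pi|_] := boolP (P i); last exact: measurable_cst.
by apply: measurable_funM => //; apply: measurable_indic; exact: mE.
Qed.

Lemma measure_le_sum (V : set X) : measurable V ->
  (forall x, V x -> exists2 i, P i & E i x) -> (mu V <= \sum_(i | P i) mu (E i))%E.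
Proof.
move=> mV VE; under [leRHS]eq_bigr do rewrite -[mu _]mul1e.
rewrite sum_measureE// -[V in leLHS]setIT -integral_indic//.
apply: ge0_le_integral => //.
- by apply/measurable_EFinP; exact: measurable_indic.
- exact: (measurable_sum_indic (fun=> 1)).
move=> x _; rewrite lee_fin [leLHS]indicE.
have [/set_mem/VE[i Pi xi]|_] := boolP (x \in V).
  by rewrite (bigD1 i)//= indicE mem_set// mul1r lerDl sumr_ge0.
by rewrite sumr_ge0.
Qed.

Lemma sum_le_integral (f : X -> R) (k : I -> R) : measurable_fun setT f ->
  (forall x, 0 <= f x) -> (forall i, P i -> 0 <= k i) ->
  (forall i j x, P i -> P j -> E i x -> E j x -> i = j) ->
  (forall i x, P i -> E i x -> k i <= f x) ->
  (\sum_(i | P i) (k i)%:E * mu (E i) <= \int[mu]_x (f x)%:E)%E.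
Proof.
move=> mf f0 k0 dE kf; rewrite sum_measureE//; apply: ge0_le_integral => //.
- by move=> x _; rewrite lee_fin sumr_ge0// => i Pi; rewrite mulr_ge0 ?k0.
- exact: measurable_sum_indic.
- exact/measurable_EFinP.
move=> x _; rewrite lee_fin.
have [[i Pi xi]|nE] := pselect (exists2 i, P i & E i x).
  rewrite (bigD1 i)//= indicE mem_set// mulr1 big1 ?addr0; first exact: kf.
  move=> j /andP[Pj ji]; rewrite indicE memNset ?mulr0// => xj.
  by move/eqP: ji; apply; exact: (dE _ _ x).
rewrite big1// => i Pi; rewrite indicE memNset ?mulr0// => xi.
by apply: nE; exists i.
Qed.

Lemma sum_measure_le (V : set X) : measurable V ->
  (forall i j x, P i -> P j -> E i x -> E j x -> i = j) ->
  (forall i, P i -> E i `<=` V) -> (\sum_(i | P i) mu (E i) <= mu V)%E.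
Proof.
move=> mV dE EV; under eq_bigr do rewrite -[mu _]mul1e.
rewrite -[V in leRHS]setIT -integral_indic//.
apply: (sum_le_integral (f := \1_V) (k := fun=> 1)) => //.
by move=> i x Pi xi; rewrite indicE mem_set//; exact: EV xi.
Qed.

End MeasureSums.

(** * Stiffness and lumped mass matrices *)

Section MeshForms.
Context {R : realType} {d : nat} {Omega : set 'rV[R]_d}.
Variable T : triangulation Omega.
Hypothesis Omega_open : open Omega.
Local Notation Rd := 'rV[R]_d.
Local Notation leb := (lebesgue_rV d : {measure set 'rV[R]_d -> \bar R}).
Local Notation J := 'I_(nnodes T).
Local Notation p := (@node _ _ _ T).
Local Notation K c := (open_simplex p c).
Local Notation Kbar c := (closed_simplex p c).
Local Notation bar := (bary p).
Implicit Types (c : {set J}) (x : Rd).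

Definition interior_node (j : J) : bool := p j \in Omega.

(** Empty when [c] is not a cell, so that sums may range over all sets of nodes. *)
Definition cell c : set Rd := [set x | c \in cells T /\ K c x].

Lemma cellE c : c \in cells T -> cell c = K c.
Proof. by move=> cT; apply/seteqP; split => x; rewrite /cell/= ?cT// => -[]. Qed.

Lemma cell0 c : c \notin cells T -> cell c = set0.
Proof. by move=> /negP cT; apply/seteqP; split => x; rewrite /cell/= => -[]. Qed.

Lemma measurable_cell c : measurable (cell c).
Proof.
have [cT|cT] := boolP (c \in cells T); last by rewrite cell0.
by rewrite cellE//; apply: measurable_open_simplex; [exact: card_cell|exact: cell_indep].
Qed.

Lemma cell_lty c : (leb (cell c) < +oo)%E.
Proof.
have [cT|cT] := boolP (c \in cells T); last by rewrite cell0// measure0.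
rewrite cellE//; apply: lebesgue_open_simplex_lty; [exact: card_cell|exact: cell_indep].
Qed.

Lemma cell_sub c : cell c `<=` Omega.
Proof. by move=> x [cT xc]; exact: element_sub xc. Qed.

Lemma cell_disjoint c1 c2 x : cell c1 x -> cell c2 x -> c1 = c2.
Proof. by move=> [c1T x1] [c2T x2]; exact: open_disjoint x1 x2. Qed.

Definition vol c : R := fine (leb (cell c)).

Lemma vol_ge0 c : 0 <= vol c.
Proof. by rewrite fine_ge0. Qed.

Lemma bary_grad_out c a k : a \notin c -> bary_grad p c a k = 0.
Proof.
move=> ac; rewrite /bary_grad /bary_coef big1// => i _.
by case: eqP => [ia|_]; rewrite ?mul0r//; case/negP: ac; rewrite -ia enum_valP.
Qed.

(** The Dirichlet product of two nodal functions, whose gradients are constant on each cell; sets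
    that are not cells have [vol] 0. *)
Definition stiff (i j : J) : R :=
  \sum_c vol c * \sum_k bary_grad p c i k * bary_grad p c j k.

Lemma stiff_sym i j : stiff i j = stiff j i.
Proof.
by apply: eq_bigr => c _; congr *%R; apply: eq_bigr => k _; rewrite mulrC.
Qed.

Lemma stiff_row i : \sum_j stiff i j = 0.
Proof.
rewrite exchange_big/= big1// => c _; rewrite -mulr_sumr.
have [cT|cT] := boolP (c \in cells T); last by rewrite /vol cell0// measure0 mul0r.
rewrite exchange_big/= big1 ?mulr0// => k _; rewrite -mulr_sumr.
rewrite (bigID [in c])/= (sum_bary_grad (card_cell cT) (cell_indep cT)) add0r.
by rewrite big1 ?mulr0// => j; exact: bary_grad_out.
Qed.

Lemma energy_stiff u : energy stiff u u = \sum_c vol c * \sum_k slope u c k ^+ 2.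
Proof.
rewrite /energy /stiff; under eq_bigr do under eq_bigr do rewrite mulr_suml.
under eq_bigr do rewrite exchange_big.
rewrite exchange_big/=; apply: eq_bigr => c _.
under eq_bigr do under eq_bigr do rewrite -mulrA.
under eq_bigr do rewrite -mulr_sumr.
rewrite -mulr_sumr; congr *%R.
transitivity (\sum_k \sum_i \sum_j (u i * bary_grad p c i k) * (u j * bary_grad p c j k)).
  rewrite [RHS]exchange_big; apply: eq_bigr => i _.
  rewrite [RHS]exchange_big; apply: eq_bigr => j _.
  by rewrite mulr_suml; apply: eq_bigr => k _; ring.
apply: eq_bigr => k _; rewrite expr2 /slope mulr_suml; apply: eq_bigr => i _.
by rewrite mulr_sumr.
Qed.

Lemma barycentric_domainP (j : J) x : barycentric_domain j x <-> exists c,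
  [/\ c \in cells T, j \in c, K c x & forall a, a \in c -> a != j -> bar c a x < bar c j x].
Proof.
split=> [[c [l [cT jc xc xl lj]]]|[c [cT jc xc xj]]]; exists c.
  have lE := barycentric_uniq (card_cell cT) (cell_indep cT) xl.
  by split => // a ac aj; rewrite -!lE// lj.
exists (bar c ^~ x); split => //.
by apply: barycentric_bary; [exact: card_cell|exact: cell_indep].
Qed.

Lemma measurable_barycentric_domain (j : J) : measurable (barycentric_domain j).
Proof.
pose B c a := [set x | (j \in c) && ((a \in c) && (a != j) ==> (bar c a x < bar c j x))].
have -> : barycentric_domain j =
    \bigcup_(c in [set: {set J}]) (cell c `&` \bigcap_(a in [set: J]) B c a).
  apply/seteqP; split => x.
    move/barycentric_domainP => [c [cT jc xc xj]]; exists c => //; split => // a _.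
    by rewrite /B/= jc; apply/implyP => /andP[ac aj]; exact: xj.
  move=> [c _ [[cT xc] xB]]; apply/barycentric_domainP; exists c.
  have jc : j \in c by have := xB j I; rewrite /B/= => /andP[].
  split => // a ac aj; have := xB a I; rewrite /B/= jc/= => /implyP; apply.
  by rewrite ac.
apply: fin_bigcup_measurable; first exact: finite_finset.
move=> c _; apply: measurableI; first exact: measurable_cell.
apply: fin_bigcap_measurable; first exact: finite_finset.
move=> a _; rewrite /B; have [jc|jc] := boolP (j \in c); last first.
  by rewrite (_ : mkset _ = set0)//; apply/seteqP; split.
have [aj|aj] := boolP ((a \in c) && (a != j)); last first.
  by rewrite (_ : mkset _ = setT)//; apply/seteqP; split.
rewrite -[X in measurable X]setTI /=.
have := @measurable_fun_ltr _ _ _ setT (bar c a) (bar c j)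
  (measurable_bary _ _ _) (measurable_bary _ _ _) measurableT [set true] I.
by congr measurable; congr setI; apply/seteqP; split => x /=.
Qed.

Lemma barycentric_domain_sub (j : J) : barycentric_domain j `<=` Omega.
Proof. by move=> x /barycentric_domainP[c [cT _ xc _]]; exact: element_sub xc. Qed.

Lemma barycentric_domain_disjoint (i j : J) x :
  barycentric_domain i x -> barycentric_domain j x -> i = j.
Proof.
move=> /barycentric_domainP[c [cT ic xc xi]] /barycentric_domainP[c' [c'T jc' xc' xj]].
have cc' := open_disjoint cT c'T xc xc'; subst c'; apply/eqP; apply: contraT => ij.
by have := lt_trans (xi j jc' _) (xj i ic ij); rewrite eq_sym ij ltxx => /(_ isT).
Qed.

Lemma barycentric_domain_le (j : J) :
  (leb (barycentric_domain j) <= \sum_(c : {set J} | j \in c) leb (cell c))%E.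
Proof.
apply: measure_le_sum => [c _||x]; first exact: measurable_cell.
  exact: measurable_barycentric_domain.
by move=> /barycentric_domainP[c [cT jc xc _]]; exists c.
Qed.

Lemma barycentric_domain_lty (j : J) : (leb (barycentric_domain j) < +oo)%E.
Proof.
apply: (le_lt_trans (barycentric_domain_le j)).
by apply/lte_sum_pinfty => c _; exact: cell_lty.
Qed.

Definition mass (j : J) : R := fine (leb (barycentric_domain j)).

Lemma vol_fin c : (vol c)%:E = leb (cell c).
Proof. by rewrite /vol fineK// ge0_fin_numE//; exact: cell_lty. Qed.

Lemma mass_fin (j : J) : (mass j)%:E = leb (barycentric_domain j).
Proof. by rewrite /mass fineK// ge0_fin_numE//; exact: barycentric_domain_lty. Qed.

Lemma mass_le (j : J) : mass j <= \sum_(c : {set J} | j \in c) vol c.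
Proof.
rewrite -lee_fin mass_fin -sumEFin (le_trans (barycentric_domain_le j))//.
by apply: lee_sum => c _; rewrite vol_fin.
Qed.

(** Nonnegative coordinates sum to 1, so one that exceeds 1/2 is the strict maximum. *)
Lemma vertex_cap_sub (c : {set J}) (j : J) : c \in cells T -> j \in c ->
  vertex_cap p c j 2^-1 `<=` barycentric_domain j.
Proof.
move=> cT jc x [xc /=]; rewrite (_ : 1 - 2^-1 = 2^-1 :> R); last by field.
move=> xj; apply/barycentric_domainP; exists c; split => // a ac aj.
have x0 := (open_simplexP (card_cell cT) (cell_indep cT) x).1 xc.
have := sum_bary (card_cell cT) (cell_indep cT) x.
rewrite (bigD1 j)//= (bigD1 a)/= ?ac// => e.
have : 0 <= \sum_(i in c | (i != j) && (i != a)) bar c i x.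
  by apply: sumr_ge0 => b /andP[/x0/ltW].
move: e; rewrite (eq_bigl (fun i => [&& i \in c, i != j & i != a])); last first.
  by move=> i; rewrite andbA.
by move: (\sum_(i | _) _) => S; lra.
Qed.

(** The caps of ratio 1/2 at [j] are disjoint, lie in the barycentric domain and fill at least 2^-d
    of their cells. The nodal mass thus controls the whole patch around the node. *)
Lemma sum_vol_le_mass (j : J) :
  \sum_(c : {set J} | j \in c) vol c <= 2 ^+ d * mass j.
Proof.
rewrite -ler_pdivrMl ?exprn_gt0// -lee_fin mass_fin mulr_sumr -sumEFin.
pose E c := if c \in cells T then vertex_cap p c j 2^-1 else set0.
apply: (@le_trans _ _ (\sum_(c : {set J} | j \in c) leb (E c))%E).
  apply: lee_sum => c jc; rewrite /E; case: ifPn => cT; last first.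
    by rewrite /vol cell0// measure0 mulr0.
  rewrite EFinM vol_fin cellE// -exprVn.
  apply: lebesgue_vertex_cap => //; [exact: card_cell|exact: cell_indep|].
  by rewrite invr_gt0 ltr0n invf_lt1 ?ltr1n.
apply: sum_measure_le => [c jc||c1 c2 x jc1 jc2|c jc].
- rewrite /E; case: ifPn => // cT.
  by apply: measurable_vertex_cap; [exact: card_cell|exact: cell_indep].
- exact: measurable_barycentric_domain.
- rewrite /E; case: ifPn => // c1T [x1 _]; case: ifPn => // c2T [x2 _].
  exact: open_disjoint x1 x2.
- rewrite /E; case: ifPn => cT; last by move=> x.
  exact: (vertex_cap_sub cT jc).
Qed.

Lemma vol_gt0 c : c \in cells T -> 0 < vol c.
Proof.
move=> cT; rewrite -lte_fin vol_fin cellE//.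
by apply: lebesgue_open_simplex_gt0; [exact: card_cell|exact: cell_indep].
Qed.

Lemma mass_gt0 (j : J) : 0 < mass j.
Proof.
rewrite -(@pmulr_rgt0 _ (2 ^+ d)) ?exprn_gt0//.
apply: lt_le_trans (sum_vol_le_mass j).
have [c cT jc] := node_in_cell j.
rewrite (bigD1 c)//= ltr_wpDr ?vol_gt0// sumr_ge0// => c' _.
exact: vol_ge0.
Qed.

Lemma card_cell_sum c (k : R) : c \in cells T -> \sum_(j in c) k = d.+1%:R * k.
Proof. by move=> cT; rewrite sumr_const card_cell// mulr_natl. Qed.

(** Each mass is at most the volume of its patch, and in the exchanged sum a cell is counted once
    for each of its d + 1 vertices. *)
Lemma sum_mass_le (f : J -> R) (k : {set J} -> R) :
  (forall j, 0 <= f j) -> (forall c j, c \in cells T -> j \in c -> f j <= k c) ->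
  \sum_j mass j * f j <= d.+1%:R * \sum_c vol c * k c.
Proof.
move=> f0 fk; apply: (@le_trans _ _ (\sum_j \sum_(c : {set J} | j \in c) vol c * f j)).
  by apply: ler_sum => j _; rewrite -mulr_suml ler_wpM2r// mass_le.
rewrite (exchange_big_dep xpredT)//= mulr_sumr; apply: ler_sum => c _.
have [cT|cT] := boolP (c \in cells T); last first.
  rewrite /vol cell0// measure0 mul0r mulr0 big1// => j _; by rewrite mul0r.
rewrite mulrCA -(card_cell_sum (k c) cT) mulr_sumr; apply: ler_sum => j jc.
by rewrite ler_wpM2l ?vol_ge0// fk.
Qed.

Lemma sum_vol_le (V : set Rd) : measurable V -> Omega `<=` V ->
  ((\sum_c vol c)%:E <= leb V)%E.
Proof.
move=> mV OV; rewrite -sumEFin; under eq_bigr do rewrite vol_fin.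
apply: sum_measure_le => //.
- by move=> c _; exact: measurable_cell.
- by move=> c1 c2 x _ _; exact: cell_disjoint.
- by move=> c _; exact: subset_trans (@cell_sub c) OV.
Qed.

Local Notation conj := (@conjc R).

Definition cslope (z : J -> R[i]) c k : R[i] := \sum_j z j * (bary_grad p c j k)%:C%C.

Lemma gradient_cinterp z c x k : cell c x ->
  gradient T k (cinterp z) x = cslope z c k.
Proof.
move=> [cT xc]; rewrite /gradient mem_set; last by exists c.
apply: complexP; rewrite /cslope ?Re_sum ?Im_sum.
  rewrite [LHS](partial_interp _ _ cT xc); apply: eq_bigr => j _.
  by rewrite ReMreal.
rewrite [LHS](partial_interp _ _ cT xc); apply: eq_bigr => j _.
by rewrite ImMreal.
Qed.

Lemma gradient_out v x k : (forall c, ~ cell c x) -> gradient T k v x = 0.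
Proof.
move=> xc; rewrite /gradient memNset// => -[c cT xcc].
by apply: (xc c).
Qed.

Lemma sum_cell_indic (F : {set J} -> R[i]) c x : cell c x ->
  \sum_c' F c' * (\1_(cell c') x)%:C%C = F c.
Proof.
move=> xc; rewrite (bigD1 c)//= indicE mem_set// mulr1 big1 ?addr0// => c' c'c.
rewrite indicE memNset ?mulr0// => xc'; move/eqP: c'c; apply.
exact: cell_disjoint xc' xc.
Qed.

Lemma conjMreal (x : R[i]) (r : R) : conj (x * r%:C%C) = conj x * r%:C%C.
Proof. by case: x => a b; apply: complexP => /=; ring. Qed.

Lemma dirichlet_cinterp z w : dirichlet T (cinterp z) (cinterp w) =
  \sum_i \sum_j z i * conj (w j) * (stiff i j)%:C%C.
Proof.
transitivity (\sum_c (\sum_k cslope z c k * conj (cslope w c k)) * (vol c)%:C%C).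
  rewrite -(cintegral_simple measurable_cell cell_lty cell_sub).
  congr cintegral; apply/funext => x.
  have [[c xc]|nx] := pselect (exists c, cell c x).
    rewrite (sum_cell_indic (fun c => \sum_k cslope z c k * conj (cslope w c k)) xc).
    by apply: eq_bigr => k _; rewrite !(gradient_cinterp _ _ xc).
  have nxc c : ~ cell c x by move=> xc; apply: nx; exists c.
  rewrite big1 => [|k _]; last by rewrite gradient_out// mul0r.
  by rewrite big1// => c _; rewrite indicE memNset ?mulr0.
rewrite /stiff.
transitivity (\sum_c \sum_i \sum_j \sum_k z i * conj (w j) *
    (vol c * (bary_grad p c i k * bary_grad p c j k))%:C%C).
  apply: eq_bigr => c _; rewrite mulr_suml.
  under [RHS]eq_bigr do rewrite exchange_big/=.
  rewrite [RHS]exchange_big/=; apply: eq_bigr => k _.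
  rewrite /cslope rmorph_sum/= mulr_suml mulr_suml; apply: eq_bigr => i _.
  rewrite mulr_sumr mulr_suml; apply: eq_bigr => j _.
  rewrite conjMreal !(rmorphM (real_complex R)); ring.
rewrite exchange_big/=; apply: eq_bigr => i _.
rewrite exchange_big/=; apply: eq_bigr => j _.
rewrite rmorph_sum mulr_sumr; apply: eq_bigr => c _.
by rewrite mulr_sumr rmorph_sum mulr_sumr.
Qed.

(** The barycentric domains are disjoint, so at each point at most one node contributes and the mass
    matrix is diagonal. *)
Lemma lumped_cinterp z w : lumped_product T (cinterp z) (cinterp w) =
  \sum_(j | interior_node j) z j * conj (w j) * (mass j)%:C%C.
Proof.
pose E (j : J) : set Rd := barycentric_domain j.
transitivity (\sum_j (if interior_node j then z j * conj (w j) else 0) * (mass j)%:C%C).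
  rewrite -(cintegral_simple measurable_barycentric_domain barycentric_domain_lty
    barycentric_domain_sub).
  congr cintegral; apply/funext => x; rewrite /lump.
  have lumpE (y : J -> R[i]) : \sum_(j < nnodes T | p j \in Omega)
      cinterp y (p j) * (\1_(barycentric_domain j) x)%:C%C =
      \sum_j (if interior_node j then y j else 0) * (\1_(barycentric_domain j) x)%:C%C.
    rewrite big_mkcond; apply: eq_bigr => j _; rewrite cinterp_node /interior_node.
    by case: ifP => //; rewrite mul0r.
  have pickE (y : J -> R[i]) j : barycentric_domain j x ->
      \sum_i y i * (\1_(barycentric_domain i) x)%:C%C = y j.
    move=> xj; rewrite (bigD1 j)//= indicE mem_set// mulr1 big1 ?addr0// => i ij.
    rewrite indicE memNset ?mulr0// => xi; move/eqP: ij; apply.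
    exact: barycentric_domain_disjoint xi xj.
  rewrite !lumpE.
  have [[j xj]|nx] := pselect (exists j : J, barycentric_domain j x).
    by rewrite !(pickE _ j)//; case: ifP => //; rewrite mul0r.
  have none (y : J -> R[i]) : \sum_i y i * (\1_(barycentric_domain i) x)%:C%C = 0.
    by rewrite big1// => i _; rewrite indicE memNset ?mulr0// => xi; apply: nx; exists i.
  by rewrite !none mul0r.
rewrite [RHS]big_mkcond; apply: eq_bigr => j _; case: ifP => //; by rewrite mul0r.
Qed.

Lemma stiff_offdiag : acute T -> forall i j : J, i != j -> stiff i j <= 0.
Proof.
move=> ac i j /ac; rewrite !nodal_basisE dirichlet_cinterp.
rewrite (bigD1 i)//= [X in _ + X]big1 => [|i' ii']; last first.
  by rewrite big1// => j' _; rewrite (negbTE ii') !mul0r.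
rewrite (bigD1 j)//= [X in _ + X + _]big1 => [|j' jj']; last first.
  by rewrite (negbTE jj') conjc_nat mulr0 mul0r.
by rewrite !eqxx conjc_nat !addr0 !mul1r lecE => /andP[].
Qed.

End MeshForms.

(** * The discrete Faber-Krahn inequality *)

Section LineSegments.
Context {R : realType}.
Local Notation leb1 := (@lebesgue_measure R).
Local Notation I01 := (`[0%R, 1%R]%classic : set (measurableTypeR R)).

(** Covering the image by a measurable set is enough for measure estimates. For nonzero [b] the
    cover is the preimage of [F] under the inverse map, composed with a reflection when [b] is
    negative; for [b = 0] it is a point. *)
Lemma lebesgue_measure_image_affine (a b : R) (F : set (measurableTypeR R)) :
  measurable F -> exists A : set (measurableTypeR R),
  [/\ measurable A, forall t, F t -> A (a + b * t) & (leb1 A <= `|b|%:E * leb1 F)%E].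
Proof.
move=> mF; have [->|b0] := eqVneq b 0.
  exists [set a]; split => //; first by move=> t _ /=; rewrite mul0r addr0.
  by rewrite normr0 mul0e lebesgue_measure_set1.
have affE t : b^-1 * (a + b * t) - b^-1 * a = t.
  by rewrite mulrDr addrAC subrr add0r mulrA mulVf// mul1r.
have mdil s e : measurable (dilate1 s e @^-1` F).
  by rewrite -[X in measurable X]setTI; exact: measurable_dilate1.
have [bpos|bneg] := ltP 0 b.
  exists (dilate1 b^-1 (- (b^-1 * a)) @^-1` F); split => //.
    by move=> t Ft; rewrite /dilate1/= affE.
  by rewrite lebesgue_measure_dilate1 ?invr_gt0// invrK gtr0_norm.
have {bneg}bneg : b < 0 by rewrite lt_neqAle b0.
pose B := dilate1 (- b^-1) (- (b^-1 * a)) @^-1` F.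
exists ((-%R : R -> measurableTypeR R) @^-1` B); split.
- rewrite -[X in measurable X]setTI.
  by apply: (_ : measurable_fun setT (-%R : measurableTypeR R -> measurableTypeR R));
    [exact: oppr_measurable|exact: measurableT|exact: mdil].
- by move=> t Ft; rewrite /B/dilate1/= mulrNN affE.
rewrite -[leb1 _]/(pushforward leb1 (-%R : _ -> measurableTypeR R) B).
rewrite lebesgue_measureN; last exact: mdil.
by rewrite lebesgue_measure_dilate1 ?oppr_gt0 ?invr_lt0// -invrN invrK ltr0_norm.
Qed.

(* The range of psi over [0, 1] covers the segment between its end values, and
   is itself covered by 0 and the images of the sets F i. *)
Lemma piecewise_affine_increment (I : finType) (psi : R -> R)
    (F : I -> set (measurableTypeR R)) (a b : I -> R) :
  {within `[0, 1], continuous psi} -> (forall i, measurable (F i)) ->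
  (forall i t, F i t -> psi t = a i + b i * t) ->
  (forall t, 0 <= t <= 1 -> psi t != 0 -> exists i, F i t) ->
  (`|psi 1 - psi 0|%:E <= \sum_i `|b i|%:E * leb1 (F i))%E.
Proof.
move=> cpsi mF psiE Fcover.
have [A AP] := choice (fun i => lebesgue_measure_image_affine (a i) (b i) (mF i)).
pose E (o : option I) : set (measurableTypeR R) := if o is Some i then A i else [set 0].
pose lo := Num.min (psi 0) (psi 1); pose hi := Num.max (psi 0) (psi 1).
have lohi : lo <= hi by rewrite /lo /hi ge_min le_max lexx.
have hiloE : hi - lo = `|psi 1 - psi 0|.
  rewrite /hi /lo; case: (leP (psi 0) (psi 1)) => h01.
    by rewrite ger0_norm ?subr_ge0.
  by rewrite ltr0_norm ?subr_lt0// opprB.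
have : (leb1 (`[lo, hi]%classic : set (measurableTypeR R)) <= \sum_(o : option I) leb1 (E o))%E.
  apply: measure_le_sum => [[i|] _| |y].
  - by have [] := AP i.
  - exact: measurable_set1.
  - exact: measurable_itv.
  rewrite /= => /(IVT ler01 cpsi)[t]; rewrite in_itv/= => t01 <-.
  have [->|/(Fcover t t01)[i Fit]] := eqVneq (psi t) 0; first by exists None.
  by exists (Some i) => //=; rewrite (psiE i)//; have [_ + _] := AP i; apply.
have -> : leb1 (`[lo, hi]%classic : set (measurableTypeR R)) = `|psi 1 - psi 0|%:E.
  rewrite lebesgue_measure_itv/= lte_fin -hiloE; case: ltP => [_|hilo].
    by rewrite EFinB.
  by rewrite (_ : hi = lo) ?subrr//; apply/le_anti; rewrite lohi hilo.
move=> /le_trans; apply.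
rewrite (bigD1 None)//= lebesgue_measure_set1 add0e.
rewrite (reindex_omap Some id)/=; last by case.
rewrite (eq_bigl xpredT) => [|i]; last by rewrite eqxx.
by apply: lee_sum => i _; have [] := AP i.
Qed.

End LineSegments.

(** Expand the nonnegative double sum of (a i - a j)^2. *)
Lemma sqr_sum_le {R : realType} (n : nat) (a : 'I_n -> R) :
  (\sum_i a i) ^+ 2 <= n%:R * \sum_i a i ^+ 2.
Proof.
have : 0 <= \sum_i \sum_j (a i - a j) ^+ 2.
  by apply: sumr_ge0 => i _; apply: sumr_ge0 => j _; exact: sqr_ge0.
have -> : \sum_i \sum_j (a i - a j) ^+ 2 =
    2 * (n%:R * \sum_i a i ^+ 2) - 2 * (\sum_i a i) ^+ 2.
  transitivity (\sum_i (n%:R * a i ^+ 2 + \sum_j a j ^+ 2 - 2 * (\sum_j a j) * a i)).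
    apply: eq_bigr => i _.
    rewrite (eq_bigr (fun j => a i ^+ 2 + a j ^+ 2 - (2 * a i) * a j)); last first.
      by move=> j _; ring.
    by rewrite sumrB big_split/= sumr_const card_ord -mulr_sumr -mulr_natl; ring.
  rewrite sumrB big_split/= -!mulr_sumr sumr_const card_ord -mulr_natl.
  by ring.
by move: (\sum_i a i) (\sum_i a i ^+ 2) => s q; lra.
Qed.

Section MeshFaberKrahn.
Context {R : realType} {d : nat} {Omega : set 'rV[R]_d}.
Variable T : triangulation Omega.
Hypothesis Omega_open : open Omega.
Hypothesis d_gt0 : (0 < d)%N.
Local Notation Rd := 'rV[R]_d.
Local Notation leb := (lebesgue_rV d : {measure set 'rV[R]_d -> \bar R}).
Local Notation leb1 := (@lebesgue_measure R).
Local Notation I01 := (`[0%R, 1%R]%classic : set (measurableTypeR R)).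
Local Notation J := 'I_(nnodes T).
Local Notation p := (@node _ _ _ T).
Local Notation K c := (open_simplex p c).
Local Notation Kbar c := (closed_simplex p c).
Local Notation bar := (bary p).
Implicit Types (c : {set J}) (x : Rd).

(** Closed cells, because a segment can run inside a common face, which the open cells miss. *)
Definition ccell c : set Rd := [set x | c \in cells T /\ Kbar c x].

Lemma ccellE c : c \in cells T -> ccell c = Kbar c.
Proof. by move=> cT; apply/seteqP; split => x; rewrite /ccell/= ?cT// => -[]. Qed.

Lemma ccell0 c : c \notin cells T -> ccell c = set0.
Proof. by move=> /negP cT; apply/seteqP; split => x; rewrite /ccell/= => -[]. Qed.

Lemma measurable_ccell c : measurable (ccell c).
Proof.
have [cT|cT] := boolP (c \in cells T); last by rewrite ccell0.
by rewrite ccellE//; apply: measurable_closed_simplex; [exact: card_cell|exact: cell_indep].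
Qed.

Lemma lebesgue_ccell c : leb (ccell c) = (vol c)%:E.
Proof.
have [cT|cT] := boolP (c \in cells T); last first.
  by rewrite ccell0// /vol cell0// measure0.
have [cc ic] := (card_cell cT, cell_indep cT).
rewrite vol_fin ccellE// cellE//; apply/eqP; rewrite eq_le.
rewrite lebesgue_closed_simplex_le//=; apply: le_measure; rewrite ?inE.
- exact: measurable_open_simplex.
- exact: measurable_closed_simplex.
- exact: sub_open_closed_simplex.
Qed.

(** The intersection avoids the open cell [c1], since a vertex of [c1] outside [c2] has coordinate 0
    there; it is contained in the null boundary of [c1]. *)
Lemma lebesgue_ccellI c1 c2 : c1 != c2 -> leb (ccell c1 `&` ccell c2) = 0%E.
Proof.
move=> c12; have [c1T|c1T] := boolP (c1 \in cells T); last first.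
  by rewrite ccell0// set0I measure0.
have [c2T|c2T] := boolP (c2 \in cells T); last by rewrite (ccell0 c2T) setI0 measure0.
have [cc ic] := (card_cell c1T, cell_indep c1T).
apply/eqP; rewrite eq_le measure_ge0 andbT -(lebesgue_simplex_boundary cc ic).
apply: le_measure; rewrite ?inE.
- by apply: measurableI; exact: measurable_ccell.
- apply: measurableD; first exact: measurable_closed_simplex.
  exact: measurable_open_simplex.
move=> x [[_ x1] [_ x2]]; split => // x1'.
have [a ac1 ac2] : exists2 a, a \in c1 & a \notin c2.
  apply/fintype.subsetPn; apply: contra c12 => s12.
  by rewrite eqEcard s12 !card_cell/=.
move/(open_simplexP cc ic): x1' => /(_ a ac1).
by rewrite (bary_consistent a c1T c2T x1 x2) bary_out// ltxx.
Qed.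

(** The l^1 norm of the gradient, dual to the coordinatewise bound by [s] on displacements in the
    box. *)
Definition grad1 (u : J -> R) c : R := \sum_k `|slope u c k|.

(** On faces the values of the adjacent cells add up. This keeps it an upper bound for the slope
    there, and faces are null sets for the L^2 norm. *)
Definition gradfun u x : R := \sum_c grad1 u c * \1_(ccell c) x.

Lemma grad1_ge0 u c : 0 <= grad1 u c.
Proof. exact: sumr_ge0. Qed.

Lemma gradfun_ge0 u x : 0 <= gradfun u x.
Proof. by apply: sumr_ge0 => c _; rewrite mulr_ge0 ?grad1_ge0. Qed.

Lemma measurable_gradfun u : measurable_fun setT (gradfun u).
Proof.
apply: measurable_sum => c; apply: measurable_funM => //.
by apply: measurable_indic; exact: measurable_ccell.
Qed.

(** Along the segment the interpolant is affine in each closed cell with slope at most s *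
    [grad1 u c], and is 0 outside the closure of Omega; the total slope, weighted by the time spent
    in each cell, bounds the increment. *)
Lemma increment_interp u s x z : (forall j, ~ Omega (p j) -> u j = 0) -> 0 < s ->
  box d s z ->
  (`|interp u (x + z) - interp u x|%:E <=
   s%:E * \int[leb1]_t (\1_I01 t * gradfun u (x + t *: z))%:E)%E.
Proof.
move=> u0 s0 zs; pose psi (t : R) := interp u (x + t *: z).
have -> : interp u (x + z) - interp u x = psi 1 - psi 0.
  by rewrite /psi scale1r scale0r addr0.
pose F c : set (measurableTypeR R) := I01 `&` [set t | ccell c (x + t *: z)].
pose sl c := \sum_k slope u c k * z ord0 k.
have mline : measurable_fun setT (fun t : measurableTypeR R => x + t *: z).
  exact: measurableT_comp (measurable_segment z) (pair1_measurable x).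
have mF c : measurable (F c).
  apply: measurableI; first exact: measurable_itv.
  by rewrite -[X in measurable X]setTI; apply: mline => //; exact: measurable_ccell.
have sl_le c : `|sl c| <= s * grad1 u c.
  apply: (le_trans (ler_norm_sum _ _ _)); rewrite /grad1 mulr_sumr.
  apply: ler_sum => k _; rewrite normrM mulrC ler_wpM2r//.
  by have := zs k; rewrite /= in_itv/= => /andP[z0 zs']; rewrite ger0_norm.
have cpsi : continuous psi.
  have cline : continuous (fun t : R => x + t *: z : Rd).
    by move=> t; apply: (@cvgD R Rd); [exact: cvg_cst|exact: scalel_continuous].
  have cu := continuous_interp_interior Omega_open u0.
  by move=> t; exact: (cvg_comp (fun t : R => x + t *: z) (interp u) (cline t) (cu _)).
(* The intercept for the cell [c] is the value at [x] of the affine extension from [c]; the leading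
   difference is 0. *)
have := @piecewise_affine_increment _ _ psi F (fun c => interp u x - interp u x +
  (\sum_j u j * bary_coef p c j (lshift d ord0) + \sum_k slope u c k * x ord0 k)) sl.
move=> /(_ (continuous_subspaceT cpsi) mF) incr.
apply: le_trans (incr _ _) _.
- move=> c t [_ [cT xc]]; rewrite /psi (interp_affine _ cT xc) subrr add0r -addrA.
  congr +%R; rewrite /sl mulr_suml -big_split/=; apply: eq_bigr => k _.
  by rewrite !mxE; ring.
- move=> t t01 psi0; have : closure Omega (x + t *: z).
    by apply: contrapT => /(interp_out u)/eqP; exact/negP.
  by rewrite (closure_Omega T) => -[c cT xc]; exists c; split => //=; rewrite in_itv.
rewrite -ge0_integralZl_EFin ?(ltW s0)//; last 2 first.
- by move=> t _; rewrite lee_fin mulr_ge0 ?gradfun_ge0.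
- apply/measurable_EFinP/measurable_funM => //.
  by apply: measurableT_comp mline; exact: measurable_gradfun.
have -> : (\int[leb1]_t (s%:E * (\1_I01 t * gradfun u (x + t *: z))%:E) =
    \int[leb1]_t (\sum_c (s * grad1 u c) * \1_(F c) t)%:E)%E.
  apply: eq_integral => t _; rewrite -EFinM; congr EFin.
  rewrite mulrCA /gradfun mulr_sumr mulr_sumr; apply: eq_bigr => c _.
  by rewrite /F indicI/=; ring.
rewrite -(@sum_measureE _ _ _ leb1 _ xpredT F (fun c _ => mF c)); last first.
  by move=> c _; rewrite mulr_ge0 ?grad1_ge0 ?ltW.
by apply: lee_sum => c _; rewrite lee_wpmul2r// lee_fin.
Qed.

(** Expanding the square gives a sum over pairs of cells in which distinct cells meet in null sets.
    On the diagonal the squared l^1 norm of the slopes costs a factor d. *)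
Lemma integral_gradfun_sqr u :
  (\int[leb]_x (gradfun u x ^+ 2)%:E <= (d%:R * energy (stiff (T := T)) u u)%:E)%E.
Proof.
pose E (cc : {set J} * {set J}) := ccell cc.1 `&` ccell cc.2.
have mE cc : measurable (E cc) by apply: measurableI; exact: measurable_ccell.
have -> : (\int[leb]_x (gradfun u x ^+ 2)%:E =
    \int[leb]_x (\sum_cc (grad1 u cc.1 * grad1 u cc.2) * \1_(E cc) x)%:E)%E.
  apply: eq_integral => x _; congr EFin; rewrite expr2 /gradfun mulr_suml.
  under eq_bigr do rewrite mulr_sumr.
  rewrite pair_big/=; apply: eq_bigr => cc _.
  by rewrite /E indicI/=; ring.
rewrite -(@sum_measureE _ _ _ leb _ xpredT E (fun cc _ => mE cc)); last first.
  by move=> cc _; rewrite mulr_ge0 ?grad1_ge0.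
rewrite (eq_bigr (fun cc : {set J} * {set J} =>
  (if cc.1 == cc.2 then grad1 u cc.1 ^+ 2 * vol cc.1 else 0)%:E)); last first.
  move=> [c1 c2] _ /=; have [<-|c12] := eqVneq c1 c2.
    by rewrite /E/= setIid lebesgue_ccell -EFinM expr2.
  by rewrite /E/= lebesgue_ccellI// mule0.
rewrite sumEFin lee_fin -(pair_big xpredT xpredT (fun c1 c2 =>
  if c1 == c2 then grad1 u c1 ^+ 2 * vol c1 else 0))/=.
rewrite energy_stiff mulr_sumr; apply: ler_sum => c _.
rewrite -big_mkcond/= (eq_bigl (fun c' => c' == c)) => [|c']; last by rewrite eq_sym.
rewrite big_pred1_eq mulrCA [leLHS]mulrC ler_wpM2l ?vol_ge0//.
apply: (le_trans (sqr_sum_le _)).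
rewrite (eq_bigr (fun k => slope u c k ^+ 2))// => k _.
by rewrite real_normK ?num_real.
Qed.

Local Notation normc := (@Normc.normc R).

Lemma normc_ge0 (z : R[i]) : 0 <= normc z.
Proof. by case: z => a b; exact: sqrtr_ge0. Qed.

Lemma normc_real (r : R) : normc r%:C%C = `|r|.
Proof. by rewrite /Normc.normc/= expr0n/= addr0 sqrtr_sqr. Qed.

Lemma normcMreal (z : R[i]) (r : R) : 0 <= r -> normc (z * r%:C%C) = normc z * r.
Proof. by move=> r0; rewrite Normc.normcM normc_real ger0_norm. Qed.

Lemma normc_sum (I : Type) (r : seq I) (P : pred I) (F : I -> R[i]) :
  normc (\sum_(i <- r | P i) F i) <= \sum_(i <- r | P i) normc (F i).
Proof.
elim/big_ind2: _ => [|x1 x2 y1 y2 h1 h2|i _]; first by rewrite Normc.normc0.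
  by rewrite (le_trans (le_normcD _ _))// lerD.
exact: lexx.
Qed.

(** A hat function is affine on each of finitely many closed cells and 0 off their union, and its
    preimages split accordingly. *)
Lemma measurable_cinterp z : cmeasurable setT (cinterp (T := T) z).
Proof.
have mhat j : measurable_fun setT (hat (T := T) j).
  move=> _ Y mY; rewrite setTI.
  have -> : hat j @^-1` Y = (\bigcup_(c in [set: {set J}]) (ccell c `&` bar c j @^-1` Y))
      `|` (~` (\bigcup_(c in [set: {set J}]) ccell c) `&` (if 0 \in Y then setT else set0)).
    apply/seteqP; split => x /=.
      have [[c _ [cT xc]]|nx] := pselect ((\bigcup_(c in [set: {set J}]) ccell c) x).
        by rewrite (hatE j cT xc) => xY; left; exists c.
      rewrite hat_out => [Y0|]; first by right; rewrite mem_set.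
      by rewrite (closure_Omega T) => -[c cT xc]; apply: nx; exists c.
    move=> [[c _ [[cT xc] xY]]|[nx]]; first by rewrite (hatE j cT xc).
    case: ifPn => // /set_mem Y0 _; rewrite hat_out//.
    by rewrite (closure_Omega T) => -[c cT xc]; apply: nx; exists c.
  apply: measurableU.
    apply: fin_bigcup_measurable; first exact: finite_finset.
    move=> c _; apply: measurableI; first exact: measurable_ccell.
    by rewrite -[X in measurable X]setTI; exact: measurable_bary.
  apply: measurableI; last by case: ifP.
  apply: measurableC; apply: fin_bigcup_measurable; first exact: finite_finset.
  by move=> c _; exact: measurable_ccell.
by split; apply: measurable_sum => j; apply: measurable_funM.
Qed.

Lemma measurable_interp u : measurable_fun setT (interp (T := T) u).
Proof.
have [m _] := measurable_cinterp (fun j => (u j)%:C%C).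
by move: m; congr (measurable_fun _ _); apply/funext => x.
Qed.

Lemma measurable_normc (disp : measure_display) (X : measurableType disp) (f : X -> R[i]) :
  cmeasurable setT f -> measurable_fun setT (fun y => normc (f y)).
Proof.
move=> [mre mim].
have -> : (fun y => normc (f y)) = (fun y => Num.sqrt (re_fun f y ^+ 2 + im_fun f y ^+ 2)).
  by apply/funext => y; rewrite /re_fun /im_fun; case: (f y).
apply: measurableT_comp; first exact: (continuous_measurable_fun (@sqrt_continuous R)).
by apply: measurable_funD; exact: measurable_funX.
Qed.

Lemma measurable_normc_powR (f : Rd -> R[i]) r : cmeasurable setT f ->
  measurable_fun setT (fun x => normc (f x) `^ r).
Proof. by move=> mf; apply: measurableT_comp (measurable_powR _) (measurable_normc mf). Qed.

(** d + 1 counts the vertices sharing a cell, 4^d comes from caps of ratio 1/4, and 2^r from the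
    interpolant being only half as large as the maximal nodal value. *)
Definition lump_cst (r : R) : R := d.+1%:R * (4 ^+ d * 2 `^ r).

(* In a cell where normc z is largest at the vertex j, the interpolant is at least
   half as large on the cap where the coordinate of j exceeds 3/4. *)
Lemma lumped_norm_le (z : J -> R[i]) (r : R) : 0 < r ->
  ((\sum_j mass j * normc (z j) `^ r)%:E <=
   (lump_cst r)%:E * \int[leb]_x (normc (cinterp z x) `^ r)%:E)%E.
Proof.
move=> r0.
pose top c := [pick j | [&& c \in cells T, j \in c & [forall a in c, normc (z a) <= normc (z j)]]].
have topP c : c \in cells T -> exists j, [/\ top c = Some j, j \in c &
    forall a, a \in c -> normc (z a) <= normc (z j)].
  move=> cT; rewrite /top; case: pickP => [j /and3P[_ jc /forall_inP ja]|]; first by exists j.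
  have [a0 a0c] : exists a, a \in c.
    by apply/set0Pn; rewrite -card_gt0 (card_cell cT).
  have [j jc ja] := @arg_maxP _ _ _ a0 [in c] (fun a => normc (z a)) a0c.
  by move=> /(_ j); rewrite cT jc/= => /negP[]; apply/forall_inP.
pose M c := if top c is Some j then normc (z j) else 0.
have M0 c : 0 <= M c by rewrite /M; case: (top c) => // j; exact: normc_ge0.
pose E c := if top c is Some j then vertex_cap p c j 4^-1 else set0.
have topT c j : top c = Some j -> c \in cells T.
  by rewrite /top; case: pickP => // j' /and3P[].
have step1 : \sum_j mass j * normc (z j) `^ r <= d.+1%:R * \sum_c vol c * M c `^ r.
  apply: sum_mass_le => [j|c j cT jc]; first exact: powR_ge0.
  have [t [ct _ tmax]] := topP c cT.
  by rewrite /M ct ge0_ler_powR ?(ltW r0) ?nnegrE ?normc_ge0// tmax.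
rewrite -lee_fin in step1; apply: (le_trans step1); rewrite /lump_cst !EFinM -muleA.
rewrite lee_pmul2l// ?lte_fin//.
have mf := measurable_normc_powR r (measurable_cinterp z).
have step2 : (\sum_c ((M c / 2) `^ r)%:E * leb (E c) <=
    \int[leb]_x (normc (cinterp z x) `^ r)%:E)%E.
  apply: (@sum_le_integral _ _ _ leb _ xpredT E) => //.
  - move=> c _; rewrite /E; case ct : (top c) => [j|]//.
    have cT := topT _ _ ct.
    by apply: measurable_vertex_cap; [exact: card_cell|exact: cell_indep].
  - by move=> x; exact: powR_ge0.
  - by move=> c _; exact: powR_ge0.
  - move=> c1 c2 x _ _; rewrite /E.
    case ct1 : (top c1) => [j1|]// [x1 _]; case ct2 : (top c2) => [j2|]// [x2 _].
    exact: open_disjoint (topT _ _ ct1) (topT _ _ ct2) x1 x2.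
  move=> c x _; rewrite /E /M; case ct : (top c) => [j|]// [xK /= xj].
  have cT := topT _ _ ct; have [t [ct' tc tmax]] := topP c cT.
  move: ct'; rewrite ct => -[jt]; subst t.
  rewrite ge0_ler_powR ?(ltW r0) ?nnegrE ?normc_ge0 ?divr_ge0 ?normc_ge0//.
  have b0 := (open_simplexP (card_cell cT) (cell_indep cT) x).1 xK.
  have xKbar := sub_open_closed_simplex (card_cell cT) (cell_indep cT) xK.
  have cE : cinterp z x = \sum_(a in c) z a * (bar c a x)%:C%C.
    rewrite cinterpE [RHS]big_mkcond; apply: eq_bigr => a _.
    by rewrite (hatE a cT xKbar); case: ifPn => // ac; rewrite bary_out// mulr0.
  have bsum := sum_bary (card_cell cT) (cell_indep cT) x.
  rewrite (bigD1 j)//= in bsum.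
  have zj : z j * (bar c j x)%:C%C =
      cinterp z x + - \sum_(a in c | a != j) z a * (bar c a x)%:C%C.
    by rewrite cE (bigD1 j)//= addrK.
  have : normc (z j) * bar c j x <= normc (cinterp z x) +
      normc (z j) * \sum_(a in c | a != j) bar c a x.
    rewrite -normcMreal ?(ltW (b0 _ tc))// zj (le_trans (le_normcD _ _))// lerD2l.
    rewrite normcN (le_trans (normc_sum _ _ _))// mulr_sumr; apply: ler_sum => a /andP[ac _].
    by rewrite normcMreal ?(ltW (b0 _ ac))// ler_wpM2r ?(ltW (b0 _ ac))// tmax.
  have -> : \sum_(a in c | a != j) bar c a x = 1 - bar c j x.
    by rewrite -bsum addrAC subrr add0r.
  rewrite -lerBlDr -mulrBr => /(le_trans _); apply.
  rewrite ler_wpM2l ?normc_ge0//.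
  by move: xj; rewrite (_ : 1 - 4^-1 = 3 / 4 :> R); [lra|field].
have C0 : 0 < 4 ^+ d * 2 `^ r :> R by rewrite mulr_gt0 ?exprn_gt0 ?powR_gt0.
rewrite -lee_pdivrMl//; apply: le_trans step2; rewrite -EFinM mulr_sumr -sumEFin.
apply: lee_sum => c _; rewrite /E /M; case ct : (top c) => [j|]; last first.
  have cT : c \notin cells T.
    by apply/negP => /topP[t [ct' _ _]]; rewrite ct' in ct.
  by rewrite /vol cell0// measure0 mul0r mulr0 mule0.
have cT := topT _ _ ct; have [t [ct' tc _]] := topP c cT.
move: ct'; rewrite ct => -[jt]; subst t.
have cap := lebesgue_vertex_cap (card_cell cT) (cell_indep cT) (s := 4^-1) tc.
rewrite powRM ?normc_ge0 ?invr_ge0//.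
apply: le_trans (lee_wpmul2l _ (cap _)); last 2 first.
- by rewrite lee_fin mulr_ge0 ?powR_ge0.
- by rewrite invr_gt0 ltr0n invf_lt1 ?ltr1n.
rewrite -cellE// -vol_fin -!EFinM lee_fin le_eqVlt; apply/orP; left; apply/eqP.
rewrite -(powR_inv1 (ler0n R 2)) -powRrM mulN1r powRN invfM exprVn.
by ring.
Qed.

Lemma sum_vol_touching_le (P : pred J) :
  \sum_(c : {set J} | [exists j in c, P j]) vol c <= 2 ^+ d * \sum_(j | P j) mass j.
Proof.
rewrite mulr_sumr; apply: (@le_trans _ _ (\sum_(j | P j) \sum_(c : {set J} | j \in c) vol c)).
  rewrite (exchange_big_dep xpredT)//= big_mkcond; apply: ler_sum => c _.
  case: ifPn => [/exists_inP[j jc Pj]|_]; last by apply: sumr_ge0 => j _; exact: vol_ge0.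
  rewrite (bigD1 j)/= ?Pj// lerDl; apply: sumr_ge0 => i _; exact: vol_ge0.
by apply: ler_sum => j _; exact: sum_vol_le_mass.
Qed.

(** [lump_cst 2] passes from lumped sums to integrals, 2 * (2^(d+1))^(2/d) is the part free of A in
    the factor 2 s^2 of the averaging with s^d = 2^(d+1) A, and d compares the l^1 and l^2 norms of
    the gradient. *)
Definition faber_krahn_cst : R :=
  lump_cst 2 * 2 * (2 ^+ d.+1) `^ (2 / d%:R) * d%:R.

Lemma lump_cst_gt0 r : 0 < lump_cst r.
Proof. by rewrite !mulr_gt0 ?exprn_gt0 ?powR_gt0 ?ltr0n. Qed.

Lemma faber_krahn_cst_gt0 : 0 < faber_krahn_cst.
Proof.
by rewrite /faber_krahn_cst !mulr_gt0 ?lump_cst_gt0 ?powR_gt0 ?exprn_gt0 ?ltr0n.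
Qed.

Lemma mesh_faber_krahn (u : J -> R) : (forall j, ~~ interior_node j -> u j = 0) ->
  \sum_(j | interior_node j) mass j * u j ^+ 2 <= faber_krahn_cst *
    (\sum_(j | interior_node j && (u j != 0)) mass j) `^ (2 / d%:R) *
    energy (stiff (T := T)) u u.
Proof.
move=> u0.
have u0' j : ~ Omega (p j) -> u j = 0.
  by move=> jO; apply: u0; rewrite /interior_node; apply/negP => /set_mem.
have uI j : u j != 0 -> interior_node j.
  by apply: contraTT => /u0 ->; rewrite eqxx.
rewrite [X in X `^ _](eq_bigl (fun j => u j != 0)); last first.
  by move=> j; apply/andP/idP => [[]//|uj]; rewrite uI.
set A := \sum_(j | u j != 0) mass j.
have E0 : 0 <= energy (stiff (T := T)) u u.
  rewrite energy_stiff; apply: sumr_ge0 => c _.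
  by rewrite mulr_ge0 ?vol_ge0// sumr_ge0// => k _; exact: sqr_ge0.
have A0 : 0 <= A by apply: sumr_ge0 => j _; rewrite ltW// mass_gt0.
have [A_eq0|A_neq0] := eqVneq A 0.
  rewrite big1 ?mulr_ge0 ?powR_ge0 ?(ltW faber_krahn_cst_gt0)// => j _.
  have [->|uj] := eqVneq (u j) 0; first by rewrite expr0n mulr0.
  move/eqP: A_eq0; rewrite psumr_eq0; last by move=> i _; rewrite ltW// mass_gt0.
  by move=> /allP/(_ j (mem_index_enum j)); rewrite uj/= gt_eqF// mass_gt0.
have {A0 A_neq0}A0 : 0 < A by rewrite lt0r A_neq0.
(* The cells touching the support have total volume at most 2^d A, so a cube of volume 2^(d+1) A is
   at least twice as large; s^2 then produces the power 2/d of A. *)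
pose B := 2 ^+ d.+1 * A; have B0 : 0 < B by rewrite mulr_gt0 ?exprn_gt0.
pose s := B `^ d%:R^-1; have s0 : 0 < s by rewrite powR_gt0.
have dn0 : d%:R != 0 :> R by rewrite pnatr_eq0 -lt0n.
have sd : s ^+ d = B by rewrite -powR_mulrn ?ltW// -powRrM mulVf// powRr1// ltW.
have s2 : s ^+ 2 = (2 ^+ d.+1) `^ (2 / d%:R) * A `^ (2 / d%:R).
  by rewrite -powRM ?exprn_ge0 ?(ltW A0)// -powR_mulrn ?ltW// -powRrM mulrC.
pose touch (c : {set J}) := [exists j in c, u j != 0].
pose V := \bigcup_(c in [set` [set c | touch c]%SET]) ccell c.
have mV : measurable V.
  apply: fin_bigcup_measurable; first exact: finite_finset.
  by move=> c _; exact: measurable_ccell.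
have uV x : ~ V x -> interp u x = 0.
  move=> nV; have [|] := pselect (closure Omega x); last exact: interp_out.
  rewrite (closure_Omega T) => -[c cT xc]; rewrite (interp_cell _ cT xc) big1// => j _.
  have [jc|jc] := boolP (j \in c); last by rewrite bary_out// mulr0.
  have [->|uj] := eqVneq (u j) 0; first by rewrite mul0r.
  exfalso; apply: nV; exists c => //=; rewrite inE; apply/exists_inP; by exists j.
have Vs : (leb V <= (s ^+ d / 2)%:E)%E.
  apply: (@le_trans _ _ (\sum_(c | touch c) leb (ccell c))%E).
    apply: measure_le_sum => // [c _|x [c]]; first exact: measurable_ccell.
    by rewrite /= inE => tc xc; exists c.
  under eq_bigr do rewrite lebesgue_ccell.
  rewrite sumEFin lee_fin sd (le_trans (sum_vol_touching_le _))//.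
  by rewrite /B exprS -/A le_eqVlt; apply/orP; left; apply/eqP; field.
have fk := faber_krahn_L2 (measurable_interp u) (measurable_gradfun u)
  (gradfun_ge0 u) mV uV s0 Vs (fun x z => @increment_interp u s x z u0' s0).
have {}fk : (\int[leb]_x (interp u x ^+ 2)%:E <=
    (2 * s ^+ 2 * (d%:R * energy (stiff (T := T)) u u))%:E)%E.
  rewrite EFinM; apply: (le_trans fk); apply: lee_wpmul2l.
    by rewrite lee_fin mulr_ge0// sqr_ge0.
  exact: integral_gradfun_sqr.
have := @lumped_norm_le (fun j => (u j)%:C%C) 2 (ltr0n _ 2).
have -> : (\int[leb]_x (normc (cinterp (fun j => (u j)%:C%C) x) `^ 2)%:E =
    \int[leb]_x (interp u x ^+ 2)%:E)%E.
  apply: eq_integral => x _; congr EFin.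
  have -> : cinterp (fun j => (u j)%:C%C) x = (interp u x)%:C%C.
    by apply: complexP => //=; rewrite /interp big1// => j _; rewrite mul0r.
  by rewrite normc_real powR_mulrn// real_normK// num_real.
under [X in (X%:E <= _)%E -> _]eq_bigr do
  rewrite normc_real powR_mulrn// real_normK ?num_real//.
move=> lump.
have {lump fk} : ((\sum_j mass j * u j ^+ 2)%:E <= (lump_cst 2 *
    (2 * s ^+ 2 * (d%:R * energy (stiff (T := T)) u u)))%:E)%E.
  rewrite EFinM; apply: (le_trans lump); apply: lee_wpmul2l => //.
  by rewrite lee_fin ltW// lump_cst_gt0.
rewrite lee_fin => le1.
apply: (@le_trans _ _ (\sum_j mass j * u j ^+ 2)).
  rewrite [leRHS](bigID (@interior_node _ _ _ T))/= lerDl.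
  by apply: sumr_ge0 => j _; rewrite mulr_ge0 ?sqr_ge0// ltW// mass_gt0.
apply: (le_trans le1); rewrite s2 /faber_krahn_cst le_eqVlt; apply/orP; left; apply/eqP.
by ring.
Qed.

Lemma sum_mass_bound (V : set Rd) (M : R) : measurable V -> Omega `<=` V ->
  (leb V <= M%:E)%E -> \sum_(j | interior_node (T := T) j) mass j <= d.+1%:R * M.
Proof.
move=> mV OV VM; apply: (@le_trans _ _ (\sum_j mass (T := T) j * 1)).
  under [leRHS]eq_bigr do rewrite mulr1.
  rewrite [leRHS](bigID (@interior_node _ _ _ T))/= lerDl.
  by apply: sumr_ge0 => j _; rewrite ltW// mass_gt0.
apply: (le_trans (@sum_mass_le _ _ _ T (fun=> 1) (fun=> 1) _ _)) => //.
under eq_bigr do rewrite mulr1.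
rewrite ler_wpM2l// -lee_fin; apply: le_trans VM; exact: sum_vol_le.
Qed.

End MeshFaberKrahn.

(** * Fractional powers *)

Section DecayIntegral.
Context {R : realType}.
Local Notation mu := (@lebesgue_measure R).

Lemma integral_powRN (a b s : R) : 0 < a -> a < b -> s != 1 ->
  (\int[mu]_(t in `[a, b]) (t `^ (- s))%:E =
   ((b `^ (1 - s) - a `^ (1 - s)) / (1 - s))%:E)%E.
Proof.
move=> a0 ab s1; have s10 : 1 - s != 0 by rewrite subr_eq0 eq_sym.
pose F (x : R) := (1 - s)^-1 * x `^ (1 - s).
have dF (x : R) : 0 < x -> is_derive x 1 F (x `^ (- s)).
  move=> x0; have := @is_deriveZ _ _ _ _ (1 - s)^-1 _ _ _ (is_derive1_powR (1 - s) x0).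
  by rewrite /GRing.scale/= mulKf// (_ : 1 - s - 1 = - s)//; ring.
have cvg_pow (x : R) : 0 < x -> {for x, continuous (fun t : R => t `^ (- s))}.
  move=> x0; apply: differentiable_continuous; apply/derivable1_diffP.
  exact: (@ex_derive _ _ _ _ _ _ _ (is_derive1_powR (- s) x0)).
have cF (x : R) : 0 < x -> {for x, continuous F}.
  move=> x0; apply: differentiable_continuous; apply/derivable1_diffP.
  exact: (@ex_derive _ _ _ _ _ _ _ (dF x x0)).
rewrite (@continuous_FTC2 _ _ F)//.
- by rewrite /F -EFinB -mulrBr mulrC.
- apply: continuous_in_subspaceT => x; rewrite inE/= in_itv/= => /andP[ax _].
  by apply: cvg_pow; exact: lt_le_trans ax.
- split=> [x||].
  + rewrite in_itv/= => /andP[ax _].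
    exact: (@ex_derive _ _ _ _ _ _ _ (dF x (lt_trans a0 ax))).
  + by apply: cvg_at_right_filter; exact: cF.
  + by apply: cvg_at_left_filter; apply: cF; exact: lt_trans ab.
- move=> x; rewrite in_itv/= => /andP[ax _]; rewrite derive1E.
  exact: (@derive_val _ _ _ _ _ _ _ (dF x (lt_trans a0 ax))).
Qed.

Definition decay (s e t : R) : R := t `^ (- s) * (if t <= 1 then 1 else t `^ (- e)).

Lemma decay_ge0 s e t : 0 <= decay s e t.
Proof. by rewrite /decay mulr_ge0 ?powR_ge0//; case: ifP => _ //; exact: powR_ge0. Qed.

Lemma measurable_decay s e : measurable_fun setT (decay s e).
Proof.
apply: measurable_funM; first exact: measurable_powR.
have m1 : measurable_fun setT (fun t : R => t <= 1) by exact: measurable_fun_ler.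
by apply: (measurable_fun_ifT m1) => //; exact: measurable_powR.
Qed.

(** s < 1 gives convergence at 0 and s + e > 1 at infinity; the two terms are the exact integrals of
    the powers over ]0, 1] and [1, +oo[. *)
Lemma integral_decay_le (s e : R) : s < 1 -> 1 < s + e ->
  (\int[mu]_(t in `]0%R, +oo[) (decay s e t)%:E <=
   ((1 - s)^-1 + (s + e - 1)^-1)%:E)%E.
Proof.
move=> s1 se1.
(* The shift by 2 puts 1 strictly inside every interval, so that both pieces of the splitting at 1
   are nondegenerate. *)
pose F n : set R := `[(n.+2%:R)^-1, n.+2%:R]%classic.
have F01 n : 0 < (n.+2%:R)^-1 :> R by rewrite invr_gt0 ltr0n.
have -> : `]0, +oo[%classic = \bigcup_n F n.
  apply/seteqP; split=> x; rewrite /= in_itv/= andbT; [move=> x0|move=> [n _]].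
    have y0 : 0 < Num.max x x^-1 by rewrite lt_max x0.
    pose n := Num.bound (Num.max x x^-1).
    have := archi_boundP (ltW y0); rewrite -/n gt_max => /andP[xn xn'].
    have nn : n%:R <= n.+2%:R :> R by rewrite ler_nat -addn2 leq_addr.
    exists n => //; rewrite /F/= in_itv/= (le_trans (ltW xn))// andbT.
    by rewrite -[leRHS]invrK lef_pV2 ?posrE ?ltr0n ?invr_gt0// (le_trans (ltW xn')).
  by rewrite /F/= in_itv/= => /andP[+ _]; apply: lt_le_trans.
have mdec D : measurable_fun D (fun t => (decay s e t)%:E).
  apply/measurable_EFinP; apply: measurable_funTS; exact: measurable_decay.
have decay_ge0E t : (0 <= (decay s e t)%:E)%E by rewrite lee_fin decay_ge0.
have ndF : nondecreasing_seq F.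
  apply/nondecreasing_seqP => n; rewrite subsetEset => x; rewrite /F/= !in_itv/= => /andP[].
  move=> /(le_trans _)-> ; last by rewrite lef_pV2 ?posrE ?ltr0n// ler_nat.
  by move=> /le_trans; apply; rewrite ler_nat.
have mF n : measurable (F n) by exact: measurable_itv.
have cvgF := @ge0_nondecreasing_set_cvg_integral _ _ _ _ _ mu ndF mF
  (fun n => mdec (F n)) (fun n x _ => decay_ge0E x).
rewrite -(cvg_lim _ cvgF)//; apply: lime_le; first by apply/cvg_ex; eexists; exact: cvgF.
apply: nearW => n.
have n1 : (n.+2%:R)^-1 < 1 :> R by rewrite invf_lt1 ?ltr0n// ltr1n.
have n2 : 1 < n.+2%:R :> R by rewrite ltr1n.
have -> : F n = `[(n.+2%:R)^-1, 1]%classic `|` `]1, n.+2%:R]%classic.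
  by rewrite /F -itv_bndbnd_setU// bnd_simp ltW.
rewrite ge0_integral_setU//=; last 2 first.
+ exact: mdec.
+ rewrite disj_set2E; apply/eqP/seteqP; split => // x []/=.
  by rewrite !in_itv/= => /andP[_ x1] /andP[]; rewrite ltNge x1.
rewrite EFinD; apply: leeD.
  have -> : (\int[mu]_(t in `[(n.+2%:R^-1)%R, 1%R]) (decay s e t)%:E =
      \int[mu]_(t in `[(n.+2%:R^-1)%R, 1%R]) (t `^ (- s))%:E)%E.
    apply: eq_integral.
    by move=> x; rewrite inE/= in_itv/= => /andP[_ x1]; rewrite /decay x1 mulr1.
  rewrite integral_powRN ?lt_eqF// powR1 lee_fin ler_pdivrMr ?subr_gt0//.
  by rewrite mulVf ?gt_eqF ?subr_gt0// gerBl powR_ge0.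
apply: (@le_trans _ _ (\int[mu]_(t in `[1%R, n.+2%:R]) (t `^ (- (s + e)))%:E)%E).
  have -> : (\int[mu]_(t in `]1%R, n.+2%:R]) (decay s e t)%:E =
      \int[mu]_(t in `]1%R, n.+2%:R]) (t `^ (- (s + e)))%:E)%E.
    apply: eq_integral.
    move=> x; rewrite inE/= in_itv/= => /andP[x1 _]; rewrite /decay leNgt x1/=.
    by rewrite -powRD ?opprD// (gt_eqF (lt_trans _ x1))// implybT.
  apply: ge0_subset_integral => //.
  + by apply/measurable_EFinP; apply: measurable_funTS; exact: measurable_powR.
  + by move=> x _; rewrite lee_fin powR_ge0.
  + by apply: subset_itvr; rewrite bnd_simp.
rewrite integral_powRN ?gt_eqF// powR1 lee_fin -(opprB (s + e)).
rewrite invrN mulrN -mulNr opprB ler_pdivrMr ?subr_gt0//.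
by rewrite mulVf ?gt_eqF ?subr_gt0// gerBl powR_ge0.
Qed.

End DecayIntegral.

(** * Integrals of linear combinations and measurability of inverse matrices *)

Section LinearCombination.
Context {disp : measure_display} {X : measurableType disp} {R : realType}.
Variables (mu : {measure set X -> \bar R}) (D : set X).
Hypothesis mD : measurable D.

Lemma integrable_lincomb (I : Type) (s : seq I) (P : pred I) (c : I -> R)
    (f : I -> X -> R) :
  (forall i, P i -> mu.-integrable D (EFin \o f i)) ->
  mu.-integrable D (EFin \o (fun x => \sum_(i <- s | P i) c i * f i x)).
Proof.
move=> intf.
rewrite (_ : _ \o _ = fun x => (\sum_(i <- s | P i) (c i)%:E * (f i x)%:E)%E).
  by apply: integrable_sum => // i Pi; apply: integrableZl => //; exact: intf.
by apply/funext => x /=; rewrite -sumEFin.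
Qed.

Lemma Rintegral_lincomb (I : Type) (s : seq I) (P : pred I) (c : I -> R)
    (f : I -> X -> R) :
  (forall i, P i -> mu.-integrable D (EFin \o f i)) ->
  Rintegral mu D (fun x => \sum_(i <- s | P i) c i * f i x) =
  \sum_(i <- s | P i) c i * Rintegral mu D (f i).
Proof.
move=> intf; elim: s => [|i s ih].
  rewrite big_nil (_ : (fun _ => _) = fun=> 0) ?Rintegral_cst ?mul0r//.
  by apply/funext => x; rewrite big_nil.
rewrite big_cons -ih; case: ifPn => Pi; last first.
  by congr Rintegral; apply/funext => x; rewrite big_cons (negbTE Pi).
have intci : mu.-integrable D (EFin \o (fun x => c i * f i x)).
  rewrite (_ : _ \o _ = fun x => ((c i)%:E * (f i x)%:E)%E); last exact/funext.
  by apply: integrableZl => //; exact: intf.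
rewrite -RintegralZl//; last exact: intf.
rewrite -RintegralD//; last exact: integrable_lincomb.
by congr Rintegral; apply/funext => x; rewrite big_cons Pi.
Qed.

Lemma Rintegral_gt0 (f : X -> R) : (0 < mu D)%E -> mu.-integrable D (EFin \o f) ->
  (forall x, D x -> 0 < f x) -> 0 < Rintegral mu D f.
Proof.
move=> D0 intf f0; rewrite lt0r Rintegral_ge0 ?andbT; last by move=> x /f0/ltW.
apply/negP => /eqP int0.
have mf := measurable_int _ intf.
have /(ae_eq_integral_abs mu mD mf)[N [mN N0 subN]] : (\int[mu]_(x in D) `|(EFin \o f) x| = 0)%E.
  rewrite (eq_integral (EFin \o f)); last first.
    by move=> x; rewrite inE => /f0 fx; rewrite /= gtr0_norm.
  by rewrite -[LHS]fineK; [rewrite [X in X%:E]int0|exact: integrable_fin_num].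
have : (mu D <= mu N)%E.
  apply: le_measure; rewrite ?inE// => x Dx; apply: subN => /= /(_ Dx) [fx0].
  by have := f0 x Dx; rewrite fx0 ltxx.
by rewrite N0 leNgt D0.
Qed.

Lemma measurable_det n (A : X -> 'M[R]_n) :
  (forall i j, measurable_fun D (fun x => A x i j)) ->
  measurable_fun D (fun x => \det (A x)).
Proof.
move=> mA; apply: measurable_sum => s; apply: measurable_funM => //.
by apply: measurable_prod => i _; exact: mA.
Qed.

Lemma measurable_inv_fun (f : X -> R) : measurable_fun D f ->
  measurable_fun D (fun x => (f x)^-1).
Proof.
move=> mf; rewrite (_ : (fun x => _) = fun x => f x * (f x ^+ 2) `^ (-1)).
  apply: measurable_funM => //; apply: (measurableT_comp (measurable_powR (-1))).
  exact: measurable_funX.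
apply/funext => x; rewrite powR_inv1 ?sqr_ge0//.
have [->|fx0] := eqVneq (f x) 0; first by rewrite invr0 mul0r.
by rewrite expr2 invfM mulrA mulfV// mul1r.
Qed.

(** Cramer's rule: the entries are cofactors divided by the determinant. *)
Lemma measurable_invmx n (A : X -> 'M[R]_n) i j :
  (forall i j, measurable_fun D (fun x => A x i j)) ->
  (forall x, D x -> A x \in unitmx) ->
  measurable_fun D (fun x => invmx (A x) i j).
Proof.
move=> mA uA.
apply: (eq_measurable_fun (fun x => (\det (A x))^-1 * \adj (A x) i j)).
  by move=> x; rewrite inE => Dx; rewrite /invmx uA// [in RHS]mxE.
apply: measurable_funM; first by apply: measurable_inv_fun; exact: measurable_det.
rewrite (_ : (fun x => _) = fun x => (-1) ^+ (j + i) * \det (row' j (col' i (A x)))).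
  apply: measurable_funM => //; apply: measurable_det => a b.
  rewrite (_ : (fun x => _) = fun x => A x (lift j a) (lift i b))//.
  by apply/funext => x; rewrite !mxE.
by apply/funext => x; rewrite mxE.
Qed.

End LinearCombination.

(** * The kernel of the negative fractional power *)

Section FractionalGreen.
Context {R : realType} {n : nat}.
Variables (P : pred 'I_n) (m : 'I_n -> R) (S : 'I_n -> 'I_n -> R).
Hypothesis m_gt0 : forall i, P i -> 0 < m i.
Hypothesis S_sym : forall i j, S i j = S j i.
Hypothesis S_offdiag : forall i j, i != j -> S i j <= 0.
Hypothesis S_row : forall i, \sum_j S i j = 0.
Variables (C th M : R).
Hypothesis C_gt0 : 0 < C.
Hypothesis th_gt0 : 0 < th.
Hypothesis th_lt1 : th < 1.
Hypothesis mass_le : \sum_(i | P i) m i <= M.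
Hypothesis faber_krahn : forall u : 'I_n -> R, (forall i, ~~ P i -> u i = 0) ->
  \sum_(i | P i) m i * u i ^+ 2 <=
  C * (\sum_(i | P i && (u i != 0)) m i) `^ th * energy S u u.
Variable p : R.
Hypothesis p_gt1 : 1 < p.
Hypothesis p_lt : p < (1 - th)^-1.
Variable al : R.
Let r := (1 - th)^-1.
Let e := (r - p) / (r - 1) / p.
Hypothesis al_lt1 : al < 1.
Hypothesis al_gt : 1 < al + e.
Local Notation mu := (@lebesgue_measure R).
Local Notation D := (`]0, +oo[%classic : set R).
Local Notation green := (green P m S).
Let p_gt0 : 0 < p. Proof. exact: lt_trans p_gt1. Qed.

Definition frac_green i k : R := Rintegral mu D (fun t => t `^ (- al) * green t i k).

Definition frac_green_cst : R :=
  (M + 1 + green_cst C th p) `^ p^-1 * ((1 - al)^-1 + (al + e - 1)^-1).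

Lemma decayE t : t `^ (- al) * green_decay C th M p t =
  (M + 1 + green_cst C th p) `^ p^-1 * decay al e t.
Proof. by rewrite /green_decay /decay mulrCA. Qed.

Lemma integrable_decay : mu.-integrable D (EFin \o decay al e).
Proof.
apply/integrableP; split.
  by apply/measurable_EFinP; apply: measurable_funTS; exact: measurable_decay.
have -> : (\int[mu]_(t in D) `|(EFin \o decay al e) t| =
    \int[mu]_(t in D) (decay al e t)%:E)%E.
  by apply: eq_integral => t _; rewrite /= ger0_norm// decay_ge0.
by apply: le_lt_trans (integral_decay_le al_lt1 al_gt) _; rewrite ltry.
Qed.

Lemma measurable_green i k : measurable_fun D (fun t => green t i k).
Proof.
apply: measurable_invmx => // [a b|t]; last first.
  by rewrite /= in_itv/= andbT => t0; exact: shifted_mx_unit.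
rewrite (_ : (fun t => _) = if P a && P b
  then (fun t => t * (m a * (a == b)%:R) + S a b) else fun=> (a == b)%:R); last first.
  by apply/funext => t; rewrite mxE; case: ifP => // _; rewrite mulrA.
by case: ifP => _ //; apply: measurable_funD => //; apply: measurable_funM.
Qed.

(** One term of the l^p norm is at most the whole norm. The factor in [m i] depends on the mesh, so
    the bound serves only for integrability in t. *)
Lemma green_le t i k : 0 < t -> P i -> P k ->
  green t i k <= m i `^ (- p^-1) * green_decay C th M p t.
Proof.
move=> t0 Pi Pk.
have := green_norm_le m_gt0 S_sym S_offdiag S_row C_gt0 th_gt0 th_lt1 mass_le
  faber_krahn p_gt1 p_lt t0 Pk.
have g0 j : 0 <= green t j k by exact: green_ge0.
rewrite powRN mulrC ler_pdivlMr ?powR_gt0 ?m_gt0//; apply: le_trans.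
have -> : green t i k * m i `^ p^-1 = (m i * green t i k `^ p) `^ p^-1.
  rewrite powRM ?powR_ge0 ?(ltW (m_gt0 Pi))// -powRrM mulfV ?gt_eqF//.
  by rewrite powRr1// mulrC.
have s0 j : P j -> 0 <= m j * green t j k `^ p.
  by move=> Pj; rewrite mulr_ge0 ?powR_ge0 ?(ltW (m_gt0 Pj)).
apply: ge0_ler_powR; rewrite ?nnegrE ?invr_ge0 ?(ltW p_gt0) ?s0 ?sumr_ge0//.
by rewrite (bigD1 i)//= lerDl; apply: sumr_ge0 => j /andP[/s0].
Qed.

Lemma integrable_green i k : P i -> P k ->
  mu.-integrable D (EFin \o (fun t => t `^ (- al) * green t i k)).
Proof.
move=> Pi Pk.
have mpow : measurable_fun D (fun t : R => t `^ (- al)).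
  by apply: measurable_funTS; exact: measurable_powR.
apply: (@le_integrable _ _ _ mu D _ _ (fun t => ((m i `^ (- p^-1) *
    (M + 1 + green_cst C th p) `^ p^-1)%:E * (decay al e t)%:E)%E)) => //.
- apply/measurable_EFinP; apply: measurable_funM => //; exact: measurable_green.
- move=> t; rewrite /= in_itv/= andbT => t0; rewrite lee_fin.
  rewrite [leLHS]ger0_norm ?mulr_ge0 ?powR_ge0 ?green_ge0//.
  apply: le_trans (ler_norm _); rewrite -mulrA -decayE mulrCA.
  by rewrite ler_wpM2l ?powR_ge0// green_le.
- by apply: integrableZl => //; exact: integrable_decay.
Qed.

Lemma frac_green_ge0 i k : P k -> 0 <= frac_green i k.
Proof.
move=> Pk; apply: Rintegral_ge0 => t; rewrite /= in_itv/= andbT => t0.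
by rewrite mulr_ge0 ?powR_ge0// green_ge0.
Qed.

Lemma frac_green_out i k : P k -> ~~ P i -> frac_green i k = 0.
Proof.
move=> Pk nPi; rewrite -[RHS](mul0r (fine (mu D))) -Rintegral_cst//.
apply: eq_Rintegral => t; rewrite inE/= in_itv/= andbT => t0.
by rewrite green_out// mulr0.
Qed.

(** Under the integral, symmetry turns row [i] into a column of the Green function; Hoelder's
    inequality and [green_norm_le] apply for each t, and only the scalar decay remains to be
    integrated. *)
Lemma frac_green_norm_le q i (a : 'I_n -> R) : p^-1 + q^-1 = 1 -> 0 < q -> P i ->
  (forall j, 0 <= a j) ->
  \sum_(j | P j) frac_green i j * (m j * a j) <=
  frac_green_cst * (\sum_(j | P j) m j * a j `^ q) `^ q^-1.
Proof.
move=> pq q0 Pi a0; set A := (_ `^ q^-1).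
have A0 : 0 <= A by exact: powR_ge0.
pose f j t := t `^ (- al) * green t i j.
have intf j : P j -> mu.-integrable D (EFin \o f j) by exact: integrable_green.
have intg : mu.-integrable D (EFin \o (fun t => (M + 1 + green_cst C th p) `^ p^-1 *
    A * decay al e t)).
  rewrite (_ : _ \o _ = fun t => (((M + 1 + green_cst C th p) `^ p^-1 * A)%:E *
    (decay al e t)%:E)%E); last exact/funext.
  by apply: integrableZl => //; exact: integrable_decay.
under eq_bigr do rewrite mulrC.
rewrite -(@Rintegral_lincomb _ _ _ mu _ (measurable_itv _) _ (index_enum _) P
  (fun j => m j * a j) f intf).
apply: (@le_trans _ _ (Rintegral mu D (fun t => (M + 1 + green_cst C th p) `^ p^-1 *
    A * decay al e t))).
  apply: le_Rintegral => //; first exact: integrable_lincomb.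
  move=> t; rewrite /= in_itv/= andbT => t0.
  rewrite mulrAC -decayE.
  rewrite (eq_bigr (fun j => t `^ (- al) * (m j * (green t j i * a j)))); last first.
    by move=> j _; rewrite /f green_sym//; ring.
  rewrite -mulr_sumr -mulrA ler_wpM2l ?powR_ge0//.
  have g0 j : 0 <= green t j i by exact: green_ge0.
  apply: (@le_trans _ _ ((\sum_(j | P j) m j * green t j i `^ p) `^ p^-1 * A)).
    by apply: hoelder_sum => // j Pj; rewrite ltW// m_gt0.
  by rewrite ler_wpM2r// green_norm_le.
rewrite RintegralZl//; last exact: integrable_decay.
rewrite /frac_green_cst mulrAC; apply: ler_wpM2r => //.
rewrite ler_wpM2l ?powR_ge0// -lee_fin /Rintegral fineK ?integral_decay_le//.
exact: (integrable_fin_num _ integrable_decay).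
Qed.

(* The fractional Green matrix is an integral of positive definite matrices. *)
Lemma frac_green_unit : exists N : 'M[R]_n, forall z : 'I_n -> R,
  (forall i, ~~ P i -> z i = 0) ->
  let w i := \sum_j N i j * z j in
  (forall i, ~~ P i -> w i = 0) /\
  forall i, P i -> \sum_(j | P j) frac_green i j * (m j * w j) = z i.
Proof.
pose G : 'M[R]_n := \matrix_(i, j) if P i && P j then frac_green i j * m j else (i == j)%:R.
have GE (w : 'I_n -> R) i : \sum_j G i j * w j =
    if P i then \sum_(j | P j) frac_green i j * (m j * w j) else w i.
  have [Pi|nPi] := boolP (P i); last first.
    rewrite (bigD1 i)//= mxE (negbTE nPi)/= eqxx mul1r big1 ?addr0// => j ji.
    by rewrite mxE (negbTE nPi)/= eq_sym (negbTE ji) mul0r.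
  rewrite (bigID P)/= [X in _ + X]big1 ?addr0 => [|j nPj].
    by apply: eq_bigr => j Pj; rewrite mxE Pi Pj/= mulrA.
  rewrite mxE (negbTE nPj) andbF; have [ij|_] := eqVneq i j; last by rewrite mul0r.
  by rewrite -ij Pi in nPj.
have uG : G \in unitmx.
  rewrite -unitmx_tr -row_free_unit -kermx_eq0.
  apply/eqP/row_matrixP => k0; rewrite row0.
  have : row k0 (kermx G^T) *m G^T = 0 by rewrite -row_mul mulmx_ker row0.
  move: (row _ _) => w w0; pose u i := w ord0 i.
  have uE i : \sum_j G i j * u j = 0.
    have /rowP/(_ i) := w0; rewrite !mxE => w0i; rewrite -[RHS]w0i.
    by apply: eq_bigr => j _; rewrite [G^T _ _]mxE mulrC.
  have u0 j : ~~ P j -> u j = 0 by move=> nPj; rewrite -[RHS](uE j) GE (negbTE nPj).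
  have Gu i : P i -> \sum_(j | P j) frac_green i j * (m j * u j) = 0.
    by move=> Pi; rewrite -[RHS](uE i) GE Pi.
  apply/rowP => i; rewrite mxE -/(u i); apply/eqP; apply: contraT => ui.
  have Pi : P i by apply: contraNT ui => /u0 ->.
  pose x j := m j * u j.
  pose f (jk : 'I_n * 'I_n) t := t `^ (- al) * green t jk.1 jk.2.
  pose Q (jk : 'I_n * 'I_n) := P jk.1 && P jk.2.
  have intf jk : Q jk -> mu.-integrable D (EFin \o f jk).
    by move=> /andP[]; exact: integrable_green.
  have int0 := @Rintegral_lincomb _ _ _ mu _ (measurable_itv _) _ (index_enum _) Q
    (fun jk => x jk.1 * x jk.2) f intf.
  have : 0 < Rintegral mu D (fun t => \sum_(jk | Q jk) x jk.1 * x jk.2 * f jk t).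
    apply: Rintegral_gt0 => //.
    - apply: (@lt_le_trans _ _ +oo%E); first exact: lt0y.
      rewrite leye_eq; apply/eqP; apply: etrans (lebesgue_measure_itv _) _.
      by rewrite /= lt0y.
    - exact: integrable_lincomb.
    - move=> t; rewrite /= in_itv/= andbT => t0.
      pose g j := \sum_(k | P k) green t j k * x k.
      have g0 j : ~~ P j -> g j = 0 by exact: green_sum_out.
      rewrite -(pair_big P P (fun j k => x j * x k * f (j, k) t))/=.
      rewrite (eq_bigr (fun j => t `^ (- al) * (x j * g j))); last first.
        by move=> j Pj; rewrite /g !mulr_sumr; apply: eq_bigr => k _; rewrite /f/=; ring.
      rewrite -mulr_sumr mulr_gt0 ?powR_gt0//.
      have Ag j (Pj : P j) : \sum_k shifted_mx P m S t j k * g k = x j.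
        exact: shifted_green_sum.
      have xg : \sum_(j | P j) x j * g j =
          t * \sum_(j | P j) m j * (g j * g j) + energy S g g.
        rewrite -(shifted_form m S_sym t g0 g0) big_mkcond/=.
        apply: eq_bigr => j _; case: ifPn => [/Ag ->|/g0 ->]; first exact: mulrC.
        by rewrite mul0r.
      have mgg j : P j -> 0 <= m j * (g j * g j).
        by move=> Pj; rewrite mulr_ge0 ?(ltW (m_gt0 Pj))// -expr2 sqr_ge0.
      have E0 := energy_ge0 S_sym S_offdiag S_row g.
      rewrite xg ltr_wpDr// mulr_gt0// lt0r sumr_ge0// andbT.
      apply: contra ui => /eqP/psumr_eq0P gg0.
      have : x i = 0.
        rewrite -(Ag i Pi) big1// => k _.
        have [Pk|/g0 ->] := boolP (P k); last by rewrite mulr0.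
        have /eqP := gg0 mgg k Pk; rewrite mulf_eq0 (gt_eqF (m_gt0 Pk))/= mulf_eq0 orbb.
        by move=> /eqP ->; rewrite mulr0.
      by move=> /eqP; rewrite mulf_eq0 (gt_eqF (m_gt0 Pi)).
  rewrite int0 -(pair_big P P (fun j k => x j * x k * frac_green j k))/= big1 ?ltxx//.
  move=> j Pj; rewrite (eq_bigr (fun k => x j * (frac_green j k * (m k * u k)))).
    by rewrite -mulr_sumr (Gu j Pj) mulr0.
  by move=> k _; rewrite /x; ring.
exists (invmx G) => z z0 w.
have Gw i : \sum_j G i j * w j = z i.
  have /matrixP/(_ i ord0) : G *m (invmx G *m \col_j z j) = \col_j z j by rewrite mulKVmx.
  rewrite !mxE => <-; apply: eq_bigr => j _; congr (_ * _); rewrite mxE.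
  by apply: eq_bigr => k _; rewrite mxE.
split=> i Pi; first by rewrite -[RHS](z0 i Pi) -Gw GE (negbTE Pi).
by rewrite -Gw GE Pi.
Qed.

End FractionalGreen.

(** * The discrete operators on nodal values *)

Section MeshOperators.
Context {R : realType} {d : nat} {Omega : set 'rV[R]_d}.
Variable T : triangulation Omega.
Hypothesis Omega_open : open Omega.
Hypothesis T_acute : acute T.
Local Notation J := 'I_(nnodes T).
Local Notation interior := (@interior_node _ _ _ T).
Local Notation massT := (@mass _ _ _ T).
Local Notation stiffT := (@stiff _ _ _ T).
Local Notation green t := (green interior massT stiffT t).
Local Notation mu := (@lebesgue_measure R).
Local Notation D := (`]0, +oo[%classic : set R).

Lemma interior_supportedP (z : J -> R[i]) :
  interior_supported z <-> forall j, ~~ interior j -> z j = 0.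
Proof.
split=> z0 j.
  by rewrite /interior_node notin_setE; exact: z0.
by move=> jO; apply: z0; rewrite /interior_node notin_setE.
Qed.

Lemma mass_neq0 (j : J) : (massT j)%:C%C != 0.
Proof. by rewrite (inj_eq (@complexI _)) gt_eqF// mass_gt0. Qed.

(** Since the lumped product is diagonal, testing with one nodal function isolates one nodal value,
    which gives the formula and its uniqueness. *)
Lemma A_h_cinterp (z : J -> R[i]) : interior_supported z ->
  A_h T (cinterp z) = cinterp (fun i => if interior i
    then - (\sum_j z j * (stiffT j i)%:C%C) / (massT i)%:C%C else 0).
Proof.
move=> z0; set f := fun i => _.
have f0 : interior_supported f.
  by apply/interior_supportedP => j nj; rewrite /f (negbTE nj).
have form (g w : J -> R[i]) : interior_supported w ->
    lumped_product T (cinterp g) (cinterp w) = - dirichlet T (cinterp z) (cinterp w) <->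
    \sum_(j | interior j) (g j - f j) * (w j)^*%C * (massT j)%:C%C = 0.
  move=> w0; rewrite lumped_cinterp dirichlet_cinterp.
  have -> : - (\sum_i \sum_j z i * (w j)^*%C * (stiffT i j)%:C%C) =
      \sum_(j | interior j) f j * (w j)^*%C * (massT j)%:C%C.
    rewrite exchange_big/= -sumrN [RHS]big_mkcond/=; apply: eq_bigr => j _.
    rewrite /f; have [_|nj] := boolP (interior j); last first.
      rewrite big1 ?oppr0// => i _.
      by rewrite (interior_supportedP w).1// conjc0 mulr0 mul0r.
    rewrite [RHS]mulrAC divfK ?mass_neq0// mulNr mulr_suml; congr (- _).
    by apply: eq_bigr => i _; rewrite mulrAC.
  under [X in _ <-> X = 0]eq_bigr do rewrite !mulrBl.
  by rewrite sumrB; split=> [->|/eqP]; rewrite ?subrr// subr_eq0 => /eqP.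
apply: xget_unique.
  split; first exact: S_h_cinterp.
  move=> v /S_hP[w w0 ->]; apply/form => //; apply: big1 => j _.
  by rewrite subrr !mul0r.
move=> v [/S_hP[g g0 ->] gz]; congr cinterp; apply/funext => k.
have [Pk|nk] := boolP (interior k); last first.
  by rewrite (interior_supportedP g).1// (interior_supportedP f).1.
pose w (j : J) : R[i] := (j == k)%:R.
have w0 : interior_supported w.
  apply/interior_supportedP => j nj; rewrite /w.
  by case: eqP => // jk; rewrite jk Pk in nj.
have := (form g w w0).1 (gz _ (S_h_cinterp Omega_open w0)).
rewrite (bigD1 k)//= big1 ?addr0 => [|j /andP[_ /negbTE jk]]; last first.
  by rewrite /w jk conjc0 mulr0 mul0r.
rewrite /w eqxx conjc1 mulr1 => /eqP; rewrite mulf_eq0 (negbTE (mass_neq0 k)) orbF.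
by rewrite subr_eq0 => /eqP.
Qed.

(** Multiplied by the masses, the resolvent equation becomes a system with the real matrix t M + S,
    whence the factor [massT j]. Real and imaginary parts decouple; [green_sum_solves] gives
    existence and [green_sum_unique] uniqueness. *)
Lemma resolvent_cinterp (t : R) (z : J -> R[i]) : 0 < t -> interior_supported z ->
  resolvent T t (cinterp z) = cinterp (fun i =>
    \sum_(j | interior j) z j * (green t i j * massT j)%:C%C).
Proof.
move=> t0 z0; set w := fun i => _.
have mass0 (i : J) : interior i -> 0 < massT i by move=> _; exact: mass_gt0.
have Ssym := @stiff_sym _ _ _ T; have Srow := @stiff_row _ _ _ T.
have Soff : forall i j : J, i != j -> stiffT i j <= 0 by exact: stiff_offdiag.
have w0 : interior_supported w.
  apply/interior_supportedP => j nj; rewrite /w big1// => k Pk.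
  by rewrite green_out// mul0r mulr0.
have eqn (y : J -> R[i]) : interior_supported y ->
    (fun x => t%:C%C * cinterp y x - A_h T (cinterp y) x) = cinterp z <->
    forall i, interior i -> y i * (t * massT i)%:C%C + \sum_j y j * (stiffT j i)%:C%C =
       z i * (massT i)%:C%C.
  move=> y0; rewrite A_h_cinterp//.
  rewrite (_ : (fun x => _) = cinterp (fun i => t%:C%C * y i - if interior i
    then - (\sum_j y j * (stiffT j i)%:C%C) / (massT i)%:C%C else 0)); last first.
    apply/funext => x; rewrite !cinterpE mulr_sumr -sumrB; apply: eq_bigr => j _.
    by rewrite mulrBl mulrA.
  split=> [/cinterp_inj yz i Pi|yz].
    rewrite -yz Pi mulNr opprK mulrDl divfK ?mass_neq0// rmorphM/=.
    by rewrite mulrA [_ * t%:C%C]mulrC.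
  congr cinterp; apply/funext => i; case: ifPn => [Pi|nPi]; last first.
    by rewrite (interior_supportedP y).1// (interior_supportedP z).1// mulr0 subr0.
  apply: (mulIf (mass_neq0 i)); rewrite -yz// mulNr opprK mulrDl divfK ?mass_neq0//.
  by rewrite rmorphM/= mulrA [_ * t%:C%C]mulrC.
have real_solves (u : J -> R) i : interior i ->
    let g k := \sum_(j | interior j) u j * (green t k j * massT j) in
    g i * (t * massT i) + \sum_j g j * stiffT j i = u i * massT i.
  move=> Pi g; have := green_sum_solves mass0 Ssym Soff Srow (fun j => massT j * u j) t0 Pi.
  rewrite [RHS]mulrC => <- /=.
  have gE k : \sum_(j | interior j) green t k j * (massT j * u j) = g k.
    by apply: eq_bigr => j _; rewrite mulrA mulrC.
  rewrite gE (mulrA t) (mulrC (g i)); congr (_ + _); apply: eq_bigr => j _.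
  by rewrite gE Ssym mulrC.
have real_unique (u g : J -> R) k : (forall j, ~~ interior j -> g j = 0) ->
    (forall i, interior i ->
      g i * (t * massT i) + \sum_j g j * stiffT j i = u i * massT i) ->
    g k = \sum_(j | interior j) u j * (green t k j * massT j).
  move=> g0 gu; rewrite (green_sum_unique mass0 Ssym Soff Srow _ t0 g0).
  apply: eq_bigr => i Pi; rewrite [RHS]mulrCA -gu// (mulrA t) (mulrC (g i)).
  by congr (_ * (_ + _)); apply: eq_bigr => j _; rewrite Ssym mulrC.
apply: xget_unique.
  split; first exact: S_h_cinterp.
  apply/eqn => // i Pi; apply: complexP.
    have Rew j : complex.Re (w j) =
        \sum_(k | interior k) complex.Re (z k) * (green t j k * massT k).
      by rewrite /w Re_sum; apply: eq_bigr => k _; rewrite ReMreal.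
    rewrite ReD Re_sum !ReMreal Rew; under [X in _ + X]eq_bigr do rewrite ReMreal Rew.
    exact: (real_solves (fun j => complex.Re (z j))).
  have Imw j : complex.Im (w j) =
      \sum_(k | interior k) complex.Im (z k) * (green t j k * massT k).
    by rewrite /w Im_sum; apply: eq_bigr => k _; rewrite ImMreal.
  rewrite ImD Im_sum !ImMreal Imw; under [X in _ + X]eq_bigr do rewrite ImMreal Imw.
  exact: (real_solves (fun j => complex.Im (z j))).
move=> v [/S_hP[y y0 ->] /eqn yz]; congr cinterp; apply/funext => k.
have {}yz := yz y0; apply: complexP.
  rewrite /w Re_sum (real_unique (fun j => complex.Re (z j)) (fun j => complex.Re (y j))).
  - by apply: eq_bigr => j _; rewrite ReMreal.
  - by move=> j nj; rewrite (interior_supportedP y).1.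
  - move=> i Pi; rewrite -!ReMreal -yz// ReD Re_sum; congr (_ + _).
    by apply: eq_bigr => j _; rewrite ReMreal.
rewrite /w Im_sum (real_unique (fun j => complex.Im (z j)) (fun j => complex.Im (y j))).
- by apply: eq_bigr => j _; rewrite ImMreal.
- by move=> j nj; rewrite (interior_supportedP y).1.
- move=> i Pi; rewrite -!ImMreal -yz// ImD Im_sum; congr (_ + _).
  by apply: eq_bigr => j _; rewrite ImMreal.
Qed.

End MeshOperators.

Section MeshFractionalPower.
Context {R : realType} {d : nat} {Omega : set 'rV[R]_d}.
Variable T : triangulation Omega.
Hypothesis Omega_open : open Omega.
Hypothesis T_acute : acute T.
Local Notation J := 'I_(nnodes T).
Local Notation Rd := 'rV[R]_d.
Local Notation leb := (lebesgue_rV d : {measure set 'rV[R]_d -> \bar R}).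
Local Notation interior := (@interior_node _ _ _ T).
Local Notation massT := (@mass _ _ _ T).
Local Notation stiffT := (@stiff _ _ _ T).
Local Notation green t := (green interior massT stiffT t).
Local Notation mu := (@lebesgue_measure R).
Local Notation D := (`]0, +oo[%classic : set R).
Variables (C th M : R).
Hypothesis C_gt0 : 0 < C.
Hypothesis th_gt0 : 0 < th.
Hypothesis th_lt1 : th < 1.
Hypothesis mass_le : \sum_(i | interior i) massT i <= M.
Hypothesis faber_krahn : forall u : J -> R, (forall i, ~~ interior i -> u i = 0) ->
  \sum_(i | interior i) massT i * u i ^+ 2 <=
  C * (\sum_(i | interior i && (u i != 0)) massT i) `^ th * energy stiffT u u.
Variable p : R.
Hypothesis p_gt1 : 1 < p.
Hypothesis p_lt : p < (1 - th)^-1.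
Variable al : R.
Let r := (1 - th)^-1.
Let e := (r - p) / (r - 1) / p.
Hypothesis al_gt0 : 0 < al.
Hypothesis al_lt1 : al < 1.
Hypothesis al_gt : 1 < al + e.
Local Notation frac_green := (frac_green interior massT stiffT al).

Let mass0 (i : J) : interior i -> 0 < massT i. Proof. by move=> _; exact: mass_gt0. Qed.
Let Ssym := @stiff_sym _ _ _ T.
Let Srow := @stiff_row _ _ _ T.
Let Soff (i j : J) : i != j -> stiffT i j <= 0. Proof. exact: stiff_offdiag. Qed.

Lemma Rintegral_resolvent (u h : J -> R) :
  Rintegral mu D (fun t => t `^ (- al) *
    \sum_i (\sum_(j | interior j) u j * (green t i j * massT j)) * h i) =
  \sum_i (\sum_(j | interior j) u j * (frac_green i j * massT j)) * h i.
Proof.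
pose f (ij : J * J) t := t `^ (- al) * green t ij.1 ij.2.
pose Q (ij : J * J) := interior ij.1 && interior ij.2.
have intf ij : Q ij -> mu.-integrable D (EFin \o f ij).
  move=> /andP[Pi Pj].
  exact: (integrable_green mass0 Ssym Soff Srow C_gt0 th_gt0 th_lt1 mass_le
    faber_krahn p_gt1 p_lt al_lt1 al_gt Pi Pj).
have lin := @Rintegral_lincomb _ _ _ mu _ (measurable_itv _) _ (index_enum _) Q
  (fun ij => u ij.2 * massT ij.2 * h ij.1) f intf.
have sumQ (F : J -> J -> R) : (forall i j, ~~ interior i -> interior j -> F i j = 0) ->
    \sum_i (\sum_(j | interior j) u j * (F i j * massT j)) * h i =
    \sum_(ij | Q ij) u ij.2 * massT ij.2 * h ij.1 * F ij.1 ij.2.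
  move=> F0; rewrite -(pair_big interior interior
    (fun i j => u j * massT j * h i * F i j))/= [LHS](bigID interior)/=.
  rewrite [X in _ + X]big1 ?addr0 => [|i nPi].
    by apply: eq_bigr => i Pi; rewrite mulr_suml; apply: eq_bigr => j Pj; ring.
  by rewrite big1 ?mul0r// => j Pj; rewrite F0// mul0r mulr0.
rewrite (sumQ frac_green); last first.
  by move=> i j nPi Pj; exact: (frac_green_out mass0).
rewrite -lin; apply: eq_Rintegral => t; rewrite inE/= in_itv/= andbT => t0.
rewrite (sumQ (green t)); last by move=> i j nPi Pj; rewrite green_out.
by rewrite mulr_sumr; apply: eq_bigr => ij _; rewrite mulrCA.
Qed.

Lemma neg_frac_power_cinterp (z : J -> R[i]) : interior_supported z ->
  neg_frac_power T al (cinterp z) = cinterp (fun i => (sin (pi * al) / pi)%:C%C *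
    \sum_(j | interior j) z j * (frac_green i j * massT j)%:C%C).
Proof.
move=> z0; apply/funext => x; rewrite /neg_frac_power cinterpE.
under [RHS]eq_bigr do rewrite -mulrA.
rewrite -mulr_sumr; congr (_ * _); apply: complexP.
  rewrite Re_sum; under [RHS]eq_bigr do rewrite ReMreal Re_sum.
  under [RHS]eq_bigr do under eq_bigr do rewrite ReMreal.
  rewrite -Rintegral_resolvent; apply: eq_Rintegral => t.
  rewrite inE/= in_itv/= andbT => t0; rewrite /re_fun mulrC ReMreal mulrC.
  rewrite resolvent_cinterp// cinterpE Re_sum; congr (_ * _); apply: eq_bigr => i _.
  by rewrite ReMreal Re_sum; congr (_ * _); apply: eq_bigr => j _; rewrite ReMreal.
rewrite Im_sum; under [RHS]eq_bigr do rewrite ImMreal Im_sum.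
under [RHS]eq_bigr do under eq_bigr do rewrite ImMreal.
rewrite -Rintegral_resolvent; apply: eq_Rintegral => t.
rewrite inE/= in_itv/= andbT => t0; rewrite /im_fun mulrC ImMreal mulrC.
rewrite resolvent_cinterp// cinterpE Im_sum; congr (_ * _); apply: eq_bigr => i _.
by rewrite ImMreal Im_sum; congr (_ * _); apply: eq_bigr => j _; rewrite ImMreal.
Qed.

Let ka := sin (pi * al) / pi : R.

Let ka_gt0 : 0 < ka.
Proof.
rewrite divr_gt0 ?pi_gt0// sin_gt0_pi// mulr_gt0 ?pi_gt0//=.
by rewrite gtr_pMr ?pi_gt0.
Qed.

(** Invertibility of the fractional Green matrix provides one preimage, so that the element chosen
    by [xget] satisfies its equation. Reading this equation at the nodes expresses the original
    values through those of the fractional power. *)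
Lemma frac_power_cinterp (ze : J -> R[i]) : interior_supported ze ->
  exists z : J -> R[i], [/\ interior_supported z, frac_power T al (cinterp ze) = cinterp z &
    forall i, ze i = ka%:C%C * \sum_(j | interior j) z j * (frac_green i j * massT j)%:C%C].
Proof.
move=> ze0.
have [N NP] := frac_green_unit mass0 Ssym Soff Srow C_gt0 th_gt0 th_lt1 mass_le
    faber_krahn p_gt1 p_lt al_lt1 al_gt.
pose z i := \sum_j ze j * (ka^-1 * N i j)%:C%C.
have Rez i : complex.Re (z i) = \sum_j N i j * (ka^-1 * complex.Re (ze j)).
  by rewrite /z Re_sum; apply: eq_bigr => j _; rewrite ReMreal; ring.
have Imz i : complex.Im (z i) = \sum_j N i j * (ka^-1 * complex.Im (ze j)).
  by rewrite /z Im_sum; apply: eq_bigr => j _; rewrite ImMreal; ring.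
have ze0' j : ~~ interior j -> ze j = 0 by exact: (interior_supportedP ze).1.
have [re0 reE] := NP (fun j => ka^-1 * complex.Re (ze j))
  (fun i nPi => etrans (congr1 (fun c => ka^-1 * complex.Re c) (ze0' i nPi)) (mulr0 _)).
have [im0 imE] := NP (fun j => ka^-1 * complex.Im (ze j))
  (fun i nPi => etrans (congr1 (fun c => ka^-1 * complex.Im c) (ze0' i nPi)) (mulr0 _)).
have z0 : interior_supported z.
  by apply/interior_supportedP => j nPj; apply: complexP; rewrite ?Rez ?Imz ?re0 ?im0.
have zE : neg_frac_power T al (cinterp z) = cinterp ze.
  rewrite neg_frac_power_cinterp//; congr cinterp; apply/funext => i.
  have [Pi|nPi] := boolP (interior i); last first.
    by rewrite ze0'// big1 ?mulr0// => j Pj; rewrite (frac_green_out mass0)// mul0r mulr0.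
  rewrite mulrC; apply: complexP; rewrite ?ReMreal ?ImMreal ?Re_sum ?Im_sum.
    rewrite -[RHS](mulVKf (lt0r_neq0 ka_gt0)) -reE// mulrC; congr (_ * _).
    by apply: eq_bigr => j Pj; rewrite ReMreal Rez; ring.
  rewrite -[RHS](mulVKf (lt0r_neq0 ka_gt0)) -imE// mulrC; congr (_ * _).
  by apply: eq_bigr => j Pj; rewrite ImMreal Imz; ring.
have [] : [set w | S_h T w /\ neg_frac_power T al w = cinterp ze] (frac_power T al (cinterp ze)).
  by apply: (xgetPex _ (ex_intro _ (cinterp z) _)); split=> //; exact: S_h_cinterp.
move=> /S_hP[y y0 yE]; rewrite yE neg_frac_power_cinterp// => /cinterp_inj ye.
by exists y; split=> // i; rewrite -ye.
Qed.

Lemma normc_nodal_le q (z ze : J -> R[i]) i : p^-1 + q^-1 = 1 -> 0 < q ->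
  interior_supported ze ->
  (forall i, ze i = ka%:C%C * \sum_(j | interior j) z j * (frac_green i j * massT j)%:C%C) ->
  Normc.normc (ze i) <= frac_green_cst C th M p al *
    (\sum_j massT j * Normc.normc (z j) `^ q) `^ q^-1.
Proof.
move=> pq q0 ze0 zeE.
have cst0 : 0 <= frac_green_cst C th M p al.
  by rewrite mulr_ge0 ?powR_ge0// addr_ge0// invr_ge0 subr_ge0 ltW.
have [Pi|nPi] := boolP (interior i); last first.
  by rewrite (interior_supportedP ze).1// Normc.normc0 mulr_ge0 ?powR_ge0.
have ka1 : ka <= 1.
  rewrite ler_pdivrMr ?pi_gt0// mul1r (le_trans (sin_le1 _))// (le_trans _ (pi_ge2 _))//.
  by rewrite ler1n.
rewrite zeE mulrC normcMreal ?(ltW ka_gt0)//.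
apply: (@le_trans _ _ (\sum_(j | interior j) frac_green i j * (massT j * Normc.normc (z j)))).
  apply: (@le_trans _ _ (\sum_(j | interior j)
      Normc.normc (z j * (frac_green i j * massT j)%:C%C))).
    rewrite -[leRHS]mulr1 ler_pM ?normc_ge0 ?(ltW ka_gt0)//; exact: normc_sum.
  apply: ler_sum => j Pj; rewrite normcMreal.
    by rewrite mulrC mulrA.
  by rewrite mulr_ge0 ?(ltW (mass_gt0 _))// frac_green_ge0.
apply: (le_trans (frac_green_norm_le mass0 Ssym Soff Srow C_gt0 th_gt0 th_lt1 mass_le
    faber_krahn p_gt1 p_lt al_lt1 al_gt pq q0 Pi (fun j => normc_ge0 (z j)))).
apply: ler_wpM2l => //.
have s0 j : 0 <= massT j * Normc.normc (z j) `^ q.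
  by rewrite mulr_ge0 ?powR_ge0// ltW// mass_gt0.
apply: ge0_ler_powR; rewrite ?nnegrE ?invr_ge0 ?(ltW q0) ?sumr_ge0//.
by rewrite [leRHS](bigID interior)/= lerDl sumr_ge0.
Qed.

(** The hat functions are nonnegative and sum to 1 or 0 at each point, so the interpolant nowhere
    exceeds a bound on the nodal values. *)
Lemma normc_cinterp_le (ze : J -> R[i]) B x : (forall i, Normc.normc (ze i) <= B) ->
  0 <= B -> Normc.normc (cinterp ze x) <= B.
Proof.
move=> zeB B0; rewrite cinterpE (le_trans (normc_sum _ _ _))//.
apply: (@le_trans _ _ (\sum_j B * hat (T := T) j x)).
  by apply: ler_sum => j _; rewrite normcMreal ?hat_ge0// ler_wpM2r ?hat_ge0.
by rewrite -mulr_sumr sum_hat; case: (_ \in _); rewrite ?mulr1// mulr0.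
Qed.

End MeshFractionalPower.

Section MeshNorms.
Context {R : realType} {d : nat} {Omega : set 'rV[R]_d}.
Variable T : triangulation Omega.
Hypothesis Omega_open : open Omega.
Local Notation J := 'I_(nnodes T).
Local Notation Rd := 'rV[R]_d.
Local Notation leb := (lebesgue_rV d : {measure set 'rV[R]_d -> \bar R}).

Lemma restrict_cinterp (z : J -> R[i]) : interior_supported z ->
  (fun x => (Normc.normc (cinterp z x))%:E) \_ Omega =
  (fun x => (Normc.normc (cinterp z x))%:E).
Proof.
move=> z0; apply/funext => x; rewrite patchE; case: ifPn => //.
rewrite notin_setE => xO.
have [[_ _ out] bnd] := S_h_cinterp Omega_open z0.
have [xc|xc] := pselect (closure Omega x); last by rewrite out// Normc.normc0.
rewrite bnd ?Normc.normc0//; split=> // /interior_subset; exact: xO.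
Qed.

Lemma nodal_norm_le (z : J -> R[i]) (q : R) : 0 < q -> interior_supported z ->
  (((\sum_j mass j * Normc.normc (z j) `^ q) `^ q^-1)%:E <=
   ((@lump_cst R d q) `^ q^-1)%:E * Lq_norm Omega q%:E (cinterp z))%E.
Proof.
move=> q0 z0; set I := (\int[leb]_x (Normc.normc (cinterp z x) `^ q)%:E)%E.
have -> : Lq_norm Omega q%:E (cinterp z) = (I `^ q^-1)%E.
  rewrite /Lq_norm (restrict_cinterp z0).
  rewrite Lnorm.unlock; apply: (congr1 (fun u => (u `^ q^-1)%E)).
  by apply: eq_integral => x _; rewrite /= ger0_norm// normc_ge0.
have lc0 := @lump_cst_gt0 R d q.
have I0 : (0 <= I)%E by apply: integral_ge0 => x _; rewrite lee_fin powR_ge0.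
rewrite -!poweR_EFin -poweRM//; last by rewrite lee_fin ltW.
have s0 : 0 <= \sum_j mass (T := T) j * Normc.normc (z j) `^ q.
  by apply: sumr_ge0 => j _; rewrite mulr_ge0 ?powR_ge0// ltW// mass_gt0.
apply: gt0_ler_poweR; rewrite ?invr_ge0 ?(ltW q0) ?in_itv/= ?leey ?andbT ?lee_fin//.
  by rewrite mule_ge0// lee_fin ltW.
exact: lumped_norm_le.
Qed.

End MeshNorms.

(** * Choice of exponents and uniform constants *)

(** Lowers the Faber-Krahn exponent from 2/d to [th], the bound [M] on the total mass absorbing the
    remaining power. *)
Lemma powR_le_interpolate {R : realType} (A M th s : R) : 0 <= A -> A <= M ->
  0 < th -> th <= s -> A `^ s <= M `^ (s - th) * A `^ th.
Proof.
move=> A0 AM th0 ths; have s0 : 0 < s by exact: lt_le_trans ths.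
have [->|A_neq0] := eqVneq A 0; first by rewrite !powR0 ?mulr0 ?gt_eqF.
rewrite -[in leLHS](subrK th s) [leLHS]powRD; last by rewrite A_neq0 implybT.
rewrite ler_wpM2r ?powR_ge0// ge0_ler_powR ?nnegrE ?subr_ge0//.
exact: le_trans AM.
Qed.

Lemma green_exponent {R : realType} (d q al : R) : 2 <= d -> d / 2 < q ->
  d / (2 * q) < al -> al < 1 ->
  let p := q / (q - 1) in
  exists th, [/\ 0 < th < 1, th <= 2 / d, 1 < p < (1 - th)^-1, p^-1 + q^-1 = 1 &
    1 < al + ((1 - th)^-1 - p) / ((1 - th)^-1 - 1) / p].
Proof.
move=> d2 dq dal al1 p; have d0 : 0 < d by exact: lt_le_trans d2.
have q1 : 1 < q by apply: le_lt_trans dq; rewrite ler_pdivlMr// mul1r.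
have q0 : 0 < q by exact: lt_trans q1.
have al0 : 0 < al by apply: lt_trans dal; rewrite divr_gt0 ?mulr_gt0.
have qal0 : 0 < q * al by exact: mulr_gt0.
have lt_th : (q * al)^-1 < 2 / d.
  rewrite -div1r ltr_pdivrMr// mulrAC ltr_pdivlMr// mul1r.
  by move: dal; rewrite ltr_pdivrMr ?mulr_gt0//; lra.
(* The interval between 1/(q al) and 2/d is nonempty exactly because al > d/(2q). The lower end
   yields q th al > 1, which is the integrability condition, and with al < 1 also th > 1/q, which is
   p < 1/(1 - th). *)
pose th := ((q * al)^-1 + 2 / d) / 2.
have : (q * al)^-1 < th by rewrite midf_lt.
have : th < 2 / d by rewrite midf_lt.
move: th => th th_s qal_th.
have th0 : 0 < th by apply: lt_trans qal_th; rewrite invr_gt0.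
have th1 : th < 1 by apply: (lt_le_trans th_s); rewrite ler_pdivrMr ?mul1r.
have q10 : 0 < q - 1 by rewrite subr_gt0.
have pV : p^-1 = 1 - q^-1 by rewrite /p; field; rewrite !gt_eqF.
have p1 : 1 < p by rewrite ltr_pdivlMr// mul1r gtrBl.
have p0 : 0 < p by exact: lt_trans p1.
have q_th : q^-1 < th.
  by apply: lt_trans qal_th; rewrite ltf_pV2 ?posrE// gtr_pMr.
have p_r : p < (1 - th)^-1.
  by rewrite -[p]invrK ltf_pV2 ?posrE ?invr_gt0 ?subr_gt0// pV; lra.
have eE : ((1 - th)^-1 - p) / ((1 - th)^-1 - 1) / p = 1 - (q * th)^-1.
  by rewrite /p; field; rewrite !gt_eqF ?subr_gt0.
exists th; rewrite th0 th1 p1 p_r (ltW th_s) eE pV subrK; split=> //.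
have : (q * th)^-1 < al.
  have qth0 : 0 < q * th by exact: mulr_gt0.
  move: qal_th; rewrite -(ltr_pM2r qal0) mulVf ?gt_eqF// => th_al.
  by rewrite -(ltr_pM2r qth0) mulVf ?gt_eqF// (_ : al * _ = th * (q * al))//; ring.
by lra.
Qed.

(** For a single mesh, but with a constant built only from [C], [th], [M], [p], [q], [al] and [d]:
    uniformity reduces to choosing [C] and [M] for the whole family. *)
Lemma mesh_sobolev {R : realType} {d : nat} {Omega : set 'rV[R]_d}
    (T : triangulation Omega) (C th M p q al : R) (v : 'rV[R]_d -> R[i]) :
  open Omega -> acute T -> 0 < C -> 0 < th < 1 ->
  \sum_(i | interior_node (T := T) i) mass (T := T) i <= M ->
  (forall u : 'I_(nnodes T) -> R, (forall i, ~~ interior_node i -> u i = 0) ->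
    \sum_(i | interior_node i) mass i * u i ^+ 2 <=
    C * (\sum_(i | interior_node i && (u i != 0)) mass i) `^ th *
    energy (stiff (T := T)) u u) ->
  1 < p < (1 - th)^-1 -> p^-1 + q^-1 = 1 -> 0 < q ->
  0 < al < 1 -> 1 < al + ((1 - th)^-1 - p) / ((1 - th)^-1 - 1) / p ->
  S_h T v ->
  (Lq_norm Omega +oo v <= (frac_green_cst C th M p al * @lump_cst R d q `^ q^-1)%:E *
     Lq_norm Omega q%:E (frac_power T al v))%E.
Proof.
move=> Omega_open T_acute C0 /andP[th0 th1] massM fk /andP[p1 pr] pq q0 /andP[al0 al1] ale.
move=> /S_hP[ze ze0 ->].
have [z [z0 -> zeE]] := frac_power_cinterp Omega_open T_acute C0 th0 th1 massM fk
  p1 pr al0 al1 ale ze0.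
set K := frac_green_cst _ _ _ _ _.
pose B := K * (\sum_j mass j * Normc.normc (z j) `^ q) `^ q^-1.
have nodal i : Normc.normc (ze i) <= B.
  exact: (normc_nodal_le T_acute C0 th0 th1 massM fk p1 pr al0 al1 ale i pq q0 ze0 zeE).
have K0 : 0 <= K.
  by rewrite mulr_ge0 ?powR_ge0// addr_ge0// invr_ge0 subr_ge0 ltW.
have B0 : 0 <= B by rewrite mulr_ge0 ?powR_ge0.
apply: (@le_trans _ _ B%:E).
  rewrite /Lq_norm restrict_cinterp// Lnorm.unlock; case: ifPn => // _.
  apply/ess_supP; apply: nearW => x; rewrite /= lee_fin ger0_norm ?normc_ge0//.
  exact: normc_cinterp_le.
rewrite /B EFinM [in leRHS]EFinM -muleA; apply: lee_wpmul2l; first by rewrite lee_fin.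
exact: nodal_norm_le.
Qed.

Theorem lemma28 (R : realType) (d : nat) (hd : d = 2%N \/ d = 3%N)
  (Omega : set 'rV[R]_d) (hOmega : bounded_polyhedral_domain Omega)
  (mu : R) (hmu : d%:R < mu) (hshape : shape_assumption Omega mu)
  (I : Type) (T : I -> triangulation Omega)
  (hreg : shape_regular T)
  (hinv : inverse_assumption T)
  (hacute : forall h : I, acute (T h))
  (q : R) (hq : d%:R / 2 < q)
  (alpha : R) (halpha : d%:R / (2 * q) < alpha) (halpha1 : alpha < 1) :
  exists2 C : R, 0 < C &
    forall (h : I) (v : 'rV[R]_d -> R[i]), S_h (T h) v ->
      (Lq_norm Omega +oo v <= C%:E * Lq_norm Omega q%:E (frac_power (T h) alpha v))%E.
Proof.
have d_ge2 : (2 <= d)%N by case: hd => ->.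
have d_gt0 : (0 < d)%N by exact: leq_trans d_ge2.
case: (hOmega) => Omega_open _ _ [N [_ Omega_le]] _.
have dR : 2 <= d%:R :> R by rewrite ler_nat.
have [th [th01 th_s p_bd pq al_e]] := green_exponent dR hq halpha halpha1.
have [th0 _] := andP th01.
have q0 : 0 < q by apply: lt_trans hq; rewrite divr_gt0 ?ltr0n.
have al01 : 0 < alpha < 1.
  by rewrite halpha1 (lt_trans _ halpha)// divr_gt0 ?mulr_gt0 ?ltr0n.
(* Boundedness gives an estimate for every number strictly beyond its threshold [N]; the covering
   cube also needs a nonnegative half-side. *)
pose m := Num.max N 0 + 1.
have m0 : 0 <= m by rewrite addr_ge0// le_max lexx orbT.
have Nm : N < m by rewrite ltr_pwDr// le_max lexx.
have Omega_m x k : Omega x -> `|x ord0 k| <= m.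
  move=> /(Omega_le m Nm); apply: le_trans.
  rewrite (_ : `|x| = mx_norm x)// mx_normrE.
  exact: (le_bigmax 0 (fun ij : 'I_1 * 'I_d => `|x ij.1 ij.2|) (ord0, k)).
have [V [mV OmegaV leV]] := bounded_cover m0 Omega_m.
pose M := d.+1%:R * (2 * m) ^+ d.
have massM h : \sum_(i | interior_node (T := T h) i) mass (T := T h) i <= M.
  by apply: (sum_mass_bound (T h) mV OmegaV); rewrite le_eqVlt; apply/orP; left; apply/eqP.
(* [M + 1] instead of [M] makes the power strictly positive. *)
pose C := @faber_krahn_cst R d * (M + 1) `^ (2 / d%:R - th).
have M0 : 0 <= M by rewrite mulr_ge0// exprn_ge0// mulr_ge0.
have C0 : 0 < C by rewrite mulr_gt0 ?faber_krahn_cst_gt0// powR_gt0// ltr_wpDl.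
have fk h (u : 'I_(nnodes (T h)) -> R) : (forall i, ~~ interior_node i -> u i = 0) ->
    \sum_(i | interior_node i) mass i * u i ^+ 2 <=
    C * (\sum_(i | interior_node i && (u i != 0)) mass i) `^ th *
    energy (stiff (T := T h)) u u.
  move=> u0; apply: (le_trans (mesh_faber_krahn Omega_open d_gt0 u0)).
  apply: ler_wpM2r.
    apply: energy_ge0 => [i j|i j|i]; [exact: stiff_sym|exact: stiff_offdiag|exact: stiff_row].
  rewrite /C -mulrA ler_wpM2l ?(ltW (faber_krahn_cst_gt0 _))//.
  apply: powR_le_interpolate => //.
    by apply: sumr_ge0 => i _; rewrite ltW// mass_gt0.
  apply: le_trans (le_trans (massM h) _); last by rewrite lerDl.
  rewrite big_mkcondr/=; apply: ler_sum => i _; case: ifP => // _.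
  by rewrite ltW// mass_gt0.
pose K := frac_green_cst C th M (q / (q - 1)) alpha * @lump_cst R d q `^ q^-1.
have K0 : 0 <= K.
  by rewrite !mulr_ge0 ?powR_ge0// addr_ge0// invr_ge0 subr_ge0 ltW.
(* [K] is only known to be nonnegative. *)
exists (K + 1) => [|h v vS]; first by rewrite ltr_wpDl.
apply: (le_trans (mesh_sobolev Omega_open (hacute h) C0 th01 (massM h) (@fk h) p_bd pq q0
  al01 al_e vS)).
by apply: lee_wpmul2r; [exact: Lnorm_ge0|rewrite lee_fin lerDl].
Qed.
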